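(* Let $f\in\mathcal N=L^2(\Omega,L^2(\partial D))$, let $\{q_k\}_{k\ge1}\subset D$ be the parameter sequence consecutively obtained by applying the statistical maximal selection principle to $f_\omega$, let $\{\tilde K_{q_k}\}$ be the corresponding multiple kernels and let $\{E_k\}$ be their consecutive Gram–Schmidt orthonormalization (all defined in the context), so that $f_\omega=\sum_{k=1}^\infty\langle f_\omega,E_k\rangle E_k$ in $\mathcal N$ (the SPOAFD2 expansion). Then, with accordingly determined coefficients $c_k(\omega)$, $k\ge1$, depending on $\omega$, $$u_{f_\omega}=\sum_{k=1}^\infty\langle f_\omega,E_k\rangle u_{E_k}=\sum_{k=1}^\infty c_k(\omega)\,\tilde K_{q_k},$$ where the equality of $u_{f_\omega}$ with the expansion is in the sense of $\mathcal N$ (functions on $D$ being identified with their boundary limit functions on $\partial D$), and in the last series $\tilde K_{q_k}$ is regarded as a function on $D$.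
   Context: $(\Omega,\mathcal F,\mathbb P)$ is a probability space and $\mathbb E$ is expectation. All functions are real valued. $f_\omega=f(\cdot,\omega)$. One of the following settings is fixed. (i) Dirichlet problem on the ball: $D=B_1$ is the open unit ball of $\mathbb R^{n+1}$, $\partial D$ is the unit sphere with normalized surface measure $\sigma$, and for $g\in L^2(\partial D)$ the lift is $u_g(x)=\int_{\partial B_1}P_x(y)g(y)\,d\sigma(y)$, $x\in B_1$, where $P_x(y)=\frac{1-|x|^2}{|x-y|^{n+1}}$ is the Poisson kernel. (ii) Dirichlet problem on the half-space: $D=\mathbb R^{1+n}_+=\{(x_0,\underline x):x_0>0,\ \underline x\in\mathbb R^n\}$, $\partial D=\mathbb R^n$ with Lebesgue measure, $u_g(x)=\int_{\mathbb R^n}P_x(\underline y)g(\underline y)\,d\underline y$ with $P_x(\underline y)=c_n\frac{x_0}{(x_0^2+|\underline x-\underline y|^2)^{(n+1)/2}}$, $c_n$ normalizing the integral to $1$. (iii) Cauchy problem for the heat equation: $D=\mathbb R^{1+n}_+=\{(t,\underline x):t>0,\ \underline x\in\mathbb R^n\}$, $\partial D=\mathbb R^n$ with Lebesgue measure, $u_g(t,\underline x)=\int_{\mathbb R^n}\varphi_t(\underline x-\underline y)g(\underline y)\,d\underline y$, $\varphi_t(\underline x)=(4\pi t)^{-n/2}e^{-|\underline x|^2/(4t)}$. The random function $u_{f_\omega}$ is the solution of the Dirichlet problem for the Laplace equation with random boundary data $f$ (in (i), (ii)) or of the heat equation with random initial data $f$ (in (iii)). $H^2(D)$ denotes the corresponding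 Hardy space $\{u_g: g\in L^2(\partial D)\}$. It is identified isometrically with $L^2(\partial D)$ through boundary limits ($u_g\leftrightarrow g$) and carries the inner product $\langle u_g,u_h\rangle=\langle g,h\rangle_{L^2(\partial D)}$. It is a reproducing kernel Hilbert space on $D$; its reproducing kernel at $q\in D$ is denoted $K_q$, and the boundary function of $K_q$, also denoted $K_q$, is the Poisson kernel $P_q$ in (i), (ii), and $\varphi_t(\underline x-\cdot)$ for $q=(t,\underline x)$ in (iii). $\langle\cdot,\cdot\rangle$ is the inner product of $L^2(\partial D)$ (equivalently of $H^2(D)$). $\mathcal N=L^2(\Omega,L^2(\partial D))$ is the Hilbert space of $L^2(\partial D)$-valued random variables $f$ with $\|f\|_{\mathcal N}^2=\mathbb E\|f_\omega\|_{L^2(\partial D)}^2<\infty$; $L^2(\Omega,H^2(D))$ is defined in the same way with $H^2(D)$ in place of $L^2(\partial D)$, and is embedded in $\mathcal N$ through boundary limits. Multiple kernels: for a sequence $(q_k)$ in $D$ (repetitions allowed) let $l(k)$ be the number of occurrences of $q_k$ in $(q_1,\dots,q_k)$. The multiple kernel $\tilde K_{q_k}$ is the $(l(k)-1)$-th order directional derivative of $q\mapsto K_q$ at $q=q_k$ (so $\tilde K_{q_k}=K_{q_k}$ if $l(k)=1$); it is regarded as an element of $H^2(D)$ or, via its boundary function, of $L^2(\partial D)$. $(E_1,\dots,E_k)$ is the Gram–Schmidt orthonormalization of $(\tilde K_{q_1},\dots,\tilde K_{q_k})$. Statistical maximal selection principle: the $q_k$ are chosen inductively. For $q\in D\setminus\{q_1,\dots,q_{k-1}\}$,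 let $E_k^q$ be the last vector of the Gram–Schmidt orthonormalization of $(\tilde K_{q_1},\dots,\tilde K_{q_{k-1}},K_q)$. At step $k$, $q_k$ (and, if it is a repetition, the direction of differentiation) is chosen so that $$\mathbb E|\langle f_\omega,E_k\rangle|^2=\sup\{\mathbb E|\langle f_\omega,E_k^q\rangle|^2:q\in D,\ q\ne q_1,\dots,q_{k-1}\},$$ with $\mathbb E|\langle f_\omega,E_k^{q^{(l)}}\rangle|^2$ tending to this supremum along some sequence $q^{(l)}\to q_k$ of points distinct from $q_1,\dots,q_{k-1}$.
   Formalization: In the last series the coefficients also depend on the truncation: the m-th partial sum of the expansion is written as the sum over k≤m of c_{m,k}(ω) K̃_{q_k}, and these sums converge to u_f in N; a single sequence c_k(ω) with convergence in N fails in general. *)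

(* Defs.v *)
From HB Require Import structures.
From mathcomp Require Import all_boot all_order all_algebra.
From mathcomp Require Import all_classical all_reals all_analysis.
From mathcomp Require Import measurable_realfun.

Set Implicit Arguments.
Unset Strict Implicit.
Unset Printing Implicit Defensive.

Import Order.TTheory GRing.Theory Num.Theory.
Import numFieldNormedType.Exports.

Local Open Scope classical_set_scope.
Local Open Scope ring_scope.

(* Points of the domains live in ['rV[R]_n.+1], which carries the topology and
   the vector operations; boundary variables, which are integrated, live in
   [n.-tuple R], which carries the product sigma-algebra. *)

Section euclidean.
Context {R : realType}.

Definition vec n (y : n.-tuple R) : 'rV[R]_n := \row_i tnth y i.

(* The library's norm on ['rV[R]_n] is the sup norm. *)
Definition enorm n (x : 'rV[R]_n) : R := Num.sqrt (\sum_i x ord0 i ^+ 2).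

Definition tcons n (p : R * n.-tuple R) : n.+1.-tuple R :=
  [tuple of p.1 :: p.2].

Lemma measurable_tcons n : measurable_fun setT (@tcons n).
Proof. exact: (measurable_cons measurable_fst measurable_snd). Qed.

Lemma measurable_invr : measurable_fun setT (@GRing.inv R).
Proof.
rewrite -(setvU [set 0]); apply/measurable_funU => //.
  exact: measurableC.
split; last exact: measurable_fun_set1.
apply: open_continuous_measurable_fun => [|x /set_mem/eqP x0].
  exact/closed_openC/accessible_closed_set1/hausdorff_accessible/Rhausdorff.
exact: inv_continuous.
Qed.

Lemma measurable_enorm n : measurable_fun setT (fun y : n.-tuple R => enorm (vec y)).
Proof.
apply: (@measurableT_comp _ _ _ _ _ _ (@Num.sqrt R)).
  apply: continuous_measurable_fun.
  exact: sqrt_continuous.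
apply: measurable_sum => i; apply: measurable_funX.
rewrite (_ : (fun _ => _) = (@tnth n R ^~ i)); first exact: measurable_tnth.
by apply/funext => y; rewrite mxE.
Qed.

(* y / |y| *)
Definition radial n (y : n.-tuple R) : n.-tuple R :=
  [tuple tnth y i / enorm (vec y) | i < n].

Lemma measurable_radial n : measurable_fun setT (@radial n).
Proof.
apply/measurable_fun_tnthP => i.
rewrite (_ : _ \o _ = fun y => tnth y i * (enorm (vec y))^-1); last first.
  by apply/funext => y /=; rewrite tnth_mktuple.
apply: measurable_funM; first exact: measurable_tnth.
apply: measurableT_comp (@measurable_enorm n).
exact: measurable_invr.
Qed.

Definition uball n : set (n.-tuple R) := [set y | enorm (vec y) < 1].

Lemma measurable_uball n : measurable (@uball n).
Proof.
rewrite -[X in measurable X]setTI.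
exact: (measurable_enorm measurableT (measurable_itv `]-oo, 1[)).
Qed.

End euclidean.

Section lebesgue_tuple.
Context {R : realType}.

Section step.
Variables (n : nat) (m : {sigma_finite_measure set (n.-tuple R) -> \bar R}).

Definition lebesgue_step : set (n.+1.-tuple R) -> \bar R :=
  pushforward ((@lebesgue_measure R) \x m)%E (@tcons R n).

Let lebesgue_step0 : lebesgue_step set0 = 0%E.
Proof. by rewrite /lebesgue_step /pushforward preimage_set0 measure0. Qed.

Let lebesgue_step_ge0 A : (0 <= lebesgue_step A)%E.
Proof. by rewrite /lebesgue_step /pushforward measure_ge0. Qed.

Let lebesgue_step_sigma_additive : semi_sigma_additive lebesgue_step.
Proof.
have mt := @measurable_tcons R n.
move=> F mF tF mUF; rewrite /lebesgue_step /pushforward preimage_bigcup.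
apply: measure_semi_sigma_additive.
- by move=> k; rewrite -[X in measurable X]setTI; exact: mt.
- apply/trivIsetP => /= i j _ _ ij; rewrite -preimage_setI.
  by move/trivIsetP : tF => /(_ _ _ _ _ ij) ->//; rewrite preimage_set0.
- by rewrite -preimage_bigcup -[X in measurable X]setTI; exact: mt.
Qed.

HB.instance Definition _ := isMeasure.Build _ _ _ lebesgue_step
  lebesgue_step0 lebesgue_step_ge0 lebesgue_step_sigma_additive.

Let lebesgue_step_sigma_finite : sigma_finite setT lebesgue_step.
Proof.
have [F FT Ffin] : sigma_finite setT ((@lebesgue_measure R) \x m)%E.
  have /sigma_finiteP[F [FT Fnd Foo]] := sigma_finiteT (@lebesgue_measure R).
  have /sigma_finiteP[G [GT Gnd Goo]] := sigma_finiteT m.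
  exists (fun k => F k `*` G k).
    rewrite -setXTT FT GT predeqE => -[x y]; split.
      move=> [/= [k _ Fkx] [l _ Gly]]; exists (maxn k l) => //; split.
      - by move: x Fkx; exact/subsetPset/Fnd/leq_maxl.
      - by move: y Gly; exact/subsetPset/Gnd/leq_maxr.
    by move=> [k _ []/= ? ?]; split; exists k.
  move=> k; have [? ?] := Foo k; have [? ?] := Goo k.
  split; first exact: measurableX.
  by rewrite product_measure1E// lte_mul_pinfty// ge0_fin_numE.
pose g (t : n.+1.-tuple R) := (tnth t ord0, [tuple of behead t]).
have mg : measurable_fun setT g.
  apply: measurable_fun_pair; [exact: measurable_tnth|exact: measurable_behead].
have gK p : g (tcons p) = p.
  by case: p => a t; rewrite /g /tcons /=; congr pair; exact/val_inj.
exists (fun i => g @^-1` F i).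
  by rewrite -preimage_bigcup -FT preimage_setT.
move=> i; have [mF Fi] := Ffin i; split.
  by rewrite -[X in measurable X]setTI; exact: mg.
rewrite /lebesgue_step /pushforward -comp_preimage.
by rewrite (_ : g \o _ = id)//; apply/funext => p /=; exact: gK.
Qed.

HB.instance Definition _ :=
  Measure_isSigmaFinite.Build _ _ _ lebesgue_step lebesgue_step_sigma_finite.

End step.

Fixpoint lebesgue_tuple n : {sigma_finite_measure set (n.-tuple R) -> \bar R} :=
  if n is k.+1 then lebesgue_step (lebesgue_tuple k) else dirac [tuple].

End lebesgue_tuple.

Section sphere_measure.
Context {R : realType} (n : nat).

(* The normalized surface measure of the unit sphere of R^n, as a measure on
   R^n carried by the sphere: the mass of [A] is the proportion of the volume
   of the unit ball occupied by the points [y] with y / |y| in [A]. *)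
Definition sphere_measure : set (n.-tuple R) -> \bar R :=
  pushforward
    (mscale (`|fine (@lebesgue_tuple R n (@uball R n))|^-1)%:nng
      (mrestr (@lebesgue_tuple R n) (@measurable_uball R n)))
    (@radial R n).

Let sphere_measure0 : sphere_measure set0 = 0%E.
Proof. by rewrite /sphere_measure /pushforward preimage_set0 measure0. Qed.

Let sphere_measure_ge0 A : (0 <= sphere_measure A)%E.
Proof. by rewrite /sphere_measure /pushforward measure_ge0. Qed.

Let sphere_measure_sigma_additive : semi_sigma_additive sphere_measure.
Proof.
have mt := @measurable_radial R n.
move=> F mF tF mUF; rewrite /sphere_measure /pushforward preimage_bigcup.
apply: measure_semi_sigma_additive.
- by move=> k; rewrite -[X in measurable X]setTI; exact: mt.
- apply/trivIsetP => /= i j _ _ ij; rewrite -preimage_setI.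
  by move/trivIsetP : tF => /(_ _ _ _ _ ij) ->//; rewrite preimage_set0.
- by rewrite -preimage_bigcup -[X in measurable X]setTI; exact: mt.
Qed.

HB.instance Definition _ := isMeasure.Build _ _ _ sphere_measure
  sphere_measure0 sphere_measure_ge0 sphere_measure_sigma_additive.

End sphere_measure.

Variant problem := DirichletBall | DirichletHalfSpace | CauchyHeat.

Section problems.
Context {R : realType} (n : nat).

Definition bdim (s : problem) : nat :=
  if s is DirichletBall then n.+1 else n.

(* The first coordinate is x_0, resp. t, in the unbounded cases. *)
Definition domain (s : problem) : set 'rV[R]_n.+1 :=
  match s with
  | DirichletBall => [set x | enorm x < 1]
  | DirichletHalfSpace | CauchyHeat => [set x | 0 < x ord0 ord0]
  end.

Definition bmeasure (s : problem) :
    {measure set ((bdim s).-tuple R) -> \bar R} :=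
  match s with
  | DirichletBall => @sphere_measure R n.+1
  | DirichletHalfSpace | CauchyHeat => @lebesgue_tuple R n
  end.

(* (x_0, x_1, ..., x_n) |-> (x_1, ..., x_n) *)
Definition base_pt (x : 'rV[R]_n.+1) : 'rV[R]_n := \row_i x ord0 (lift ord0 i).

Definition poisson_ball (x : 'rV[R]_n.+1) (y : n.+1.-tuple R) : R :=
  (1 - enorm x ^+ 2) / enorm (x - vec y) ^+ n.+1.

(* c_n; by scaling it normalizes every P_x. *)
Definition poisson_cst : R :=
  (\int[@lebesgue_tuple R n]_y
     ((1 + enorm (vec y) ^+ 2) `^ (n.+1%:R / 2))^-1)^-1.

Definition poisson_half_space (x : 'rV[R]_n.+1) (y : n.-tuple R) : R :=
  poisson_cst * (x ord0 ord0 /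
    (x ord0 ord0 ^+ 2 + enorm (base_pt x - vec y) ^+ 2) `^ (n.+1%:R / 2)).

Definition heat_kernel (x : 'rV[R]_n.+1) (y : n.-tuple R) : R :=
  let t := x ord0 ord0 in
  (4 * pi * t) `^ (- (n%:R / 2)) *
    expR (- (enorm (base_pt x - vec y) ^+ 2 / (4 * t))).

Definition repr_kernel (s : problem) : 'rV[R]_n.+1 -> (bdim s).-tuple R -> R :=
  match s with
  | DirichletBall => poisson_ball
  | DirichletHalfSpace => poisson_half_space
  | CauchyHeat => heat_kernel
  end.

End problems.

Arguments domain {R} n s.
Arguments bmeasure {R} n s.
Arguments repr_kernel {R} n s.

Section L2.
Context {R : realType} {d : measure_display} {Y : measurableType d}.
Variable mu : {measure set Y -> \bar R}.
Implicit Types g h : Y -> R.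

Definition inner g h : R := \int[mu]_y (g y * h y).

Definition L2norm g : \bar R := 'N[mu]_2%:E[EFin \o g].

Definition L2 : set (Y -> R) := [set g | g \in Lfun mu 2%:E].

Section hardy.
Variables (X : Type) (D : set X) (K : X -> Y -> R).

(* u_g, for the Poisson or heat kernel [K] *)
Definition lift_fun g (x : X) : R := \int[mu]_y (K x y * g y).

(* The norm of H^2(D) = {u_g}, transported from L2 of the boundary: it is
   ||g|| for U = u_g on D, and +oo if U is not in H^2(D). *)
Definition hardy_norm (U : X -> R) : \bar R :=
  ereal_inf [set L2norm g |
    g in [set g | L2 g /\ forall x, D x -> U x = lift_fun g x]].

End hardy.

Section random.
Context {d' : measure_display} {Omega : measurableType d'}.
Variable P : probability Omega R.

(* L^2(Omega, L^2). As L^2 is separable here, its Borel sigma-algebra is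
   generated by the balls, so that Borel measurability of [f] is measurability
   of the distances to fixed elements. *)
Definition random_L2 (f : Omega -> Y -> R) : Prop :=
  [/\ forall w, L2 (f w),
      forall g, L2 g ->
        measurable_fun setT (fun w => L2norm (fun y => f w y - g y)) &
      (\int[P]_w (L2norm (f w) ^+ 2) < +oo)%E].

(* E |<f, e>|^2 *)
Definition energy (f : Omega -> Y -> R) (e : Y -> R) : \bar R :=
  (\int[P]_w ((inner (f w) e) ^+ 2)%:E)%E.

(* S_m -> f in L^2(Omega, L^2) *)
Definition cvg_random_L2 (S : nat -> Omega -> Y -> R) (f : Omega -> Y -> R) :=
  (\int[P]_w (L2norm (fun y => f w y - S m w y)%R ^+ 2))%E @[m --> \oo]
    --> 0%E.

(* U_m -> V in L^2(Omega, H^2(D)) *)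
Definition cvg_random_H2 (X : Type) (D : set X) (K : X -> Y -> R)
    (U : nat -> Omega -> X -> R) (V : Omega -> X -> R) :=
  (\int[P]_w (hardy_norm D K (fun x => V w x - U m w x)%R ^+ 2))%E @[m --> \oo]
    --> 0%E.

End random.

(* A vector which depends linearly on its predecessors contributes 0. *)
Definition gs_step (es : seq (Y -> R)) g : seq (Y -> R) :=
  let r y := g y - \sum_(e <- es) inner g e * e y in
  rcons es (fun y => (Num.sqrt (inner r r))^-1 * r y).

Definition gram_schmidt (gs : seq (Y -> R)) : seq (Y -> R) :=
  foldl gs_step [::] gs.

Definition gs_last (gs : seq (Y -> R)) : Y -> R :=
  last (cst 0) (gram_schmidt gs).

End L2.

Section selection.
Context {R : realType} {d : measure_display} {Y : measurableType d} {N : nat}.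
Variables (mu : {measure set Y -> \bar R}).
Variables (D : set 'rV[R]_N) (K : 'rV[R]_N -> Y -> R).
Variables (q v : nat -> 'rV[R]_N).

(* l(k) - 1, the number of earlier occurrences of q_k (k starts from 0) *)
Definition mult k : nat := count_mem (q k) (mkseq q k).

(* The derivative of order l(k) - 1 at q_k of p |-> K_p in the direction v_k,
   as a boundary function; v_k is irrelevant if q_k is not a repetition. *)
Definition mkernel k : Y -> R :=
  fun y => ((fun s : R => K (q k + s *: v k) y)^`(mult k))%classic 0.

Definition E_ k : Y -> R := gs_last mu (mkseq mkernel k.+1).

Definition E_cand k (p : 'rV[R]_N) : Y -> R :=
  gs_last mu (rcons (mkseq mkernel k) (K p)).

Definition max_selection {d' : measure_display} {Omega : measurableType d'}
    (P : probability Omega R) (f : Omega -> Y -> R) : Prop :=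
  forall k, let admissible := [set p | D p /\ p \notin mkseq q k] in
    let best := ereal_sup [set energy mu P f (E_cand k p) | p in admissible] in
  [/\ D (q k), ((0 < mult k)%N -> enorm (v k) = 1), energy mu P f (E_ k) = best &
      exists z : nat -> 'rV[R]_N,
        [/\ forall i, admissible (z i),
            z i @[i --> \oo] --> q k &
            energy mu P f (E_cand k (z i)) @[i --> \oo] --> best]].

(* If E_k = sum_(j <= k) a_(k,j) Kt_j, this is the coefficient of Kt_j in the
   partial sum over k < m of the <f_w, E_k> E_k. It depends on m: the multiple
   kernels span, but need not form a basis. *)
Definition kernel_coef {Omega : Type} (f : Omega -> Y -> R)
    (a : nat -> nat -> R) m j (w : Omega) : R :=
  \sum_(j <= k < m) inner mu (f w) (E_ k) * a k j.

End selection.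

(* Main.v *)
Require Import Defs.
From HB Require Import structures.
From mathcomp Require Import all_boot all_order all_algebra.
From mathcomp Require Import all_classical all_reals all_analysis.
From mathcomp Require Import measurable_realfun.
From mathcomp Require Import ring lra.

(** The expansion converges because a residual which no kernel detects must
    vanish, and the maximal selection leaves a residual that kernels detect less
    and less.

    Let [r_k] be the residual of [f_w] after projection on [E_0, ..., E_(k-1)].
    By Bessel's inequality, integrated over [w], the energies
    [E |<f_w, E_k>|^2] have a finite sum, hence tend to 0. By the selection
    principle they dominate [E |<r_k, K_p>|^2], up to the factor [|K_p|^2], for
    every point [p] of the domain; if [p] has been selected before step [k], then
    [<r_k, K_p>] even vanishes ([residual_energy_le]). For fixed [w] the numbers
    [<r_k, K_p>] converge, again by Bessel's inequality, and Fatou's lemma shows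
    that their limit is 0 for almost every [w]. As there are countably many
    rational points, this holds almost surely for all rational [p] at once.

    For such a [w], the functions [g] with [<r_k, g> -> 0] form a linear class
    closed under dominated pointwise limits ([weak_null_closed_class]). A class
    of this kind that contains the kernels at all rational points is all of L2
    ([kernel_total]). So it contains [f_w], and [|r_k|^2 = <r_k, f_w>] tends to
    0. As [|r_k|^2 <= |f_w|^2], dominated convergence gives convergence in the
    mean over [w]. The Hardy norm of [u_g] is at most the norm of [g], which
    carries the convergence over to the lifts; and unfolding the Gram-Schmidt
    recursion expresses the [E_k] by the multiple kernels.

    For totality, kernels are turned into families that are closed under
    products. Difference quotients in [s] lead from [(s + rho)^-p] to
    [(s + rho)^-(p + 1)], and [(1 + rho / s)^-(p + j)] tends to [exp (- a rho)]
    when [j / s] tends to [a] ([closed_class_exp]). In the half-space, with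
    [rho = |x - y|^2] and [s] the square of the height, this turns Poisson kernels
    into Gaussians; the heat kernels are Gaussians from the start. On the sphere
    [|r e - y|^2] is an affine function of [e . y], and one obtains the
    exponentials [exp (2 e . y)]. A family that is closed under products and
    generates the Borel sets is total by a functional monotone class argument
    ([multiplicative_total]).

    That multiple kernels are square integrable rests on the fact that the
    logarithmic derivative of a kernel along a line is a rational function of the
    parameter, with coefficients that grow slowly in [y]; every derivative is
    therefore the product of the kernel and a function of slow growth
    ([derive1n_log_rational], [L2_iterated_derivative]). *)

Import Order.TTheory GRing.Theory Num.Theory.
Import numFieldNormedType.Exports.

Set Implicit Arguments.
Unset Strict Implicit.
Unset Printing Implicit Defensive.

Local Open Scope classical_set_scope.
Local Open Scope ring_scope.


(** * The space L2 and its inner product *)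

Section L2_theory.
Context {R : realType} {d : measure_display} {Y : measurableType d}.
Variable mu : {measure set Y -> \bar R}.
Implicit Types f g h : Y -> R.

Lemma L2_measurable g : L2 mu g -> measurable_fun setT g.
Proof. by rewrite /L2/= inE => /andP[+ _]; rewrite inE. Qed.

Lemma L2_sqr_integrable g : L2 mu g ->
  mu.-integrable setT (EFin \o (fun y => g y ^+ 2)).
Proof. exact: Lfun2_integrable_sqr. Qed.

Lemma sqr_L2norm g : (L2norm mu g ^+ 2 = \int[mu]_y (g y ^+ 2)%:E)%E.
Proof.
transitivity (L2norm mu g `^ 2)%E.
  rewrite /L2norm; move: (Lnorm_ge0 mu 2%:E (EFin \o g)).
  case: ('N[mu]_2%:E[EFin \o g])%E => [r||]//.
    by rewrite lee_fin => r0; rewrite /= powR_mulrn.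
  by rewrite poweRyr.
rewrite /L2norm powR_Lnorm//.
by apply: eq_integral => y _; rewrite /= powR_mulrn// real_normK ?num_real.
Qed.

Lemma L2I g : measurable_fun setT g -> (\int[mu]_y (g y ^+ 2)%:E < +oo)%E ->
  L2 mu g.
Proof.
move=> mg goo; rewrite /L2/= inE; apply/andP; split; rewrite inE//= /finite_norm.
have := Lnorm_ge0 mu 2%:E (EFin \o g); move: goo; rewrite -sqr_L2norm /L2norm.
by case: ('N[mu]_2%:E[EFin \o g])%E => [r _ _||//]; rewrite ?ltry.
Qed.

Lemma L2_mul_integrable f g : L2 mu f -> L2 mu g ->
  mu.-integrable setT (EFin \o (fun y => f y * g y)).
Proof. by move=> f2 g2; apply/Lfun1_integrable; exact: Lfun2_mul_Lfun1. Qed.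

(** The parallelogram bound [(s + t)^2 <= 2 s^2 + 2 t^2] suffices. *)
Lemma L2_comb a b f g : L2 mu f -> L2 mu g ->
  L2 mu (fun y => a * f y + b * g y).
Proof.
move=> f2 g2; apply: L2I.
  apply: measurable_funD; apply: measurable_funM => //; exact: L2_measurable.
have If := L2_sqr_integrable f2; have Ig := L2_sqr_integrable g2.
have : mu.-integrable setT
    ((fun y => ((2 * a ^+ 2) * f y ^+ 2 + (2 * b ^+ 2) * g y ^+ 2)%:E) : Y -> \bar R).
  have -> : (fun y => ((2 * a ^+ 2) * f y ^+ 2 + (2 * b ^+ 2) * g y ^+ 2)%:E) =
    ((fun y => (2 * a ^+ 2)%:E * (f y ^+ 2)%:E) \+
     (fun y => (2 * b ^+ 2)%:E * (g y ^+ 2)%:E))%E.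
    by apply/funext => y /=; rewrite -EFinM -EFinM -EFinD.
  by apply: integrableD => //; exact: integrableZl.
move=> /integrableP[mh]; apply: le_lt_trans.
apply: ge0_le_integral => //.
- by move=> y _; rewrite lee_fin sqr_ge0.
- apply/measurable_EFinP; apply: measurable_funX.
  by apply: measurable_funD; apply: measurable_funM => //; exact: L2_measurable.
- exact: measurableT_comp.
- move=> y _; rewrite lee_fin ger0_norm; last first.
    by apply: addr_ge0; apply: mulr_ge0; rewrite ?sqr_ge0// mulr_ge0 ?sqr_ge0.
  rewrite -subr_ge0 (_ : _ - _ = (a * f y - b * g y) ^+ 2) ?sqr_ge0//; ring.
Qed.

Lemma L2_0 : L2 mu (fun=> 0).
Proof.
apply: L2I => //.
by under eq_integral do rewrite expr0n/=; rewrite integral0.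
Qed.

Lemma L2_scale a f : L2 mu f -> L2 mu (fun y => a * f y).
Proof.
move=> f2; rewrite (_ : (fun _ => _) = fun y => a * f y + 0 * f y); last first.
  by apply/funext => y; rewrite mul0r addr0.
exact: L2_comb.
Qed.

Lemma L2_sub f g : L2 mu f -> L2 mu g -> L2 mu (fun y => f y - g y).
Proof.
move=> f2 g2; rewrite (_ : (fun _ => _) = fun y => 1 * f y + (-1) * g y); last first.
  by apply/funext => y; rewrite mul1r mulN1r.
exact: L2_comb.
Qed.

Lemma L2_add f g : L2 mu f -> L2 mu g -> L2 mu (fun y => f y + g y).
Proof.
move=> f2 g2; rewrite (_ : (fun _ => _) = fun y => 1 * f y + 1 * g y); last first.
  by apply/funext => y; rewrite !mul1r.
exact: L2_comb.
Qed.

Lemma L2_sum (I : Type) (r : seq I) (F : I -> Y -> R) :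
  (forall i, L2 mu (F i)) -> L2 mu (fun y => \sum_(i <- r) F i y).
Proof.
move=> F2; elim: r => [|i r ih].
  by rewrite (_ : (fun _ => _) = fun=> 0); [exact: L2_0|apply/funext => y; rewrite big_nil].
rewrite (_ : (fun _ => _) = fun y => F i y + \sum_(j <- r) F j y).
  exact: L2_add.
by apply/funext => y; rewrite big_cons.
Qed.

Lemma L2_bounded f g C : measurable_fun setT f -> L2 mu g ->
  (forall y, `|f y| <= C * `|g y|) -> L2 mu f.
Proof.
move=> mf g2 fg; apply: L2I => //.
have /integrableP[mh] := L2_sqr_integrable (L2_scale C g2).
apply: le_lt_trans; apply: ge0_le_integral => //.
- by move=> y _; rewrite lee_fin sqr_ge0.
- by apply/measurable_EFinP; exact: measurable_funX.
- exact: measurableT_comp.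
- move=> y _; rewrite lee_fin ger0_norm ?sqr_ge0// exprMn.
  rewrite -(real_normK (num_real (f y))) -(real_normK (num_real (g y))) -exprMn.
  by rewrite lerXn2r// nnegrE// (le_trans _ (fg y)).
Qed.

Lemma L2_norm f : L2 mu f -> L2 mu (fun y => `|f y|).
Proof.
move=> f2; apply: (L2_bounded (C := 1) _ f2) => [|y].
  exact/measurableT_comp/L2_measurable.
by rewrite normr_id mul1r.
Qed.

Lemma innerC f g : inner mu f g = inner mu g f.
Proof. by apply: eq_Rintegral => y _; rewrite mulrC. Qed.

Lemma inner_ge0 f : 0 <= inner mu f f.
Proof. by apply: Rintegral_ge0 => y _; rewrite -expr2 sqr_ge0. Qed.

Lemma sqr_L2normE f : L2 mu f -> (L2norm mu f ^+ 2 = (inner mu f f)%:E)%E.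
Proof.
move=> f2; rewrite sqr_L2norm /inner /Rintegral fineK.
  by apply: eq_integral => y _; rewrite expr2.
exact/integrable_fin_num/L2_mul_integrable.
Qed.

Lemma inner_comb a b f g h : L2 mu f -> L2 mu g -> L2 mu h ->
  inner mu (fun y => a * f y + b * g y) h = a * inner mu f h + b * inner mu g h.
Proof.
move=> f2 g2 h2; rewrite /inner.
rewrite (@eq_Rintegral _ _ _ _ _ (fun y => a * (f y * h y) + b * (g y * h y))); last first.
  by move=> y _; rewrite mulrDl !mulrA.
have If := L2_mul_integrable f2 h2; have Ig := L2_mul_integrable g2 h2.
rewrite RintegralD//.
- by rewrite !RintegralZl.
- exact: (integrableZl _ a If).
- exact: (integrableZl _ b Ig).
Qed.

Lemma inner_subl f g h : L2 mu f -> L2 mu g -> L2 mu h ->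
  inner mu (fun y => f y - g y) h = inner mu f h - inner mu g h.
Proof.
move=> f2 g2 h2; have := inner_comb 1 (-1) f2 g2 h2; rewrite mul1r mulN1r => <-.
by congr inner; apply/funext => y; rewrite mul1r mulN1r.
Qed.

Lemma inner_subr f g h : L2 mu f -> L2 mu g -> L2 mu h ->
  inner mu h (fun y => f y - g y) = inner mu h f - inner mu h g.
Proof. by move=> *; rewrite innerC inner_subl// !(innerC h). Qed.

Lemma inner_addl f g h : L2 mu f -> L2 mu g -> L2 mu h ->
  inner mu (fun y => f y + g y) h = inner mu f h + inner mu g h.
Proof.
move=> f2 g2 h2; have := inner_comb 1 1 f2 g2 h2; rewrite !mul1r => <-.
by congr inner; apply/funext => y; rewrite !mul1r.
Qed.

Lemma inner0l h : inner mu (fun=> 0) h = 0.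
Proof.
rewrite /inner (@eq_Rintegral _ _ _ _ _ (cst 0)) ?Rintegral_cst ?mul0r// => y _.
by rewrite mul0r.
Qed.

Lemma inner_scalel a f h : L2 mu f -> L2 mu h ->
  inner mu (fun y => a * f y) h = a * inner mu f h.
Proof.
move=> f2 h2; have := inner_comb a 0 f2 f2 h2; rewrite mul0r addr0 => <-.
by congr inner; apply/funext => y; rewrite mul0r addr0.
Qed.

Lemma inner_scaler a f h : L2 mu f -> L2 mu h ->
  inner mu h (fun y => a * f y) = a * inner mu h f.
Proof. by move=> *; rewrite innerC inner_scalel// innerC. Qed.

Lemma inner_suml (I : Type) (r : seq I) (F : I -> Y -> R) h :
  (forall i, L2 mu (F i)) -> L2 mu h ->
  inner mu (fun y => \sum_(i <- r) F i y) h = \sum_(i <- r) inner mu (F i) h.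
Proof.
move=> F2 h2; elim: r => [|i r ih].
  rewrite big_nil (_ : (fun _ => _) = fun=> 0) ?inner0l//.
  by apply/funext => y; rewrite big_nil.
rewrite big_cons -ih -inner_addl//; last exact: L2_sum.
by congr inner; apply/funext => y; rewrite big_cons.
Qed.

Lemma inner_sumr (I : Type) (r : seq I) (F : I -> Y -> R) h :
  (forall i, L2 mu (F i)) -> L2 mu h ->
  inner mu h (fun y => \sum_(i <- r) F i y) = \sum_(i <- r) inner mu h (F i).
Proof.
move=> F2 h2; rewrite innerC inner_suml//.
by apply: eq_bigr => i _; rewrite innerC.
Qed.

(** Discriminant argument. The quadratic form [q] below is nonnegative; it is
    evaluated at [(c, - b)] if [c > 0], and at a point where it would be
    negative if [c = 0] and [b <> 0]. *)
Lemma cauchy_schwarz f g : L2 mu f -> L2 mu g ->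
  inner mu f g ^+ 2 <= inner mu f f * inner mu g g.
Proof.
move=> f2 g2; set a := inner mu f f; set b := inner mu f g; set c := inner mu g g.
have q s t : 0 <= s ^+ 2 * a + 2 * s * t * b + t ^+ 2 * c.
  have := inner_ge0 (fun y => s * f y + t * g y).
  have fg2 := L2_comb s t f2 g2.
  rewrite inner_comb// !(innerC _ (fun y => s * f y + t * g y)) !inner_comb//.
  rewrite -/a -/c (innerC g f) -/b => /le_trans; apply.
  by rewrite le_eqVlt; apply/orP; left; apply/eqP; ring.
have a0 : 0 <= a := inner_ge0 f.
have [c0|c0] := eqVneq c 0.
  rewrite c0 mulr0; have := q b (- (a + 1) / 2); rewrite c0 mulr0 addr0 => h.
  have : b ^+ 2 * a + 2 * b * (- (a + 1) / 2) * b = - b ^+ 2 by field.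
  by move=> e; move: h; rewrite e oppr_ge0.
have cp : 0 < c by rewrite lt0r c0 inner_ge0.
have := q c (- b); rewrite (_ : _ + _ = c * (a * c - b ^+ 2)); last by ring.
by rewrite pmulr_rge0// subr_ge0.
Qed.
End L2_theory.

(** Comparison of integrals of nonnegative functions holds without
    measurability, the integral being a supremum over simple minorants. *)
Lemma ge0_le_integral_all {R : realType} {d : measure_display}
    {T : measurableType d} (P : {measure set T -> \bar R}) (f g : T -> \bar R) :
  (forall x, 0 <= f x)%E -> (forall x, f x <= g x)%E ->
  (\int[P]_x f x <= \int[P]_x g x)%E.
Proof.
move=> f0 fg; have g0 x : (0 <= g x)%E by exact: le_trans (fg x).
rewrite !ge0_integralTE//; apply: le_ereal_sup => _ [h hf <-]; exists h => // x.
exact: le_trans (fg x).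
Qed.

(** * Classes closed under dominated limits *)

Section closed_classes.
Context {R : realType} {d : measure_display} {Y : measurableType d}.
Variable mu : {measure set Y -> \bar R}.
Variable S : set Y.
Implicit Types (f g h G : Y -> R) (M : set (Y -> R)).

(** Linear classes of square integrable functions that are stable under
    dominated limits, which need to hold only on the carrier [S] of the
    measure: this lets one work with kernels whose formulas are meaningful on
    [S] alone. Such classes play the part of closed subspaces. *)
Definition closed_class M : Prop :=
  [/\ M `<=` L2 mu,
      forall a b f g, M f -> M g -> M (fun y => a * f y + b * g y) &
      forall (g_ : nat -> Y -> R) g G, (forall i, M (g_ i)) ->
        measurable_fun setT g -> L2 mu G ->
        (forall i y, S y -> `|g_ i y| <= G y) ->
        (forall y, S y -> g_ ^~ y @ \oo --> g y) -> M g].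

Hypothesis mS : measurable S.
Hypothesis S0 : mu (~` S) = 0%E.

Lemma ae_carrier (Q : Y -> Prop) : (forall y, S y -> Q y) ->
  {ae mu, forall y, Q y}.
Proof.
move=> SQ; exists (~` S); split => //; first exact: measurableC.
by move=> y nQ Sy; apply: nQ; exact: SQ.
Qed.

Lemma L2_dominated g G : measurable_fun setT g -> L2 mu G ->
  (forall y, S y -> `|g y| <= `|G y|) -> L2 mu g.
Proof.
move=> mg G2 gG; apply: L2I => //.
have /integrableP[mh] := L2_sqr_integrable G2.
apply: le_lt_trans; apply: ae_ge0_le_integral => //.
- by move=> y _; rewrite lee_fin sqr_ge0.
- by apply/measurable_EFinP; exact: measurable_funX.
- exact: measurableT_comp.
- apply: ae_carrier => y Sy _; rewrite lee_fin (ger0_norm (sqr_ge0 _)).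
  rewrite -(real_normK (num_real (g y))) -(real_normK (num_real (G y))).
  by rewrite lerXn2r// ?nnegrE// gG.
Qed.

(** Dominated convergence for the squares, bounded by [(2 G)^2]. *)
Lemma dominated_L2_cvg (g_ : nat -> Y -> R) g G : (forall i, L2 mu (g_ i)) ->
  L2 mu g -> L2 mu G -> (forall i y, S y -> `|g_ i y| <= G y) ->
  (forall y, S y -> g_ ^~ y @ \oo --> g y) ->
  inner mu (fun y => g y - g_ i y) (fun y => g y - g_ i y) @[i --> \oo] --> 0.
Proof.
move=> g_2 g2 G2 g_G g_g.
pose dd i y := ((g y - g_ i y) ^+ 2)%:E.
have mdd i : measurable_fun setT (dd i).
  apply/measurable_EFinP/measurable_funX/measurable_funB; exact: (L2_measurable (mu := mu)).
have [||||_ _ cv] := @dominated_convergence _ _ _ mu setT measurableT dd (fun=> 0%E)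
   (fun y => ((2 * G y) ^+ 2)%:E) mdd.
- by [].
- apply: ae_carrier => y Sy _; apply: cvg_EFin; first exact: nearW.
  have : (g y - g_ i y) * (g y - g_ i y) @[i --> \oo] --> (g y - g y) * (g y - g y).
    by apply: cvgM; apply: cvgB; try exact: g_g; exact: cvg_cst.
  by rewrite subrr mul0r.
- exact: (L2_sqr_integrable (L2_scale 2 G2)).
- apply: ae_carrier => y Sy i _; rewrite /dd abse_EFin lee_fin.
  rewrite ger0_norm ?sqr_ge0//.
  rewrite -(real_normK (num_real (_ - _))) lerXn2r ?nnegrE//.
    by rewrite mulr_ge0// (le_trans _ (g_G 0%N y Sy)).
  apply: (le_trans (ler_normB _ _)).
  have : `|g y| <= G y.
    have : `|g_ i y| @[i --> \oo] --> `|g y| by apply: cvg_norm; exact: g_g.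
    by move=> /cvgr_to_le; apply; apply: nearW => j; exact: g_G.
  have := g_G i y Sy; lra.
- rewrite integral0 in cv.
  have {}cv := fine_cvg cv.
  pose u i := inner mu (fun y => g y - g_ i y) (fun y => g y - g_ i y).
  suff e : fine \o [sequence (\int[mu]_x dd i x)%E]_i = u.
    by move: cv; rewrite e; exact.
  apply/funext => i; rewrite /u/= /inner /Rintegral.
  by congr fine; apply: eq_integral => y _; rewrite /dd expr2.
Qed.

(** The class to which the argument is applied. A dominated limit [g] is close
    in norm to some [g_N], so that by Cauchy-Schwarz [<r_k, g>] is close to
    [<r_k, g_N>] uniformly in [k]. *)
Lemma weak_null_closed_class (r_ : nat -> Y -> R) C :
  (forall k, L2 mu (r_ k)) -> (forall k, inner mu (r_ k) (r_ k) <= C) ->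
  closed_class [set g | L2 mu g /\ inner mu (r_ k) g @[k --> \oo] --> 0].
Proof.
move=> r2 rC; split; first by move=> g [].
- move=> a b f g [f2 f0] [g2 g0]; split; first exact: L2_comb.
  rewrite (_ : (fun _ => _) = fun k => a * inner mu (r_ k) f + b * inner mu (r_ k) g).
    have : a * inner mu (r_ k) f + b * inner mu (r_ k) g @[k --> \oo] --> a * 0 + b * 0.
      by apply: cvgD; apply: cvgM => //; exact: cvg_cst.
    by rewrite !mulr0 addr0.
  by apply/funext => k; rewrite innerC inner_comb// !(innerC _ (r_ k)).
- move=> g_ g G Mg_ mg G2 g_G g_g.
  have g_2 i : L2 mu (g_ i) by have [] := Mg_ i.
  have gG y : S y -> `|g y| <= G y.
    move=> Sy.
    have : `|g_ i y| @[i --> \oo] --> `|g y| by apply: cvg_norm; exact: g_g.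
    by move=> /cvgr_to_le; apply; apply: nearW => j; exact: g_G.
  have g2 : L2 mu g.
    apply: (L2_dominated mg G2) => y Sy; exact: le_trans (gG y Sy) (ler_norm _).
  split => //.
  have cv := dominated_L2_cvg g_2 g2 G2 g_G g_g.
  have C0 : 0 <= C by exact: le_trans (inner_ge0 _ _) (rC 0%N).
  apply/cvgr0Pnorm_lt => e e0.
  (* This is the error on [g] that makes Cauchy-Schwarz yield e / 2, since
     |r_k|^2 <= C < C + 1; the increment avoids a division by 0. *)
  have e1 : 0 < e ^+ 2 / (4 * (C + 1)).
    by rewrite divr_gt0 ?exprn_gt0// mulr_gt0// ltr_wpDl.
  have [N _ /(_ N (leqnn N))/=] := cvgr0_norm_lt _ cv _ e1.
  rewrite ger0_norm ?inner_ge0// => gN.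
  have [_ cN] := Mg_ N.
  have e2 : 0 < e / 2 by rewrite divr_gt0.
  near=> k.
  have -> : inner mu (r_ k) g = inner mu (r_ k) (g_ N) +
      inner mu (r_ k) (fun y => g y - g_ N y).
    by rewrite inner_subr// addrC subrK.
  have h1 : `|inner mu (r_ k) (g_ N)| < e / 2 by near: k; exact: cvgr0_norm_lt.
  have h2 : `|inner mu (r_ k) (fun y => g y - g_ N y)| <= e / 2.
    rewrite -(ler_pXn2r (n := 2))// ?nnegrE ?(ltW e2)// real_normK ?num_real//.
    apply: (le_trans (cauchy_schwarz (r2 k) (L2_sub g2 (g_2 N)))).
    apply: (@le_trans _ _ ((C + 1) * (e ^+ 2 / (4 * (C + 1))))).
      apply: ler_pM => //; [exact: inner_ge0|exact: inner_ge0| |exact: ltW].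
      by apply: (le_trans (rC k)); rewrite lerDl.
    rewrite le_eqVlt; apply/orP; left; apply/eqP; field.
    by rewrite gt_eqF// ltr_wpDl.
  apply: (le_lt_trans (ler_normD _ _)); lra.
Unshelve. all: by end_near. Qed.

Section theory.
Variable M : set (Y -> R).
Hypothesis cM : closed_class M.

Lemma closed_class_L2 g : M g -> L2 mu g.
Proof. by case: cM => + _ _ => /[apply]. Qed.

Lemma closed_class_comb a b f g : M f -> M g -> M (fun y => a * f y + b * g y).
Proof. by case: cM => _ + _; exact. Qed.

Lemma closed_class_scale a f : M f -> M (fun y => a * f y).
Proof.
move=> Mf; rewrite (_ : (fun _ => _) = fun y => a * f y + 0 * f y).
  exact: closed_class_comb.
by apply/funext => y; rewrite mul0r addr0.
Qed.

Lemma closed_class_add f g : M f -> M g -> M (fun y => f y + g y).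
Proof.
move=> Mf Mg; rewrite (_ : (fun _ => _) = fun y => 1 * f y + 1 * g y).
  exact: closed_class_comb.
by apply/funext => y; rewrite !mul1r.
Qed.

Lemma closed_class_sub f g : M f -> M g -> M (fun y => f y - g y).
Proof.
move=> Mf Mg; rewrite (_ : (fun _ => _) = fun y => 1 * f y + (-1) * g y).
  exact: closed_class_comb.
by apply/funext => y; rewrite mul1r mulN1r.
Qed.

Lemma closed_class_lim (g_ : nat -> Y -> R) g G : (forall i, M (g_ i)) ->
  measurable_fun setT g -> L2 mu G ->
  (forall i y, S y -> `|g_ i y| <= G y) ->
  (forall y, S y -> g_ ^~ y @ \oo --> g y) -> M g.
Proof. by case: cM => _ _; exact. Qed.

Lemma closed_class_ae f g : M f -> measurable_fun setT g ->
  (forall y, S y -> f y = g y) -> M g.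
Proof.
move=> Mf mg fg; have f2 := closed_class_L2 Mf.
apply: (@closed_class_lim (fun=> f) g (fun y => `|f y|)) => //.
- exact: L2_norm.
- by move=> y Sy; rewrite fg//; exact: cvg_cst.
Qed.
End theory.
End closed_classes.

(** * Gram-Schmidt orthonormalization *)

Section gram_schmidt_theory.
Context {R : realType} {d : measure_display} {Y : measurableType d}.
Variable mu : {measure set Y -> \bar R}.
Variable Kt : nat -> Y -> R.
Hypothesis Kt2 : forall k, L2 mu (Kt k).
Implicit Types (g h : Y -> R) (k m : nat).

Let E k := gs_last mu (mkseq Kt k.+1).

Definition gs_residual k g : Y -> R :=
  fun y => g y - \sum_(j < k) inner mu g (E j) * E j y.

Lemma gram_schmidt_rcons gs g :
  gram_schmidt mu (rcons gs g) = gs_step mu (gram_schmidt mu gs) g.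
Proof. by rewrite /gram_schmidt foldl_rcons. Qed.

Lemma gram_schmidt_mkseq k : gram_schmidt mu (mkseq Kt k) = mkseq E k.
Proof.
elim: k => [//|k ih]; rewrite [RHS]mkseqS -ih /E /gs_last mkseqS gram_schmidt_rcons.
by rewrite /gs_step last_rcons.
Qed.

Lemma gs_last_rcons k g : gs_last mu (rcons (mkseq Kt k) g) =
  fun y => (Num.sqrt (inner mu (gs_residual k g) (gs_residual k g)))^-1 *
    gs_residual k g y.
Proof.
rewrite /gs_last gram_schmidt_rcons /gs_step last_rcons gram_schmidt_mkseq.
suff e : (fun y => g y - \sum_(e <- mkseq E k) inner mu g e * e y) =
  gs_residual k g.
  by rewrite e; apply/funext => y; congr (_ * _); exact: (congr1 (@^~ y) e).
apply/funext => y; rewrite /gs_residual; congr (_ - _).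
by rewrite big_map -(big_mkord xpredT (fun j => inner mu g (E j) * E j y)) /index_iota subn0.
Qed.

Lemma gs_vectorE k : E k =
  fun y => (Num.sqrt (inner mu (gs_residual k (Kt k)) (gs_residual k (Kt k))))^-1 *
    gs_residual k (Kt k) y.
Proof. by rewrite /E mkseqS gs_last_rcons. Qed.

(** The square integrability of the [E j] is a hypothesis here because it is
    proved by induction with this lemma. *)
Lemma gs_residual_L2_of k g : (forall j, (j < k)%N -> L2 mu (E j)) -> L2 mu g ->
  L2 mu (gs_residual k g).
Proof.
move=> E2 g2; apply: L2_sub => //; apply: L2_sum => i.
exact/L2_scale/E2.
Qed.

Lemma gs_vector_L2 k : L2 mu (E k).
Proof.
elim/ltn_ind: k => k ih; rewrite gs_vectorE; apply: L2_scale.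
exact: gs_residual_L2_of.
Qed.

Lemma gs_residual_L2 k g : L2 mu g -> L2 mu (gs_residual k g).
Proof. by apply: gs_residual_L2_of => j _; exact: gs_vector_L2. Qed.

Lemma inner_gs_residual k g h : L2 mu g -> L2 mu h ->
  inner mu (gs_residual k g) h =
  inner mu g h - \sum_(j < k) inner mu g (E j) * inner mu (E j) h.
Proof.
move=> g2 h2; rewrite inner_subl//; last first.
  by apply: L2_sum => i; exact/L2_scale/gs_vector_L2.
rewrite inner_suml//; last by move=> i; exact/L2_scale/gs_vector_L2.
by congr (_ - _); apply: eq_bigr => i _; rewrite inner_scalel//; exact: gs_vector_L2.
Qed.

Lemma gs_residual_sym k g h : L2 mu g -> L2 mu h ->
  inner mu (gs_residual k g) h = inner mu g (gs_residual k h).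
Proof.
move=> g2 h2; rewrite (innerC _ g) !inner_gs_residual// (innerC _ h g).
by congr (_ - _); apply: eq_bigr => i _; rewrite mulrC (innerC _ g) (innerC _ h).
Qed.

(** The vectors [E k] are orthonormal except that some may vanish: a residual of
    zero norm is multiplied by [0^-1 = 0]. *)
Lemma gs_vector_norm k : E k = (fun=> 0) \/ inner mu (E k) (E k) = 1.
Proof.
rewrite gs_vectorE; set r := gs_residual _ _; set s := inner mu r r.
have r2 : L2 mu r by exact: gs_residual_L2.
have [s0|s0] := eqVneq s 0.
  by left; apply/funext => y; rewrite s0 sqrtr0 invr0 mul0r.
right; have sp : 0 < s by rewrite lt0r s0 inner_ge0.
rewrite inner_scalel ?inner_scaler//; last exact: L2_scale.
rewrite -/s mulrA -expr2 exprVn sqr_sqrtr ?inner_ge0//.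
by rewrite mulVf.
Qed.

(** The form in which orthonormality up to zero vectors is used. *)
Lemma inner_gs_vectorM k c g :
  c * inner mu g (E k) * inner mu (E k) (E k) = c * inner mu g (E k).
Proof.
case: (gs_vector_norm k) => [->|->]; last by rewrite mulr1.
by rewrite (innerC _ g) !inner0l !mulr0.
Qed.

Lemma gs_residual_orth_of k j g :
  (forall i i', (i < k)%N -> (i' < k)%N -> i != i' -> inner mu (E i) (E i') = 0) ->
  (j < k)%N -> L2 mu g -> inner mu (gs_residual k g) (E j) = 0.
Proof.
move=> orth jk g2; rewrite inner_gs_residual//; last exact: gs_vector_L2.
rewrite (bigD1 (Ordinal jk))//= -{1}[inner mu g (E j)]mul1r big1 ?addr0; last first.
  by move=> i ij; rewrite orth ?mulr0.
have := inner_gs_vectorM j 1 g; rewrite !mul1r => ->.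
by rewrite subrr.
Qed.

Lemma gs_orthogonal i j : i != j -> inner mu (E i) (E j) = 0.
Proof.
suff H k : forall i i', (i < k)%N -> (i' < k)%N -> i != i' -> inner mu (E i) (E i') = 0.
  by apply: (H (maxn i j).+1); rewrite ltnS ?leq_maxl ?leq_maxr.
elim: k => [//|k ih] {}i {}j.
have side a : (a < k)%N -> inner mu (E k) (E a) = 0.
  move=> ak; rewrite {1}gs_vectorE inner_scalel; last 2 first.
  - exact: gs_residual_L2.
  - exact: gs_vector_L2.
  by rewrite gs_residual_orth_of ?mulr0.
rewrite (ltnS i) (ltnS j) (leq_eqVlt i) (leq_eqVlt j) => /orP[/eqP ->|ik] /orP[/eqP ->|jk] ij.
- by rewrite eqxx in ij.
- exact: side.
- by rewrite innerC; exact: side.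
- exact: ih.
Qed.

Lemma gs_residual_orth k j g : (j < k)%N -> L2 mu g ->
  inner mu (gs_residual k g) (E j) = 0.
Proof. by apply: gs_residual_orth_of => i i' _ _; exact: gs_orthogonal. Qed.

Lemma gs_residual_selfE k g : L2 mu g ->
  inner mu (gs_residual k g) (gs_residual k g) = inner mu (gs_residual k g) g.
Proof.
move=> g2; have r2 := gs_residual_L2 k g2.
rewrite {2}/gs_residual inner_subr//; last first.
  by apply: L2_sum => i; exact/L2_scale/gs_vector_L2.
rewrite inner_sumr//; last by move=> i; exact/L2_scale/gs_vector_L2.
rewrite big1 ?subr0// => i _.
rewrite inner_scaler//; last exact: gs_vector_L2.
by rewrite gs_residual_orth// mulr0.
Qed.

Lemma norm_gs_residual k g : L2 mu g ->
  inner mu (gs_residual k g) (gs_residual k g) =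
  inner mu g g - \sum_(j < k) inner mu g (E j) ^+ 2.
Proof.
move=> g2; rewrite gs_residual_selfE// inner_gs_residual//.
by congr (_ - _); apply: eq_bigr => i _; rewrite (innerC _ (E i)) expr2.
Qed.

Lemma bessel k g : L2 mu g -> \sum_(j < k) inner mu g (E j) ^+ 2 <= inner mu g g.
Proof. by move=> g2; rewrite -subr_ge0 -norm_gs_residual// inner_ge0. Qed.

Lemma norm_gs_residual_le k g : L2 mu g ->
  inner mu (gs_residual k g) (gs_residual k g) <= inner mu g g.
Proof.
move=> g2; rewrite norm_gs_residual// gerBl.
by apply: sumr_ge0 => i _; rewrite sqr_ge0.
Qed.

(** Division by the norm is avoided, so that this includes the case of a
    residual of zero norm, where both sides vanish by Cauchy-Schwarz. *)
Lemma inner_residual_gs_residual k j g : L2 mu g ->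
  inner mu (gs_residual k g) (gs_residual j (Kt j)) ^+ 2 =
  inner mu (gs_residual j (Kt j)) (gs_residual j (Kt j)) *
  inner mu (gs_residual k g) (E j) ^+ 2.
Proof.
move=> g2; have r2 := gs_residual_L2 k g2.
have s2 := gs_residual_L2 j (Kt2 j).
rewrite gs_vectorE inner_scaler// exprMn exprVn sqr_sqrtr ?inner_ge0// mulrA.
have [e|e] := eqVneq (inner mu (gs_residual j (Kt j)) (gs_residual j (Kt j))) 0.
  rewrite e !mul0r; apply/eqP; rewrite eq_le sqr_ge0 andbT.
  by have := cauchy_schwarz r2 s2; rewrite e mulr0.
by rewrite mulfV// mul1r.
Qed.

(** The vector [Kt j] is its own residual plus a combination of the [E i] with
    [i < j], and both are orthogonal to the residual of [g] if [j < k]. *)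
Lemma gs_residual_orth_family k j g : (j < k)%N -> L2 mu g ->
  inner mu (gs_residual k g) (Kt j) = 0.
Proof.
move=> jk g2; have r2 := gs_residual_L2 k g2.
have : inner mu (gs_residual k g) (gs_residual j (Kt j)) = 0.
  by apply/eqP; rewrite -(sqrf_eq0) inner_residual_gs_residual// gs_residual_orth// expr0n mulr0.
rewrite {2}/gs_residual inner_subr//; last first.
  by apply: L2_sum => i; exact/L2_scale/gs_vector_L2.
rewrite inner_sumr//; last by move=> i; exact/L2_scale/gs_vector_L2.
rewrite big1 ?subr0// => i _.
rewrite inner_scaler//; last exact: gs_vector_L2.
by rewrite gs_residual_orth ?mulr0// (ltn_trans _ jk).
Qed.

(** What the selection of a candidate [g] says about residuals. If [r] is the
    residual of [g] and [f_k] that of [f], the last Gram-Schmidt vector is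
    [r / |r|], and [<f, r / |r|> = <f_k, g> / |r|] with [|r| <= |g|]. *)
Lemma inner_gs_last_rcons k f g : L2 mu f -> L2 mu g ->
  inner mu (gs_residual k f) g ^+ 2 <=
  inner mu g g * inner mu f (gs_last mu (rcons (mkseq Kt k) g)) ^+ 2.
Proof.
move=> f2 g2; have r2 := gs_residual_L2 k g2.
rewrite gs_last_rcons inner_scaler// gs_residual_sym//.
rewrite exprMn exprVn sqr_sqrtr ?inner_ge0//.
set s := inner mu (gs_residual k g) _.
have [s0|s0] := eqVneq s 0.
  by have := cauchy_schwarz f2 r2; rewrite -/s s0 mulr0 invr0 mul0r mulr0.
have sp : 0 < s by rewrite lt0r s0 inner_ge0.
rewrite mulrA ler_peMl ?sqr_ge0// ler_pdivlMr// mul1r.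
exact: norm_gs_residual_le.
Qed.

Lemma gs_vector_span : exists a : nat -> nat -> R,
  forall k y, E k y = \sum_(j < k.+1) a k j * Kt j y.
Proof.
suff /choice[a Ha] : forall k, exists c : nat -> R,
    forall y, E k y = \sum_(j < k.+1) c j * Kt j y by exists a.
elim/ltn_ind => k ih.
have /choice[c Hc] : forall i : 'I_k, exists c : nat -> R,
    forall y, E i y = \sum_(j < i.+1) c j * Kt j y by move=> i; exact: ih.
set N := (Num.sqrt (inner mu (gs_residual k (Kt k)) (gs_residual k (Kt k))))^-1.
exists (fun j => N * ((j == k)%:R -
  \sum_(i < k) inner mu (Kt k) (E i) * (if (j < i.+1)%N then c i j else 0))) => y.
rewrite gs_vectorE -/N.
under eq_bigr do rewrite -mulrA.
rewrite -mulr_sumr; congr (_ * _).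
under eq_bigr do rewrite mulrBl mulr_suml.
rewrite sumrB; congr (_ - _).
  rewrite big_ord_recr/= eqxx mul1r big1 ?add0r// => i _.
  by rewrite ltn_eqF// mul0r.
rewrite exchange_big/=; apply: eq_bigr => i _.
under eq_bigr do rewrite -mulrA.
rewrite -mulr_sumr Hc; congr (_ * _).
rewrite (big_ord_widen k.+1 (fun j => c i j * Kt j y))//; last by rewrite ltnS ltnW.
rewrite big_mkcond/=; apply: eq_bigr => j _.
by case: ifP => _ //; rewrite mul0r.
Qed.
End gram_schmidt_theory.

(** * Convergence of the residuals *)

Section convergence.
Context {R : realType} {d : measure_display} {Y : measurableType d} {N : nat}.
Variables (mu : {measure set Y -> \bar R}) (S : set Y).
Variables (D : set 'rV[R]_N) (K : 'rV[R]_N -> Y -> R) (q v : nat -> 'rV[R]_N).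
Context {d' : measure_display} {Omega : measurableType d'}.
Variables (P : probability Omega R) (f : Omega -> Y -> R).

Hypothesis mS : measurable S.
Hypothesis S0 : mu (~` S) = 0%E.
Hypothesis K2 : forall p, D p -> L2 mu (K p).
Let Kt := mkernel K q v.
Hypothesis Kt2 : forall k, L2 mu (Kt k).
Hypothesis total : forall M, closed_class mu S M ->
  (forall t : 'rV[rat]_N, D (map_mx ratr t) -> M (K (map_mx ratr t))) ->
  L2 mu `<=` M.
Hypothesis f2 : random_L2 mu P f.
Hypothesis sel : max_selection mu D K q v P f.

Let E k := gs_last mu (mkseq Kt k.+1).
Let E2 k : L2 mu (E k). Proof. exact: gs_vector_L2. Qed.
Let fL2 w : L2 mu (f w). Proof. by case: f2. Qed.
Let res k w := gs_residual mu Kt k (f w).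
Let res2 k w : L2 mu (res k w). Proof. exact: gs_residual_L2. Qed.

Lemma measurable_sqdist g : L2 mu g ->
  measurable_fun setT (fun w => inner mu (fun y => f w y - g y) (fun y => f w y - g y)).
Proof.
move=> g2; apply/measurable_EFinP.
rewrite (_ : EFin \o _ = fun w =>
  L2norm mu (fun y => f w y - g y)%R * L2norm mu (fun y => f w y - g y)%R)%E.
  by apply: emeasurable_funM; case: f2 => _ + _; exact.
apply/funext => w /=; rewrite -sqr_L2normE; first by rewrite expe2.
exact: L2_sub.
Qed.

Lemma measurable_sqnorm : measurable_fun setT (fun w => inner mu (f w) (f w)).
Proof.
rewrite (_ : (fun w => _) = fun w => inner mu (fun y => f w y - 0) (fun y => f w y - 0)).
  exact/measurable_sqdist/L2_0.
apply/funext => w; congr inner; apply/funext => y; by rewrite subr0.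
Qed.

(** Polarization: [2 <f, g> = |f|^2 + |g|^2 - |f - g|^2], and measurability of a
    random element means that of its distances to fixed elements. *)
Lemma measurable_inner g : L2 mu g -> measurable_fun setT (fun w => inner mu (f w) g).
Proof.
move=> g2; rewrite (_ : (fun w => _) = fun w => 2^-1 *
  (inner mu (f w) (f w) + inner mu g g -
   inner mu (fun y => f w y - g y) (fun y => f w y - g y))).
  apply: measurable_funM => //; apply: measurable_funB; last exact: measurable_sqdist.
  by apply: measurable_funD => //; exact: measurable_sqnorm.
apply/funext => w; have fg2 := L2_sub (fL2 w) g2.
rewrite inner_subl// !inner_subr// (innerC _ g (f w)); lra.
Qed.

Lemma sqnorm_integrable : P.-integrable setT (EFin \o (fun w => inner mu (f w) (f w))).
Proof.
apply/integrableP; split; first exact/measurable_EFinP/measurable_sqnorm.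
case: f2 => _ _; apply: le_lt_trans; rewrite le_eqVlt; apply/orP; left; apply/eqP.
by apply: eq_integral => w _; rewrite sqr_L2normE// [LHS]/= ger0_norm// inner_ge0.
Qed.

Let energyE k : energy mu P f (E k) = (\int[P]_w (inner mu (f w) (E k) ^+ 2)%:E)%E.
Proof. by []. Qed.

Let msq g : L2 mu g -> measurable_fun setT (fun w => ((inner mu (f w) g) ^+ 2)%:E).
Proof. by move=> g2; apply/measurable_EFinP/measurable_funX/measurable_inner. Qed.

Lemma energy_fin g : L2 mu g -> energy mu P f g \is a fin_num.
Proof.
move=> g2; apply: integrable_fin_num => //.
apply: (le_integrable measurableT _ _ (integrableZl measurableT (inner mu g g) sqnorm_integrable)).
  exact: msq.
move=> w _ /=; rewrite lee_fin !ger0_norm ?sqr_ge0 ?mulr_ge0 ?inner_ge0//.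
by rewrite mulrC; exact: cauchy_schwarz.
Qed.

(** By Bessel's inequality the energies sum to at most [E |f|^2]. *)
Lemma energy_cvg0 : energy mu P f (E k) @[k --> \oo] --> 0%E.
Proof.
pose e k := fine (energy mu P f (E k)).
have e0 k : 0 <= e k by apply/fine_ge0/integral_ge0 => w _; rewrite lee_fin sqr_ge0.
have Ee k : energy mu P f (E k) = (e k)%:E by rewrite fineK// energy_fin.
pose T := fine (\int[P]_w (inner mu (f w) (f w))%:E)%E.
have TE : (\int[P]_w (inner mu (f w) (f w))%:E)%E = T%:E.
  by rewrite fineK//; apply: integrable_fin_num => //; exact: sqnorm_integrable.
have eT m : \sum_(0 <= k < m) e k <= T.
  rewrite -lee_fin -TE -sumEFin.
  under eq_bigr do rewrite -Ee energyE.
  rewrite -ge0_integral_sum//; last 2 first.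
  - by move=> k; exact: msq.
  - by move=> k w _; rewrite lee_fin sqr_ge0.
  apply: ge0_le_integral_all => w; first by apply: sume_ge0 => k _; rewrite lee_fin sqr_ge0.
  by rewrite sumEFin lee_fin big_mkord; exact: bessel.
have : cvgn (series e).
  apply: nondecreasing_is_cvgn.
    apply/nondecreasing_seqP => m; rewrite /series/= big_nat_recr//= lerDl; exact: e0.
  by exists T => _ [m _ <-]; exact: eT.
move=> /cvg_series_cvg_0 h.
rewrite (_ : (fun k => _) = EFin \o e); last by apply/funext => k; exact: Ee.
by apply: cvg_EFin => //; exact: nearW.
Qed.

Let u p k w := inner mu (res k w) (K p).

Lemma measurable_residual p k : D p -> measurable_fun setT (u p k).
Proof.
move=> Dp; rewrite (_ : u p k = fun w => inner mu (f w) (K p) -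
    \sum_(j < k) inner mu (f w) (E j) * inner mu (E j) (K p)).
  apply: measurable_funB; first exact/measurable_inner/K2.
  apply: measurable_sum => i; apply: measurable_funM => //.
  exact/measurable_inner/E2.
by apply/funext => w; rewrite /u /res inner_gs_residual//; exact: K2.
Qed.

(** The point [p] either competes at step [k], and [inner_gs_last_rcons] applies,
    or has been selected before; then [K p] is the multiple kernel of its first
    occurrence, to which the residual is orthogonal. *)
Lemma residual_energy_le p k : D p ->
  (\int[P]_w (u p k w ^+ 2)%:E <= (inner mu (K p) (K p))%:E * energy mu P f (E k))%E.
Proof.
move=> Dp; have Kp2 := K2 Dp.
have rhs0 : (0 <= (inner mu (K p) (K p))%:E * energy mu P f (E k))%E.
  by rewrite mule_ge0 ?lee_fin ?inner_ge0// integral_ge0// => w _; rewrite lee_fin sqr_ge0.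
have [pq|pq] := boolP (p \in mkseq q k).
  rewrite integral0_eq// => w _.
  have qi : nth 0 (mkseq q k) (index p (mkseq q k)) = p by exact: nth_index.
  move: (pq); rewrite -index_mem; set i := index _ _; rewrite size_mkseq => ik.
  have KtK : Kt i = K p.
    apply/funext => y; rewrite /Kt /mkernel.
    have -> : mult q i = 0%N.
      apply/eqP; rewrite -leqn0 leqNgt -has_count has_pred1; apply/negP => /nthP.
      move=> /(_ 0)[j]; rewrite size_mkseq => ji; rewrite nth_mkseq// => qj.
      have := before_find 0 (a := pred1 p) (s := mkseq q k) ji.
      rewrite /= nth_mkseq ?(ltn_trans ji)// qj.
      by rewrite -(nth_mkseq 0 q ik) /i qi eqxx.
    by rewrite derive1n0 scale0r addr0 -(nth_mkseq 0 q ik) /i qi.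
  by rewrite /u -KtK gs_residual_orth_family// expr0n.
have [_ _ best _] := sel k.
have : (energy mu P f (E_cand mu K q v k p) <= energy mu P f (E k))%E.
  by rewrite best; apply: ereal_sup_ubound; exists p.
have c2 : L2 mu (E_cand mu K q v k p).
  by rewrite /E_cand gs_last_rcons//; apply: L2_scale; exact: gs_residual_L2.
have cE := msq c2.
move=> le_best; apply: (@le_trans _ _
  ((inner mu (K p) (K p))%:E * energy mu P f (E_cand mu K q v k p))%E); last first.
  by apply: lee_wpmul2l => //; rewrite lee_fin inner_ge0.
rewrite /energy -ge0_integralZl_EFin ?inner_ge0//; last first.
  by move=> w _; rewrite lee_fin sqr_ge0.
apply: ge0_le_integral_all => w; first by rewrite lee_fin sqr_ge0.
by rewrite -EFinM lee_fin; exact: inner_gs_last_rcons.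
Qed.

Lemma residual_energy_cvg0 p : D p -> (\int[P]_w (u p k w ^+ 2)%:E)%E @[k --> \oo] --> 0%E.
Proof.
move=> Dp; apply: (@squeeze_cvge _ _ _ _ (fun=> 0%E) _
   (fun k => (inner mu (K p) (K p))%:E * energy mu P f (E k))%E).
- apply: nearW => k; rewrite residual_energy_le// andbT.
  by apply: integral_ge0 => w _; rewrite lee_fin sqr_ge0.
- exact: cvg_cst.
- rewrite -(mule0 (inner mu (K p) (K p))%:E).
  by apply: cvgeZl => //; exact: energy_cvg0.
Qed.

(** Pointwise in [w], the inner products are partial sums of an absolutely
    convergent series. *)
Lemma residual_is_cvg p w : D p -> cvgn (fun k => u p k w).
Proof.
move=> Dp; have Kp2 := K2 Dp.
have -> : (fun k => u p k w) = fun k => inner mu (f w) (K p) -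
    series (fun j => inner mu (f w) (E j) * inner mu (E j) (K p)) k.
  by apply/funext => k; rewrite /u /res inner_gs_residual// /series/= big_mkord.
apply: is_cvgB; first exact: is_cvg_cst.
apply: normed_cvg.
pose a j : R := `|inner mu (f w) (E j) * inner mu (E j) (K p)|.
suff : cvgn (series a) by [].
apply: nondecreasing_is_cvgn.
  by apply/nondecreasing_seqP => m; rewrite /series/= big_nat_recr//= lerDl /a.
exists ((inner mu (f w) (f w) + inner mu (K p) (K p)) / 2) => _ [m _ <-].
rewrite /series/= big_mkord.
apply: (@le_trans _ _ (\sum_(j < m) (inner mu (f w) (E j) ^+ 2 + inner mu (K p) (E j) ^+ 2) / 2)).
  apply: ler_sum => j _; rewrite /a (innerC _ (E j)) normrM.
  set x := inner _ _ _; set z := inner _ _ _.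
  have := sqr_ge0 (`|x| - `|z|); rewrite sqrrB !real_normK ?num_real//; lra.
rewrite -mulr_suml ler_pM2r ?invr_gt0// big_split/=.
by apply: lerD; exact: bessel.
Qed.

(** Convergence in mean only gives a subsequence that converges almost surely;
    since the whole sequence is known to converge, Fatou's lemma shows that its
    limit is 0. *)
Lemma residual_ae_cvg0 p : D p -> {ae P, forall w, u p k w @[k --> \oo] --> 0}.
Proof.
move=> Dp.
have mu2 k : measurable_fun setT (fun w => (u p k w ^+ 2)%:E).
  exact/measurable_EFinP/measurable_funX/measurable_residual.
have u20 k w : setT w -> (0 <= (u p k w ^+ 2)%:E)%E by rewrite lee_fin sqr_ge0.
have := fatou P measurableT mu2 u20.
have -> : (limn_einf (fun k => \int[P]_w (u p k w ^+ 2)%:E) = 0)%E.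
  by have [] := cvg_limn_einf_sup (residual_energy_cvg0 Dp).
have sqlim w : (u p k w ^+ 2)%:E @[k --> \oo] --> (lim (u p k w @[k --> \oo]) ^+ 2)%:E.
  apply: cvg_EFin; first exact: nearW.
  rewrite expr2 (_ : _ \o _ = fun k => u p k w * u p k w).
    by apply: cvgM; exact: residual_is_cvg.
  by apply/funext => k.
have limE w : limn_einf (fun k => (u p k w ^+ 2)%:E) = (lim (u p k w @[k --> \oo]) ^+ 2)%:E.
  by have [] := cvg_limn_einf_sup (sqlim w).
under eq_integral do rewrite limE.
move=> le0.
have mlim : measurable_fun setT (fun w => (lim (u p k w @[k --> \oo]) ^+ 2)%:E).
  apply: (emeasurable_fun_cvg (fun k w => (u p k w ^+ 2)%:E)).
    exact: mu2.
  by move=> w _; exact: sqlim.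
have : (\int[P]_w `|(lim (u p k w @[k --> \oo]) ^+ 2)%:E| = 0)%E.
  apply/eqP; rewrite eq_le; apply/andP; split; last exact: integral_ge0.
  apply: le_trans le0; rewrite le_eqVlt; apply/orP; left; apply/eqP.
  by apply: eq_integral => w _; rewrite abse_EFin ger0_norm// sqr_ge0.
move=> /(ae_eq_integral_abs P measurableT mlim); apply: filterS => w /(_ I)[].
move=> /eqP; rewrite sqrf_eq0 => /eqP l0.
by rewrite -l0; exact: residual_is_cvg.
Qed.

(** Outside a null set common to the countably many rational points, totality
    puts [f w] itself in the class of the [g] with [<r_k, g> -> 0], and
    [<r_k, f w> = |r_k|^2]. *)
Lemma residual_ae_norm_cvg0 :
  {ae P, forall w, inner mu (res k w) (res k w) @[k --> \oo] --> 0}.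
Proof.
have H : {ae P, forall w, forall i : nat,
    if @unpickle 'rV[rat]_N i is Some t then
      D (map_mx ratr t) -> u (map_mx ratr t) k w @[k --> \oo] --> 0 else True}.
  apply: ae_foralln => i; case: unpickle => [t|]; last exact: nearW.
  have [Dt|nDt] := pselect (D (map_mx ratr t)); last exact: nearW.
  by have := residual_ae_cvg0 Dt; apply: filterS => w.
move: H; apply: filterS => w Hw.
have cM := @weak_null_closed_class _ _ _ mu S mS S0 (res^~ w) (inner mu (f w) (f w))
  (res2^~ w) (fun k => norm_gs_residual_le Kt2 k (fL2 w)).
have [t Dt|_] := total cM _ (fL2 w).
  split; first exact: K2.
  by have := Hw (pickle t); rewrite pickleK => /(_ Dt).
by under eq_fun do rewrite -gs_residual_selfE//.
Qed.

Lemma residual_cvg0 :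
  (\int[P]_w (inner mu (res k w) (res k w))%:E)%E @[k --> \oo] --> 0%E.
Proof.
have mr k : measurable_fun setT (fun w => (inner mu (res k w) (res k w))%:E).
  apply/measurable_EFinP.
  rewrite (_ : (fun _ => _) = fun w => inner mu (f w) (f w) -
    \sum_(j < k) inner mu (f w) (E j) ^+ 2).
    apply: measurable_funB; first exact: measurable_sqnorm.
    by apply: measurable_sum => j; apply: measurable_funX; exact/measurable_inner/E2.
  by apply/funext => w; rewrite /res norm_gs_residual.
have [||||_ _] := @dominated_convergence _ _ _ P setT measurableT
    (fun k w => (inner mu (res k w) (res k w))%:E) (fun=> 0%E)
    (fun w => (inner mu (f w) (f w))%:E) mr.
- by [].
- by have := residual_ae_norm_cvg0; apply: filterS => w h _; apply: cvg_EFin => //; exact: nearW.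
- exact: sqnorm_integrable.
- apply: nearW => w k _; rewrite abse_EFin lee_fin ger0_norm ?inner_ge0//.
  exact: norm_gs_residual_le.
- by rewrite integral0.
Qed.

Lemma cvg_random_L2_partial_sums : cvg_random_L2 mu P
  (fun m w y => \sum_(k < m) inner mu (f w) (E k) * E k y) f.
Proof.
have := residual_cvg0; rewrite /cvg_random_L2.
rewrite (_ : (fun k => \int[P]_w (inner mu (res k w) (res k w))%:E)%E =
  (fun m => \int[P]_w (L2norm mu (res m w) ^+ 2))%E)//.
apply/funext => m; apply: eq_integral => w _; by rewrite sqr_L2normE.
Qed.

Let U := lift_fun mu K.

Lemma lift_partial_sum m w p : D p ->
  U (f w) p - \sum_(k < m) inner mu (f w) (E k) * U (E k) p = U (res m w) p.
Proof.
move=> Dp; have Kp2 := K2 Dp; have UE g : U g p = inner mu g (K p) by rewrite innerC.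
rewrite !UE inner_gs_residual//; congr (_ - _).
by apply: eq_bigr => i _; rewrite UE.
Qed.

(** The Hardy norm of [u_g] is an infimum over boundary functions, hence at most
    the norm of [g]. *)
Lemma cvg_random_H2_residual (V : nat -> Omega -> 'rV[R]_N -> R) :
  (forall m w p, D p -> U (f w) p - V m w p = U (res m w) p) ->
  cvg_random_H2 mu P D K V (fun w => U (f w)).
Proof.
move=> VE; rewrite /cvg_random_H2.
have hn0 W : (0 <= hardy_norm mu D K W)%E.
  by apply: le_ereal_inf_tmp => _ [g _ <-]; exact: Lnorm_ge0.
apply: (@squeeze_cvge _ _ _ _ (fun=> 0%E) _
  (fun m => \int[P]_w (L2norm mu (res m w) ^+ 2))%E); last exact: cvg_random_L2_partial_sums.
  apply: nearW => m; rewrite integral_ge0 ?andTb; last by move=> w _; exact: expe_ge0.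
  apply: ge0_le_integral_all => w; first exact: expe_ge0.
  have h : (hardy_norm mu D K (fun x => U (f w) x - V m w x)%R <= L2norm mu (res m w))%E.
    by apply: ereal_inf_lbound; exists (res m w) => //; split => // x Dx; exact: VE.
  by rewrite lee_sqr// Lnorm_ge0.
exact: cvg_cst.
Qed.

Lemma lift_gs_vector (a : nat -> nat -> R) :
  (forall k y, E k y = \sum_(j < k.+1) a k j * Kt j y) ->
  forall m w p, D p ->
    \sum_(k < m) inner mu (f w) (E k) * U (E k) p =
    \sum_(j < m) kernel_coef mu K q v f a m j w * U (Kt j) p.
Proof.
move=> Ea m w p Dp; have Kp2 := K2 Dp.
have UE g : U g p = inner mu g (K p) by rewrite innerC.
have UEk k : U (E k) p = \sum_(j < k.+1) a k j * U (Kt j) p.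
  rewrite UE (_ : E k = fun y => \sum_(j < k.+1) a k j * Kt j y); last exact/funext.
  rewrite inner_suml//; last by move=> i; exact: L2_scale.
  by apply: eq_bigr => j _; rewrite inner_scalel// UE.
transitivity (\sum_(k < m) \sum_(j < m) (if (j <= k)%N then
    inner mu (f w) (E k) * a k j * U (Kt j) p else 0)).
  apply: eq_bigr => k _; rewrite UEk mulr_sumr.
  rewrite (big_ord_widen m (fun j => inner mu (f w) (E k) * (a k j * U (Kt j) p)))//.
  rewrite big_mkcond/=; apply: eq_bigr => j _; rewrite ltnS.
  by case: ifP => // _; rewrite mulrA.
rewrite exchange_big/=; apply: eq_bigr => j _.
rewrite /kernel_coef mulr_suml -big_mkcond/=.
by rewrite (@big_nat_widenl _ _ _ j 0)// big_mkord.
Qed.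

(** The kernel family enters only through square integrability and the totality
    of its members at rational points. *)
Theorem random_expansion :
  [/\ cvg_random_L2 mu P
        (fun m w y => \sum_(k < m) inner mu (f w) (E k) * E k y) f,
      cvg_random_H2 mu P D K
        (fun m w x => \sum_(k < m) inner mu (f w) (E k) * U (E k) x)
        (fun w => U (f w)) &
      exists a : nat -> nat -> R,
        let c := kernel_coef mu K q v f a in
        [/\ forall k y, E k y = \sum_(j < k.+1) a k j * Kt j y,
            forall m w x, D x ->
              \sum_(k < m) inner mu (f w) (E k) * U (E k) x =
              \sum_(j < m) c m j w * U (Kt j) x &
            cvg_random_H2 mu P D K
              (fun m w x => \sum_(j < m) c m j w * U (Kt j) x)
              (fun w => U (f w))]].
Proof.
split; first exact: cvg_random_L2_partial_sums.
  by apply: cvg_random_H2_residual => m w p Dp; exact: lift_partial_sum.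
have [a Ea] := gs_vector_span mu Kt; exists a; split => //.
  exact: lift_gs_vector.
apply: cvg_random_H2_residual => m w p Dp.
by rewrite -lift_gs_vector// lift_partial_sum.
Qed.
End convergence.

(** * Totality of multiplicative families *)

Section level_sets.
Context {R : realType} {d : measure_display} {Y : measurableType d}.
Implicit Types (f g : Y -> R) (c : R).

Lemma measurable_superlevel f c : measurable_fun setT f ->
  measurable [set y | c < f y].
Proof.
move=> mf; rewrite (_ : [set _ | _] = setT `&` f @^-1` `]c, +oo[%classic).
  exact: mf.
by rewrite setTI; apply/seteqP; split=> y /=; rewrite in_itv/= andbT.
Qed.

Lemma measurable_le_set f g : measurable_fun setT f -> measurable_fun setT g ->
  measurable [set y | f y <= g y].
Proof.
move=> mf mg; rewrite (_ : [set _ | _] = ~` [set y | 0 < f y - g y]).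
  by apply/measurableC/measurable_superlevel; exact: measurable_funB.
by apply/seteqP; split=> y /=; rewrite subr_gt0 leNgt => /negP.
Qed.
End level_sets.

Section square_root_iteration.
Context {R : realType}.
Implicit Types t : R.

(** The iteration [p + (a - p^2) / 2] for the square root. Applied to [t^2], it
    makes [|t|] a bounded limit of polynomials in [t]. *)
Fixpoint sqrt_iter (a : R) n : R :=
  if n is m.+1 then sqrt_iter a m + (a - sqrt_iter a m ^+ 2) / 2 else 0.

(** The error [t - p] is multiplied by [1 - (t + p) / 2] at each step. *)
Lemma sqrt_iterP t n : 0 <= t <= 1 ->
  (0 <= sqrt_iter (t ^+ 2) n <= t) /\
  (t - sqrt_iter (t ^+ 2) n <= (1 - t / 2) ^+ n).
Proof.
move=> /andP[t0 t1]; elim: n => [|n [/andP[p0 pt] pn]] /=.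
  by rewrite lexx t0 subr0 expr0.
set p := sqrt_iter _ _ in p0 pt pn *.
have e : t - (p + (t ^+ 2 - p ^+ 2) / 2) = (1 - (t + p) / 2) * (t - p) by field.
have le1 : 0 <= 1 - (t + p) / 2 by lra.
have e' := mulr_ge0 le1 (_ : 0 <= t - p); rewrite subr_ge0 in e'.
split.
  apply/andP; split; last by rewrite -subr_ge0 e e'.
  rewrite addr_ge0// divr_ge0// subr_ge0 lerXn2r//.
rewrite e exprS; apply: ler_pM => //; first by rewrite subr_ge0.
by lra.
Qed.

Lemma sqrt_iter_cvg t : 0 <= t <= 1 -> sqrt_iter (t ^+ 2) @ \oo --> t.
Proof.
move=> t01; have /andP[t0 t1] := t01.
have [->|tn0] := eqVneq t 0.
  rewrite (_ : sqrt_iter _ = fun=> 0); first exact: cvg_cst.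
  apply/funext => n; have [|/andP[h1 h2] _] := @sqrt_iterP 0 n.
    by rewrite lexx ler01.
  by apply/eqP; rewrite eq_le h1 h2.
have tp : 0 < t by rewrite lt0r tn0.
apply: (@squeeze_cvgr _ _ _ _ (fun n => t - (1 - t / 2) ^+ n) (fun=> t)).
- apply: nearW => n; have [/andP[_ h2] h3] := sqrt_iterP n t01.
  by rewrite h2 andbT; lra.
- rewrite -[X in _ --> X]subr0; apply: cvgB; first exact: cvg_cst.
  apply: cvg_expr; rewrite ger0_norm; lra.
- exact: cvg_cst.
Qed.

End square_root_iteration.

Section multiplicative_families.
Context {R : realType} {d : measure_display} {Y : measurableType d}.
Variables (mu : {measure set Y -> \bar R}) (S : set Y) (M : set (Y -> R)).
Hypothesis mS : measurable S.
Hypothesis S0 : mu (~` S) = 0%E.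
Hypothesis cM : closed_class mu S M.
Variable G : set (Y -> R).
Hypothesis GM : G `<=` M.
Hypothesis G01 : forall g y, G g -> S y -> 0 <= g y <= 1.
Hypothesis GG : forall g h, G g -> G h -> G (fun y => g y * h y).
Implicit Types (g h phi th : Y -> R).

(** The functions [g phi], for [g] in [G], stay in [M]. With the factor [g],
    constants are admissible even where they are not square integrable. *)
Definition admissible_weight phi : Prop :=
  [/\ measurable_fun setT phi, (exists C, forall y, S y -> `|phi y| <= C) &
      forall g, G g -> M (fun y => g y * phi y)].

(** Asking that multiplication preserve admissible weights, rather than that
    [th] be admissible itself, makes the multipliers an algebra; they contain
    [G] because [G] is stable under products. *)
Definition weight_multiplier th : Prop :=
  measurable_fun setT th /\
  forall phi, admissible_weight phi -> admissible_weight (fun y => phi y * th y).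

Local Notation W := admissible_weight.
Local Notation T := weight_multiplier.

Let mG g : G g -> measurable_fun setT g.
Proof. by move=> /GM /(closed_class_L2 cM) /L2_measurable. Qed.

Lemma multiplier_gen g : G g -> T g.
Proof.
move=> Gg; split; first exact: mG.
move=> phi [mphi [C phiC] Mphi]; split.
- by apply: measurable_funM => //; exact: mG.
- exists C => y Sy; rewrite normrM; have /andP[g0 g1] := G01 Gg Sy.
  rewrite (le_trans _ (phiC y Sy))// ler_piMr//.
  by rewrite ger0_norm.
- move=> h Gh; rewrite (_ : (fun _ => _) = fun y => (h y * g y) * phi y).
    exact/Mphi/GG.
  by apply/funext => y; rewrite -mulrA (mulrC (g y)).
Qed.

Lemma multiplier_cst c : T (fun=> c).
Proof.
split => // phi [mphi [C phiC] Mphi]; split.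
- exact: measurable_funM.
- exists (C * `|c|) => y Sy; rewrite normrM ler_wpM2r//; exact: phiC.
- move=> h Gh; rewrite (_ : (fun _ => _) = fun y => c * (h y * phi y)).
    exact/(closed_class_scale cM)/Mphi.
  by apply/funext => y; rewrite mulrA mulrC.
Qed.

Lemma multiplier_mul th1 th2 : T th1 -> T th2 -> T (fun y => th1 y * th2 y).
Proof.
move=> [m1 T1] [m2 T2]; split; first exact: measurable_funM.
move=> phi /T1/T2; congr W; apply/funext => y; by rewrite mulrA.
Qed.

Lemma multiplier_add th1 th2 : T th1 -> T th2 -> T (fun y => th1 y + th2 y).
Proof.
move=> [m1 T1] [m2 T2]; split; first exact: measurable_funD.
move=> phi Wphi; have [ma [A phiA] Ma] := T1 _ Wphi; have [mb [B phiB] Mb] := T2 _ Wphi.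
split.
- by under eq_fun do rewrite mulrDr; exact: measurable_funD.
- exists (A + B) => y Sy; rewrite mulrDr (le_trans (ler_normD _ _))// lerD//.
    exact: phiA.
  exact: phiB.
- move=> g Gg; have := closed_class_add cM (Ma g Gg) (Mb g Gg); congr M.
  by apply/funext => y; rewrite !mulrDr.
Qed.

Lemma multiplier_scale c th : T th -> T (fun y => c * th y).
Proof. by apply: multiplier_mul; exact: multiplier_cst. Qed.

Lemma multiplier_sub th1 th2 : T th1 -> T th2 -> T (fun y => th1 y - th2 y).
Proof.
move=> T1 T2; rewrite (_ : (fun _ => _) = fun y => th1 y + (-1) * th2 y).
  exact/multiplier_add/multiplier_scale.
by apply/funext => y; rewrite mulN1r.
Qed.

Lemma multiplier_exp th n : T th -> T (fun y => th y ^+ n).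
Proof.
move=> Tth; elim: n => [|n ih]; first exact: multiplier_cst.
rewrite (_ : (fun _ => _) = fun y => th y * th y ^+ n); first exact: multiplier_mul.
by apply/funext => y; rewrite exprS.
Qed.

Lemma multiplier_lim (th_ : nat -> Y -> R) th C : (forall i, T (th_ i)) ->
  measurable_fun setT th -> (forall i y, S y -> `|th_ i y| <= C) ->
  (forall y, S y -> th_ ^~ y @ \oo --> th y) -> T th.
Proof.
move=> T_ mth thC th_th; split => // phi Wphi.
have [mphi [B phiB] Mphi] := Wphi; split; first exact: measurable_funM.
- exists (B * C) => y Sy; rewrite normrM ler_pM//; first exact: phiB.
  have : `|th_ i y| @[i --> \oo] --> `|th y| by apply: cvg_norm; exact: th_th.
  by move=> /cvgr_to_le; apply; apply: nearW => i; exact: thC.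
- move=> g Gg; have g2 := closed_class_L2 cM (GM Gg).
  apply: (@closed_class_lim _ _ _ _ _ _ cM (fun i y => g y * (phi y * th_ i y)) _
      (fun y => `|(B * C) * g y|)).
  + by move=> i; have [_ /(_ phi Wphi)[_ _]] := T_ i; exact.
  + by apply: measurable_funM; [exact: mG|exact: measurable_funM].
  + exact/L2_norm/L2_scale.
  + move=> i y Sy; have le1 : `|phi y * th_ i y| <= `|B * C|.
      apply: le_trans (ler_norm (B * C)).
      by rewrite normrM ler_pM//; [exact: phiB|exact: thC].
    by rewrite normrM (normrM (B * C)) mulrC ler_wpM2r.
  + move=> y Sy; apply: cvgM; first exact: cvg_cst.
    by apply: cvgM; [exact: cvg_cst|exact: th_th].
Qed.

(** Absolute values are bounded limits of polynomials, by the square root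
    iteration. *)
Lemma multiplier_abs th : T th -> (forall y, S y -> `|th y| <= 1) ->
  T (fun y => `|th y|).
Proof.
move=> Tth th1; apply: (@multiplier_lim (fun n y => sqrt_iter (th y ^+ 2) n) _ 1).
- elim=> [|n ih] /=; first exact: multiplier_cst.
  apply: multiplier_add => //.
  rewrite (_ : (fun _ => _) = fun y => 2^-1 *
     (th y ^+ 2 - sqrt_iter (th y ^+ 2) n ^+ 2)); last first.
    by apply/funext => y; rewrite mulrC.
  by apply/multiplier_scale/multiplier_sub; exact: multiplier_exp.
- by case: Tth => mth _; exact: measurableT_comp.
- move=> i y Sy; rewrite -(real_normK (num_real (th y))).
  have [|/andP[h1 h2] _] := @sqrt_iterP R `|th y| i; first by rewrite normr_ge0 th1.
  by rewrite (ger0_norm h1) (le_trans h2)// th1.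
- move=> y Sy; rewrite -(real_normK (num_real (th y))).
  by apply: sqrt_iter_cvg; rewrite normr_ge0 th1.
Qed.

(** [1 - (1 - th)^n] tends to the indicator of the set where [th > 0]. *)
Lemma multiplier_pos th : T th -> (forall y, S y -> 0 <= th y <= 1) ->
  T (\1_[set y | 0 < th y]).
Proof.
move=> Tth th1.
have mset : measurable [set y | 0 < th y].
  by apply: measurable_superlevel; case: Tth.
apply: (@multiplier_lim (fun n y => 1 - (1 - th y) ^+ n) _ 1).
- move=> n; apply: multiplier_sub; first exact: multiplier_cst.
  by apply: multiplier_exp; apply: multiplier_sub => //; exact: multiplier_cst.
- exact: measurable_indic.
- move=> n y Sy; have /andP[h0 h1] := th1 y Sy.
  have h2 : 0 <= 1 - th y <= 1 by lra.
  rewrite ger0_norm; last by rewrite subr_ge0 exprn_ile1//; case/andP: h2.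
  by rewrite gerBl exprn_ge0//; case/andP: h2.
- move=> y Sy; have /andP[h0 h1] := th1 y Sy; rewrite indicE.
  have [th0|th0] := ltP 0 (th y).
    rewrite mem_set//= -[X in _ --> X]subr0; apply: cvgB; first exact: cvg_cst.
    apply: cvg_expr; rewrite ger0_norm; lra.
  rewrite memNset/=; last by apply/negP; rewrite -leNgt.
  have -> : th y = 0 by apply/eqP; rewrite eq_le h0 th0.
  rewrite (_ : (fun _ => _) = fun=> 0); first exact: cvg_cst.
  by apply/funext => n; rewrite subr0 expr1n subrr.
Qed.

(** The positive part of an affine function of [g] is a multiplier with values
    in [0, 1], and it is positive exactly where [g > c]. *)
Lemma multiplier_superlevel g c : G g -> T (\1_[set y | c < g y]).
Proof.
move=> Gg.
(* Division by b brings g - c into [-1, 1], since g takes values in [0, 1]. *)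
pose b := 1 + `|c|; have b0 : 0 < b by rewrite ltr_wpDr.
pose th y := b^-1 * (g y - c).
have Tth : T th.
  by apply/multiplier_scale/multiplier_sub; [exact: multiplier_gen|exact: multiplier_cst].
have th1 y : S y -> `|th y| <= 1.
  move=> Sy; have /andP[g0 g1] := G01 Gg Sy.
  rewrite normrM gtr0_norm ?invr_gt0// ler_pdivrMl// mulr1 /b.
  by rewrite (le_trans (ler_normB _ _))// lerD2r ger0_norm.
pose u y := 2^-1 * (`|th y| + th y).
have Tu : T u by apply/multiplier_scale/multiplier_add => //; exact: multiplier_abs.
have uE : [set y | c < g y] = [set y | 0 < u y].
  apply/funext => y; apply/propext; rewrite /= /u pmulr_rgt0 ?invr_gt0//.
  have thc : (0 < th y) = (c < g y) by rewrite /th pmulr_rgt0 ?invr_gt0// subr_gt0.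
  rewrite -thc; have [h|h] := ltP 0 (th y).
    by rewrite gtr0_norm// addr_gt0.
  by rewrite ler0_norm// addNr ltxx.
rewrite uE; apply: multiplier_pos => // y Sy.
have := th1 y Sy; rewrite /u ler_norml => /andP[h1 h2].
have := ler_norm (th y); have := ler_norm (- th y); rewrite normrN.
have th1y := th1 y Sy; lra.
Qed.

(** The indicator of a countable union is the limit of
    [1 - prod_(i < n) (1 - 1_(A i))]. *)
Lemma multiplier_sigma_algebra :
  sigma_algebra setT [set A | measurable A /\ T \1_A].
Proof.
split.
- split => //; rewrite indic0; exact: multiplier_cst.
- move=> A [mA TA]; rewrite setTD; split; first exact: measurableC.
  rewrite (_ : \1_(~` A) = fun y => 1 - \1_A y); last first.
    by rewrite indicC; apply/funext => y; rewrite indicE; case: (y \in A); rewrite /= ?subrr ?subr0.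
  by apply: multiplier_sub => //; exact: multiplier_cst.
- move=> A TA; have mA : measurable (\bigcup_k A k).
    by apply: bigcup_measurable => k _; have [] := TA k.
  split => //.
  apply: (@multiplier_lim (fun n y => 1 - \prod_(i < n) (1 - \1_(A i) y)) _ 1).
  + move=> n; apply: multiplier_sub; first exact: multiplier_cst.
    elim: n => [|n ih].
      rewrite (_ : (fun _ => _) = fun=> 1); first exact: multiplier_cst.
      by apply/funext => y; rewrite big_ord0.
    rewrite (_ : (fun _ => _) = fun y => \prod_(i < n) (1 - \1_(A i) y) * (1 - \1_(A n) y)).
      apply: multiplier_mul => //; apply: multiplier_sub; first exact: multiplier_cst.
      by have [] := TA n.
    by apply/funext => y; rewrite big_ord_recr.
  + exact: measurable_indic.
  + move=> n y _; have h i : 0 <= 1 - (\1_(A i) y : R) <= 1.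
      by rewrite indicE; case: (_ \in _) => /=; lra.
    have : 0 <= \prod_(i < n) (1 - (\1_(A i) y : R)) <= 1.
      rewrite prodr_ge0/=; last by move=> i _; case/andP: (h i).
      by apply: prodr_ile1 => i _; exact: h.
    by move=> /andP[p0 p1]; rewrite ger0_norm ?subr_ge0// gerBl.
  + move=> y _; have [[i _ Ai]|nA] := pselect ((\bigcup_k A k) y).
      rewrite indicE mem_set; last by exists i.
      apply: cvg_near_cst; exists i.+1 => // n /= ni.
      rewrite (bigD1 (Ordinal ni))//= indicE mem_set//= subrr mul0r subr0//.
    rewrite indicE memNset//.
    rewrite (_ : (fun _ => _) = fun=> 0); first exact: cvg_cst.
    apply/funext => n; rewrite big1 ?subrr// => i _.
    by rewrite indicE memNset ?subr0// => Ai; apply: nA; exists i.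
Qed.

Hypothesis generated : measurable `<=`
  <<s [set A | exists2 g, G g & exists c, A = [set y | c < g y]] >>.

Lemma multiplier_indic A : measurable A -> T \1_A.
Proof.
move=> /generated; suff : <<s [set A | exists2 g, G g & exists c, A = [set y | c < g y]] >>
    `<=` [set A | measurable A /\ T \1_A] by move=> /[apply] -[].
apply: smallest_sub; first exact: multiplier_sigma_algebra.
move=> _ [g Gg [c ->]]; split; last exact: multiplier_superlevel.
by apply: measurable_superlevel; exact: mG.
Qed.

(** Binary expansion: [r n] is the remainder of [phi] after [n] digits, and the
    [n]-th digit is the indicator of a measurable set. *)
Lemma multiplier_unit_interval phi : measurable_fun setT phi ->
  (forall y, 0 <= phi y <= 1) -> T phi.
Proof.
move=> mphi phi01.
pose fix r (n : nat) (y : Y) {struct n} : R := if n is m.+1 then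
  r m y - 2^-1 ^+ n * \1_[set z | 2^-1 ^+ n <= r m z] y else phi y.
have mr n : measurable_fun setT (r n) /\
    measurable [set z | 2^-1 ^+ n.+1 <= r n z].
  have mlev (f : Y -> R) c : measurable_fun setT f -> measurable [set z | c <= f z].
    by move=> mf; exact: measurable_le_set.
  elim: n => [|n [mrn mset]]; first by split => //; exact: mlev.
  have mr1 : measurable_fun setT (r n.+1).
    by apply: measurable_funB => //; apply: measurable_funM => //; exact: measurable_indic.
  by split => //; exact: mlev.
have r01 n y : 0 <= r n y <= 2^-1 ^+ n.
  elim: n => [|n /andP[r0 r1]]; first by rewrite expr0; exact: phi01.
  rewrite /= indicE; have [h|h] := leP (2^-1 ^+ n.+1) (r n y).
    rewrite mem_set//= mulr1 subr_ge0 h/=.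
    by move: r1 h; rewrite exprS; lra.
  rewrite memNset; last by rewrite /= leNgt h.
  by rewrite mulr0 subr0 r0 ltW.
apply: (@multiplier_lim (fun n y => phi y - r n y) _ 1).
- elim=> [|n ih].
    rewrite (_ : (fun _ => _) = fun=> 0); first exact: multiplier_cst.
    by apply/funext => y; rewrite /= subrr.
  rewrite (_ : (fun _ => _) = fun y => (phi y - r n y) +
      2^-1 ^+ n.+1 * \1_[set z | 2^-1 ^+ n.+1 <= r n z] y).
    apply: multiplier_add => //; apply: multiplier_scale; apply: multiplier_indic.
    by have [] := mr n.
  by apply/funext => y; rewrite /= opprB addrA addrAC.
- exact: mphi.
- move=> n y _; have := r01 n y; have := phi01 y => /andP[p0 p1] /andP[r0 r1].
  have : r n y <= 1 by rewrite (le_trans r1)// exprn_ile1//; lra.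
  rewrite ler_norml; move: (r n y) (phi y) p0 p1 r0 => a b p0 p1 r0 a1; apply/andP; split; lra.
- move=> y _; rewrite -[X in _ --> X]subr0; apply: cvgB; first exact: cvg_cst.
  apply: (@squeeze_cvgr _ _ _ _ (fun=> 0) (fun n => 2^-1 ^+ n)).
  + by apply: nearW => n; exact: r01.
  + exact: cvg_cst.
  + by apply: cvg_expr; rewrite ger0_norm; lra.
Qed.

Lemma multiplier_bounded phi C : measurable_fun setT phi ->
  (forall y, `|phi y| <= C) -> T phi.
Proof.
move=> mphi phiC.
have [Y0|/existsNP[y0 _]] := pselect (forall y : Y, False).
  rewrite (_ : phi = fun=> 0); first exact: multiplier_cst.
  by apply/funext => y; case: (Y0 y).
have C0 : 0 <= C by exact: le_trans (phiC y0).
pose b := 2 * (C + 1).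
have b0 : 0 < b by rewrite /b; lra.
rewrite (_ : phi = fun y => b * (b^-1 * phi y + 2^-1) - b * 2^-1).
  apply: multiplier_sub; last exact: multiplier_cst.
  apply: multiplier_scale; apply: multiplier_unit_interval.
    by apply: measurable_funD => //; exact: measurable_funM.
  move=> y; have : `|b^-1 * phi y| <= 2^-1.
    rewrite normrM gtr0_norm ?invr_gt0// ler_pdivrMl// /b.
    by apply: (le_trans (phiC y)); lra.
  by rewrite ler_norml; lra.
apply/funext => y; rewrite mulrDr mulrA mulfV ?gt_eqF// mul1r; lra.
Qed.

Hypothesis Gpos : exists2 g, G g & forall y, S y -> 0 < g y.

(** A square integrable [h] is the limit of its truncations to the sets
    [|h| <= n g0], which are [g0] times a bounded function. *)
Theorem multiplicative_total : L2 mu `<=` M.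
Proof.
move=> h h2; have [g0 Gg0 g0p] := Gpos; have mh := L2_measurable h2.
pose phi n y := (h y / g0 y) * \1_[set z | `|h z| <= n%:R * g0 z] y.
have mphi n : measurable_fun setT (phi n).
  apply: measurable_funM.
    apply: measurable_funM => //; apply: measurableT_comp (mG Gg0).
    exact: measurable_invr.
  apply: measurable_indic; apply: measurable_le_set.
    exact: measurableT_comp.
  by apply: measurable_funM => //; exact: mG.
have phin n y : `|phi n.+1 y| <= n.+1%:R.
  rewrite /phi indicE; have [hn|hn] := leP `|h y| (n.+1%:R * g0 y).
    rewrite mem_set// mulr1; have [->|g00] := eqVneq (g0 y) 0.
      by rewrite invr0 mulr0 normr0.
    have gp : 0 < g0 y.
      by rewrite lt0r g00; have := le_trans (normr_ge0 _) hn; rewrite pmulr_rge0.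
    by rewrite normrM normfV (gtr0_norm gp) ler_pdivrMr.
  by rewrite memNset ?mulr0 ?normr0// /= leNgt hn.
apply: (@closed_class_lim _ _ _ _ _ _ cM (fun n y => g0 y * phi n.+1 y) _ (fun y => `|h y|)) => //.
- move=> n; have [_ /(_ (fun=> 1))[]] := multiplier_bounded (mphi n.+1) (phin n).
    split => //; first by exists 1 => y _; rewrite normr1.
    by move=> g Gg; rewrite (_ : (fun _ => _) = g); [exact: GM|apply/funext => y; rewrite mulr1].
  move=> _ _ /(_ g0 Gg0); congr M; apply/funext => y; by rewrite mul1r.
- exact: L2_norm.
- move=> n y Sy; have gp := g0p y Sy.
  rewrite /phi mulrA (mulrC (g0 y)) divfK ?gt_eqF// normrM indicE.
  by case: (_ \in _); rewrite ?normr1 ?normr0 ?mulr1 ?mulr0.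
- move=> y Sy; have gp := g0p y Sy.
  have [n0 n0P] : exists n, `|h y| / g0 y <= n%:R.
    by exists (Num.truncn (`|h y| / g0 y)).+1; apply/ltW/truncnS_gt.
  apply: cvg_near_cst; exists n0 => // n /= n0n.
  rewrite /phi mulrA (mulrC (g0 y)) divfK ?gt_eqF// indicE mem_set ?mulr1//=.
  rewrite -ler_pdivrMr// (le_trans n0P)// ler_nat ltnW//.
Qed.
End multiplicative_families.

(** * From powers to exponentials *)

Section real_powers.
Context {R : realType}.
Implicit Types a b h p : R.

Lemma gt0_powRE a p : 0 < a -> a `^ p = expR (p * ln a).
Proof. by move=> a0; rewrite /powR gt_eqF. Qed.

Lemma powRNB1 b p : 0 < b -> b `^ (- p - 1) = b `^ (- p) / b.
Proof.
move=> b0; rewrite powRD; last by rewrite (gt_eqF b0) implybT.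
by rewrite powR_inv1 ?ltW.
Qed.

(** Convexity of [a |-> a `^ (- p)], in the form of its tangent at [b]; it follows
    from [1 + x <= exp x] and [ln (1 + x) <= x]. *)
Lemma powRN_tangent a b p : 0 < a -> 0 < b -> 0 <= p ->
  b `^ (- p) - p * (a - b) * b `^ (- p - 1) <= a `^ (- p).
Proof.
move=> a0 b0 p0; rewrite powRNB1//.
have -> : b `^ (- p) - p * (a - b) * (b `^ (- p) / b) =
    b `^ (- p) * (1 - p * (a / b - 1)).
  by field; rewrite gt_eqF.
have -> : a `^ (- p) = b `^ (- p) * expR (- p * (ln a - ln b)).
  by rewrite !gt0_powRE// -expRD; congr expR; ring.
rewrite ler_wpM2l ?powR_ge0//; apply: le_trans (expR_ge1Dx _).
rewrite lerD2l mulNr lerN2 ler_wpM2l//.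
have -> : ln a - ln b = ln (1 + (a / b - 1)).
  by rewrite subrKC ln_div ?posrE.
by apply: le_ln1Dx; have := divr_gt0 a0 b0; lra.
Qed.

Lemma powRN_normalize s r p : 0 < s -> 0 <= r ->
  s `^ p * (s + r) `^ (- p) = (1 + r / s) `^ (- p).
Proof.
move=> s0 r0; have sr : 0 < s + r by rewrite ltr_wpDr.
have -> : 1 + r / s = (s + r) / s by field; rewrite gt_eqF.
by rewrite !gt0_powRE ?divr_gt0// ln_div ?posrE// -expRD; congr expR; ring.
Qed.

Lemma powRN_le a b p : 0 < b -> b <= a -> 0 <= p -> a `^ (- p) <= b `^ (- p).
Proof.
move=> b0 ba p0; have a0 := lt_le_trans b0 ba.
by rewrite !gt0_powRE// ler_expR !mulNr lerN2 ler_wpM2l// ler_ln ?posrE.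
Qed.

(** The tangents at both ends enclose the difference quotient, which gives both
    its domination and its limit. *)
Lemma powRN_quotient_bounds b h p : 0 < b -> 0 < h -> 0 < p ->
  (b + h) `^ (- p - 1) <= (b `^ (- p) - (b + h) `^ (- p)) / (h * p) <= b `^ (- p - 1).
Proof.
move=> b0 h0 p0; have bh : 0 < b + h by rewrite addr_gt0.
have hp : 0 < h * p by rewrite mulr_gt0.
rewrite ler_pdivlMr// ler_pdivrMr//; apply/andP; split.
  have := powRN_tangent b0 bh (ltW p0); lra.
by have := powRN_tangent bh b0 (ltW p0); lra.
Qed.

Lemma powRN_quotient_cvg b (h : nat -> R) p : 0 < b -> 0 < p ->
  (forall i, 0 < h i) -> h @ \oo --> 0 ->
  (b `^ (- p) - (b + h i) `^ (- p)) / (h i * p) @[i --> \oo] --> b `^ (- p - 1).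
Proof.
move=> b0 p0 h0 hcv.
apply: (@squeeze_cvgr _ _ _ _ (fun i => (b + h i) `^ (- p - 1)) (fun=> b `^ (- p - 1))).
- by apply: nearW => i; exact: powRN_quotient_bounds.
- have -> : (fun i => (b + h i) `^ (- p - 1)) = fun i => expR ((- p - 1) * ln (b + h i)).
    by apply/funext => i; rewrite gt0_powRE// addr_gt0.
  rewrite gt0_powRE//; apply: (continuous_cvg _ (@continuous_expR R _)).
  apply: cvgM; first exact: cvg_cst.
  apply: continuous_cvg; first exact: continuous_ln.
  by rewrite -[X in _ --> X]addr0; apply: cvgD => //; exact: cvg_cst.
- exact: cvg_cst.
Qed.

Lemma ln1D_ge x : 0 <= x :> R -> x / (1 + x) <= ln (1 + x).
Proof.
move=> x0; have x1 : 0 < 1 + x by rewrite ltr_wpDr.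
rewrite -[ln _]opprK -lnV ?posrE// lerNr.
rewrite [X in ln X](_ : _ = 1 + (- (x / (1 + x)))); last by field; rewrite gt_eqF.
apply: le_ln1Dx; rewrite ltrN2 ltr_pdivrMr// mul1r; lra.
Qed.

(** With [x = rho / s], the logarithm [(p + j) ln (1 + x)] lies between
    [(p + j) x / (1 + x)] and [(p + j) x], which tend to [a rho] together. *)
Lemma powRN_exp_cvg (rho a p : R) (s : nat -> R) (j : nat -> nat) :
  0 <= rho -> 0 <= p -> (forall k, 0 < s k) -> (s k)^-1 @[k --> \oo] --> 0 ->
  (j k)%:R / s k @[k --> \oo] --> a ->
  (1 + rho / s k) `^ (- (p + (j k)%:R)) @[k --> \oo] --> expR (- (a * rho)).
Proof.
move=> rho0 p0 s0 scv jcv.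
have x0 k : 0 <= rho / s k by rewrite divr_ge0// ltW.
have -> : (fun k => (1 + rho / s k) `^ (- (p + (j k)%:R))) =
    fun k => expR (- ((p + (j k)%:R) * ln (1 + rho / s k))).
  by apply/funext => k; rewrite gt0_powRE ?mulNr// ltr_wpDr.
apply: (continuous_cvg _ (@continuous_expR R _)); apply: cvgN.
have xcv : rho / s k @[k --> \oo] --> rho * 0 by apply: cvgM => //; exact: cvg_cst.
have pjcv : (p + (j k)%:R) * (rho / s k) @[k --> \oo] --> rho * (p * 0 + a).
  rewrite (_ : (fun _ => _) = fun k => rho * (p * (s k)^-1 + (j k)%:R / s k)).
    apply: cvgM; first exact: cvg_cst.
    by apply: cvgD => //; apply: cvgM => //; exact: cvg_cst.
  by apply/funext => k; field; rewrite gt_eqF.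
rewrite mulr0 add0r in pjcv; rewrite mulr0 in xcv.
apply: (@squeeze_cvgr _ _ _ _ (fun k => (p + (j k)%:R) * (rho / s k) / (1 + rho / s k))
    (fun k => (p + (j k)%:R) * (rho / s k))).
- apply: nearW => k; have pj : 0 <= p + (j k)%:R by rewrite addr_ge0.
  rewrite -mulrA !ler_wpM2l ?ln1D_ge ?le_ln1Dx//.
  by rewrite (lt_le_trans _ (x0 k)).
- rewrite [X in _ --> X](_ : _ = rho * a / (1 + 0)); last by rewrite addr0 divr1 mulrC.
  apply: cvgM => //; apply: cvgV; first by rewrite addr0 oner_eq0.
  by apply: cvgD => //; exact: cvg_cst.
- by rewrite (mulrC a).
Qed.
End real_powers.

Section resolvent_to_exponential.
Context {R : realType} {d : measure_display} {Y : measurableType d}.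
Variables (mu : {measure set Y -> \bar R}) (S : set Y) (M : set (Y -> R)).
Hypothesis cM : closed_class mu S M.
Variables (rho : Y -> R) (A : set R).
Hypothesis mrho : measurable_fun setT rho.
Hypothesis rho0 : forall y, S y -> 0 <= rho y.
Hypothesis A0 : forall s, A s -> 0 < s.
Hypothesis Alim : forall s, A s -> exists t : nat -> R,
  (forall i, A (t i) /\ s < t i) /\ (t @ \oo --> s).

Let pw p s y := (s + rho y) `^ (- p).

Lemma measurable_power p s : measurable_fun setT (pw p s).
Proof.
apply: (measurableT_comp (measurable_powR (- p))).
exact: measurable_funD.
Qed.

(** [(s + rho)^-(p + 1)] is, up to the factor [- p], the derivative of
    [(s + rho)^-p] in [s]; right difference quotients stay below [s^-1] times
    the function [(s + rho)^-p] of the class. *)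
Lemma closed_class_power_succ p : 0 < p -> (forall s, A s -> M (pw p s)) ->
  forall s, A s -> M (pw (p + 1) s).
Proof.
move=> p0 MA s As; have [t [At ts]] := Alim As.
have s0 := A0 As; have t0 i : 0 < t i - s by rewrite subr_gt0; have [] := At i.
apply: (@closed_class_lim _ _ _ _ _ _ cM
  (fun i y => ((t i - s) * p)^-1 * (pw p s y - pw p (t i) y)) _
  (fun y => s^-1 * pw p s y)).
- move=> i; apply: (closed_class_scale cM); apply: (closed_class_sub cM); apply: MA => //.
  by have [] := At i.
- exact: measurable_power.
- exact/L2_scale/(closed_class_L2 cM)/MA.
- move=> i y Sy; have b0 : 0 < s + rho y by rewrite ltr_wpDr// rho0.
  have := powRN_quotient_bounds b0 (t0 i) p0.
  rewrite (_ : s + rho y + (t i - s) = t i + rho y); last by ring.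
  move=> /andP[h1 h2]; rewrite mulrC ger0_norm; last first.
    exact: le_trans (powR_ge0 _ _) h1.
  apply: (le_trans h2); rewrite powRNB1// mulrC ler_wpM2r ?powR_ge0//.
  by rewrite lef_pV2 ?posrE// lerDl rho0.
- move=> y Sy; have b0 : 0 < s + rho y by rewrite ltr_wpDr// rho0.
  rewrite /pw opprD.
  have hcv : t i - s @[i --> \oo] --> 0.
    by rewrite -(subrr s); apply: cvgB => //; exact: cvg_cst.
  have := powRN_quotient_cvg b0 p0 t0 hcv.
  rewrite (_ : (fun i => _) = fun i => ((t i - s) * p)^-1 * (pw p s y - pw p (t i) y))//.
  apply/funext => i; rewrite mulrC (_ : s + rho y + (t i - s) = t i + rho y)//.
  by ring.
Qed.

Lemma closed_class_power p k : 0 < p -> (forall s, A s -> M (pw p s)) ->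
  forall s, A s -> M (pw (p + k%:R) s).
Proof.
move=> p0 MA; elim: k => [|k ih] s As; first by rewrite addr0; exact: MA.
rewrite -natr1 addrA; apply: closed_class_power_succ => //.
by rewrite ltr_pwDl.
Qed.

(** The powers [(s + rho)^-(p + j)] are in the class by the preceding lemma; after
    multiplication by [s^(p + j)] they tend to the exponential. That they stay
    below some [G] is a hypothesis, since it depends on how [rho] grows compared
    with the measure. *)
Lemma closed_class_exp (p a : R) (s : nat -> R) (j : nat -> nat) G :
  0 < p -> (forall s, A s -> M (pw p s)) ->
  (forall k, A (s k)) -> (s k)^-1 @[k --> \oo] --> 0 ->
  (j k)%:R / s k @[k --> \oo] --> a -> L2 mu G ->
  (forall k y, S y -> (1 + rho y / s k) `^ (- (p + (j k)%:R)) <= G y) ->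
  M (fun y => expR (- (a * rho y))).
Proof.
move=> p0 MA As scv jcv G2 leG; have s0 k := A0 (As k).
apply: (@closed_class_lim _ _ _ _ _ _ cM
  (fun k y => s k `^ (p + (j k)%:R) * pw (p + (j k)%:R) (s k) y) _ G) => //.
- by move=> k; apply: (closed_class_scale cM); exact: closed_class_power.
- apply: measurableT_comp => //; apply: measurableT_comp => //.
  exact: measurable_funM.
- by move=> k y Sy; rewrite powRN_normalize ?rho0// ger0_norm ?powR_ge0// leG.
- move=> y Sy; have := powRN_exp_cvg (rho0 Sy) (ltW p0) s0 scv jcv.
  rewrite (_ : (fun k => _) =
    fun k => s k `^ (p + (j k)%:R) * pw (p + (j k)%:R) (s k) y)//.
  by apply/funext => k; rewrite powRN_normalize ?rho0.
Qed.
End resolvent_to_exponential.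

(** * Derivatives of kernels along a line *)

Section iterated_derivatives.
Context {R : realType}.
Implicit Types (F H : R -> R) (T Z p : {poly R}).

(** The numerators of the iterated derivatives of [H p] when [H' = H T / Z]; the
    last term is the derivative of the denominator [Z ^ m]. *)
Fixpoint dnum T Z p k : {poly R} :=
  if k is m.+1 then
    T * dnum T Z p m + Z * (dnum T Z p m)^`() - m%:R *: (Z^`() * dnum T Z p m)
  else p.

Lemma is_derive_log_rational H T Z p k s :
  Z.[s] != 0 -> is_derive s (1 : R) H (H s * T.[s] / Z.[s]) ->
  is_derive s (1 : R) (fun s => H s * p.[s] / Z.[s] ^+ k)
    (H s * (T * p + Z * p^`() - k%:R *: (Z^`() * p)).[s] / Z.[s] ^+ k.+1).
Proof.
move=> Zs dH.
have dZ := is_deriveV Zs (is_derive_poly Z s).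
have dp := is_derive_poly p s.
have := is_deriveM (is_deriveM dH dp) (is_deriveX k dZ).
rewrite (_ : H * horner p * _ = fun s => H s * p.[s] / Z.[s] ^+ k); last first.
  by rewrite !fctE; apply/funext => x; rewrite exprVn.
move=> dall; apply: is_derive_eq dall _.
rewrite !hornerE /GRing.scale/= !fctE/=.
rewrite -!exprVn; set w := Z.[s]^-1.
have w0 : w != 0 by rewrite invr_eq0.
have -> : Z.[s] = w^-1 by rewrite invrK.
case: k => [|k]; first by rewrite !expr0 expr1; field.
by rewrite !exprS /=; field.
Qed.

(** By induction: the logarithmic derivative [T / Z] of [H] makes every derivative
    of [H p] the product of [H] and a rational function with denominator
    [Z ^ k]. *)
Lemma derive1n_log_rational F H T Z p k :
  (\forall s \near (0 : R), F s = H s * p.[s]) ->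
  (\forall s \near (0 : R), Z.[s] != 0) ->
  (\forall s \near (0 : R), is_derive s (1 : R) H (H s * T.[s] / Z.[s])) ->
  \forall s \near (0 : R), (F^`(k))%classic s = H s * (dnum T Z p k).[s] / Z.[s] ^+ k.
Proof.
move=> FE Z0 dH; elim: k => [|k ih].
  by apply: filterS FE => s; rewrite derive1n0 expr0 divr1.
have ih2 := near_join ih; near=> s.
rewrite derive1nS derive1E.
rewrite (@near_eq_derive _ _ _ _ (fun s => H s * (dnum T Z p k).[s] / Z.[s] ^+ k)); last first.
  by near: s.
apply: (@derive_val _ _ _ _ _ _ _ _); apply: is_derive_log_rational; near: s => //.
Unshelve. all: by end_near. Qed.
End iterated_derivatives.

Section subexponential.
Context {R : realType} {d : measure_display} {Y : measurableType d}.
Variables (mu : {measure set Y -> \bar R}) (S : set Y) (rho : Y -> R).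
Hypothesis mS : measurable S.
Hypothesis S0 : mu (~` S) = 0%E.
Hypothesis rho0 : forall y, S y -> 0 <= rho y.
Implicit Types (b : Y -> R) (p : Y -> {poly R}).

(** Functions of slow growth, which any exponential [exp (delta rho)] absorbs.
    They form an algebra, and contain [rho] and the bounded functions. With
    [rho = 0] they are the bounded functions. *)
Definition subexp b : Prop := measurable_fun setT b /\
  forall delta, 0 < delta ->
    exists C, forall y, S y -> `|b y| <= C * expR (delta * rho y).

Definition subexp_poly p : Prop := forall i, subexp (fun y => (p y)`_i).

Lemma subexp_cst c : subexp (fun=> c).
Proof.
split => // delta delta0; exists `|c| => y Sy; rewrite ler_peMr//.
by rewrite -expR0 ler_expR mulr_ge0 ?rho0// ltW.
Qed.

Lemma subexp_add b1 b2 : subexp b1 -> subexp b2 -> subexp (fun y => b1 y + b2 y).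
Proof.
move=> [m1 B1] [m2 B2]; split; first exact: measurable_funD.
move=> delta delta0; have [C1 H1] := B1 _ delta0; have [C2 H2] := B2 _ delta0.
exists (C1 + C2) => y Sy; rewrite mulrDl (le_trans (ler_normD _ _))// lerD//.
  exact: H1.
exact: H2.
Qed.

Lemma subexp_mul b1 b2 : subexp b1 -> subexp b2 -> subexp (fun y => b1 y * b2 y).
Proof.
move=> [m1 B1] [m2 B2]; split; first exact: measurable_funM.
move=> delta delta0; have hd : 0 < delta / 2 by rewrite divr_gt0.
have [C1 H1] := B1 _ hd; have [C2 H2] := B2 _ hd.
exists (C1 * C2) => y Sy.
have -> : delta * rho y = delta / 2 * rho y + delta / 2 * rho y by field.
by rewrite expRD mulrACA normrM ler_pM//; [exact: H1|exact: H2].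
Qed.

Lemma subexp_scale c b : subexp b -> subexp (fun y => c * b y).
Proof. by apply: subexp_mul; exact: subexp_cst. Qed.

Lemma subexp_sum (I : Type) (r : seq I) (b : I -> Y -> R) :
  (forall i, subexp (b i)) -> subexp (fun y => \sum_(i <- r) b i y).
Proof.
move=> hb; elim: r => [|i r ih].
  rewrite (_ : (fun _ => _) = fun=> 0); first exact: subexp_cst.
  by apply/funext => y; rewrite big_nil.
rewrite (_ : (fun _ => _) = fun y => b i y + \sum_(j <- r) b j y).
  exact: subexp_add.
by apply/funext => y; rewrite big_cons.
Qed.

Lemma subexp_poly_add p1 p2 : subexp_poly p1 -> subexp_poly p2 ->
  subexp_poly (fun y => p1 y + p2 y).
Proof.
move=> h1 h2 i; rewrite (_ : (fun _ => _) = fun y => (p1 y)`_i + (p2 y)`_i).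
  exact: subexp_add.
by apply/funext => y; rewrite coefD.
Qed.

Lemma subexp_poly_scale c p : subexp_poly p -> subexp_poly (fun y => c *: p y).
Proof.
move=> h i; rewrite (_ : (fun _ => _) = fun y => c * (p y)`_i).
  exact: subexp_scale.
by apply/funext => y; rewrite coefZ.
Qed.

Lemma subexp_poly_sub p1 p2 : subexp_poly p1 -> subexp_poly p2 ->
  subexp_poly (fun y => p1 y - p2 y).
Proof.
move=> h1 h2; rewrite (_ : (fun _ => _) = fun y => p1 y + (-1) *: p2 y).
  exact/subexp_poly_add/subexp_poly_scale.
by apply/funext => y; rewrite scaleN1r.
Qed.

Lemma subexp_poly_mul p1 p2 : subexp_poly p1 -> subexp_poly p2 ->
  subexp_poly (fun y => p1 y * p2 y).
Proof.
move=> h1 h2 i; rewrite (_ : (fun _ => _) =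
    fun y => \sum_(j < i.+1) (p1 y)`_j * (p2 y)`_(i - j)).
  by apply: subexp_sum => j; exact: subexp_mul.
by apply/funext => y; rewrite coefM.
Qed.

Lemma subexp_poly_deriv p : subexp_poly p -> subexp_poly (fun y => (p y)^`()).
Proof.
move=> h i; rewrite (_ : (fun _ => _) = fun y => i.+1%:R * (p y)`_i.+1).
  exact: subexp_scale.
by apply/funext => y; rewrite coef_deriv mulr_natl.
Qed.

Lemma subexp_poly_cst (q : {poly R}) : subexp_poly (fun=> q).
Proof. by move=> i; exact: subexp_cst. Qed.

Lemma subexp_polyC b : subexp b -> subexp_poly (fun y => (b y)%:P).
Proof.
move=> hb [|i].
  by rewrite (_ : (fun _ => _) = b)//; apply/funext => y; rewrite coefC.
rewrite (_ : (fun _ => _) = fun=> 0); first exact: subexp_cst.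
by apply/funext => y; rewrite coefC.
Qed.

Lemma subexp_dnum T Z p k : subexp_poly T -> subexp_poly Z -> subexp_poly p ->
  subexp_poly (fun y => dnum (T y) (Z y) (p y) k).
Proof.
move=> hT hZ hp; elim: k => [//|k ih] /=; apply: subexp_poly_sub.
  apply: subexp_poly_add; apply: subexp_poly_mul => //.
  exact: subexp_poly_deriv.
by apply/subexp_poly_scale/subexp_poly_mul => //; exact: subexp_poly_deriv.
Qed.

(** The derivative is [H 0] times a function of slow growth, hence dominated by
    [G]. The description by [H], [T] and [Z] may fail at one point, outside [U]:
    for the Poisson kernel of the ball this is the pole [y = q], where only
    measurability matters. *)
Lemma L2_iterated_derivative (F H : R -> Y -> R) (T Z p : Y -> {poly R})
    (U : set Y) (c delta : R) G k :
  measurable U -> S `<=` U -> (forall y y', ~ U y -> ~ U y' -> y = y') ->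
  subexp_poly T -> subexp_poly Z -> subexp_poly p ->
  c != 0 -> (forall y, U y -> (Z y).[0] = c) ->
  (forall y, U y -> \forall s \near (0 : R), F s y = H s y * (p y).[s]) ->
  (forall y, U y -> \forall s \near (0 : R),
    is_derive s (1 : R) (H^~ y) (H s y * (T y).[s] / (Z y).[s])) ->
  measurable_fun setT (H 0) -> 0 < delta -> L2 mu G ->
  (forall y, S y -> `|H 0 y| * expR (delta * rho y) <= G y) ->
  L2 mu (fun y => ((F^~ y)^`(k))%classic 0).
Proof.
move=> mU SU subU hT hZ hp c0 Zc FE dH mH delta0 G2 HG.
pose g y := H 0 y * (dnum (T y) (Z y) (p y) k)`_0 / c ^+ k.
have [mb bB] := subexp_dnum k hT hZ hp 0%N.
have gE y : U y -> ((F^~ y)^`(k))%classic 0 = g y.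
  move=> Uy; rewrite /g -(Zc y Uy) -horner_coef0.
  have Znear : \forall s \near (0 : R), (Z y).[s] != 0.
    have : (Z y).[s] @[s --> (0 : R)] --> (Z y).[0].
      exact: continuous_horner.
    rewrite Zc// => /cvgr_neq0; exact.
  exact: nbhs_singleton (derive1n_log_rational k (FE y Uy) Znear (dH y Uy)).
have mg : measurable_fun setT g.
  by apply: measurable_funM => //; exact: measurable_funM.
have mF : measurable_fun setT (fun y => ((F^~ y)^`(k))%classic 0).
  have [UT|/existsNP[y0 nU]] := pselect (forall y, U y).
    by rewrite (_ : (fun _ => _) = g)//; apply/funext => y; exact: gE.
  pose c0' := ((F^~ y0)^`(k))%classic 0.
  rewrite (_ : (fun _ => _) = fun y => g y * \1_U y + c0' * (1 - \1_U y)).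
    apply: measurable_funD; apply: measurable_funM => //.
    by apply: measurable_funB => //; exact: measurable_indic.
  apply/funext => y; rewrite indicE; have [Uy|nUy] := pselect (U y).
    by rewrite mem_set// subrr mulr0 mulr1 addr0 gE.
  by rewrite memNset// subr0 mulr0 mulr1 add0r (subU y y0).
have [C HC] := bB _ delta0.
apply: (@L2_dominated _ _ _ mu S mS S0 _ (fun y => (C / `|c| ^+ k) * G y)) => //.
  exact: L2_scale.
move=> y Sy; rewrite gE; last exact: SU.
have G0 : 0 <= G y by apply: le_trans (HG y Sy); rewrite mulr_ge0 ?expR_ge0.
have C0 : 0 <= C.
  by have := le_trans (normr_ge0 _) (HC y Sy); rewrite pmulr_lge0 ?expR_gt0.
rewrite /g !normrM !normfV !normrX normr_id [leRHS]mulrAC.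
rewrite ler_wpM2r ?invr_ge0 ?exprn_ge0// (ger0_norm C0) (ger0_norm G0).
apply: (le_trans (ler_wpM2l (normr_ge0 _) (HC y Sy))).
by rewrite mulrCA ler_wpM2l ?HG.
Qed.
End subexponential.

(** * Integrability on the boundary of the half-space *)

Section power_decay.
Context {R : realType}.
Let leb := @lebesgue_measure R.

Lemma powRN_cvg_pinfty (q : R) : 0 < q -> (1 + x) `^ (- q) @[x --> +oo%R] --> (0 : R).
Proof.
move=> q0; apply/cvgr0Pnorm_lt => e e0; near=> x.
have x0 : 0 < 1 + x.
  by rewrite ltr_pwDl//; near: x; apply: nbhs_pinfty_ge; rewrite num_real.
rewrite ger0_norm ?powR_ge0// gt0_powRE// -[ltRHS]lnK ?posrE// ltr_expR.
rewrite mulNr ltrNl -ltr_pdivrMl// mulrC.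
have h : expR (- ln e / q) < x.
  by near: x; apply: nbhs_pinfty_gt; rewrite num_real.
by rewrite -ltr_expR lnK ?posrE// (lt_trans h)// ltrDr.
Unshelve. all: by end_near. Qed.

Lemma continuous_powRN (p : R) : continuous (fun x : R => (1 + `|x|) `^ (- p)).
Proof.
rewrite (_ : (fun x => _) = fun x => expR (- p * ln (1 + `|x|))); last first.
  by apply/funext => x; rewrite gt0_powRE// ltr_pwDl.
move=> x; apply: (continuous_cvg _ (@continuous_expR R _)).
apply: cvgM; first exact: cvg_cst.
apply: continuous_cvg; first by apply: continuous_ln; rewrite ltr_pwDl.
apply: cvgD; first exact: cvg_cst.
exact: norm_continuous.
Qed.

(** The primitive on the half-line is [- (1 + x)^-q / q]. *)
Lemma integral_powRN_lty (q : R) : 0 < q ->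
  (\int[leb]_x ((1 + `|x|) `^ (- (q + 1)))%:E < +oo)%E.
Proof.
move=> q0; have cf := @continuous_powRN (q + 1).
rewrite ge0_symfun_integralT//; last first.
- by move=> x /=; rewrite normrN.
rewrite (_ : [set x | _] = `[0, +oo[%classic); last first.
  by apply/seteqP; split => x/=; rewrite in_itv/= andbT.
pose F (x : R) := - q^-1 * (1 + x) `^ (- q).
have dF (x : R) : 0 <= x -> is_derive x (1 : R) F ((1 + x) `^ (- (q + 1))).
  move=> x0; have x1 : 0 < 1 + x by rewrite ltr_pwDl.
  have d1 : is_derive x (1 : R) (fun x : R => 1 + x) 1.
    by have := is_deriveD (is_derive_cst (1 : R) x (1 : R)) (is_derive_id x (1 : R)); rewrite add0r.
  have := @is_derive1_comp _ (fun z => z `^ (- q)) (fun x : R => 1 + x) x _ _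
    (is_derive1_powR (- q) x1) d1.
  move=> d2; apply: (@is_derive_eq _ _ _ F _ _ _ _ (is_deriveZ (- q^-1) d2)).
  rewrite /GRing.scale/= mulr1 -opprD; field.
  by rewrite gt_eqF.
rewrite (@ge0_continuous_FTC2y _ _ F 0 0)//.
- by rewrite -EFinB -EFinM ltry.
- by apply: continuous_subspaceT => x; exact: cf.
- rewrite -[X in _ --> X](mulr0 (- q^-1)); apply: cvgM; first exact: cvg_cst.
  exact: powRN_cvg_pinfty.
- by move=> x x0; have [] := dF x (ltW x0).
- apply: cvg_at_right_filter; have [dF0 _] := dF 0 (lexx 0).
  exact/differentiable_continuous/derivable1_diffP.
- move=> x; rewrite in_itv/= andbT => x0; rewrite derive1E.
  by rewrite (@derive_val _ _ _ _ _ _ _ (dF x (ltW x0))) ger0_norm ?ltW.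
Qed.
End power_decay.

Section lebesgue_tuple_products.
Context {R : realType}.
Local Notation leb n := (@lebesgue_tuple R n).

Lemma measurable_prod_tuple n (phi : R -> R) : measurable_fun setT phi ->
  measurable_fun setT (fun y : n.-tuple R => \prod_(i < n) phi (tnth y i)).
Proof.
move=> mphi; apply: measurable_prod => i _.
by apply: (measurableT_comp mphi); exact: measurable_tnth.
Qed.

Lemma integral_lebesgue_tupleS n (f : n.+1.-tuple R -> \bar R) :
  measurable_fun setT f -> (forall y, 0 <= f y)%E ->
  (\int[leb n.+1]_y f y =
   \int[(@lebesgue_measure R \x leb n)%E]_p f (tcons p))%E.
Proof.
move=> mf f0.
have f0' : {in setT, forall y, (0 <= f y)%E} by move=> y _.
have := @ge0_integral_pushforward _ _ (measurableTypeR R * n.-tuple R)%type _ R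
  (@tcons R n) (@measurable_tcons R n)
  [the measure _ _ of (@lebesgue_measure R \x leb n)%E] setT f measurableT mf f0'.
rewrite preimage_setT => h.
by transitivity (\int[pushforward (@lebesgue_measure R \x leb n)%E (@tcons R n)]_y f y)%E.
Qed.

(** Tonelli's theorem, by induction on the dimension. *)
Lemma integral_prod_tuple n (phi : R -> R) : measurable_fun setT phi ->
  (forall x, 0 <= phi x) ->
  (\int[leb n]_y (\prod_(i < n) phi (tnth y i))%:E =
   (\int[@lebesgue_measure R]_x (phi x)%:E) ^+ n)%E.
Proof.
move=> mphi phi0.
have P0 k (y : k.-tuple R) : 0 <= \prod_(i < k) phi (tnth y i) by exact: prodr_ge0.
have mP k := @measurable_prod_tuple k phi mphi.
have I0 : (0 <= \int[@lebesgue_measure R]_x (phi x)%:E)%E.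
  by apply: integral_ge0 => x _; rewrite lee_fin.
elim: n => [|n ih].
  rewrite (eq_integral (cst 1%E)); last by move=> y _; rewrite big_ord0.
  by rewrite integral_cst// mul1e /= diracT.
rewrite integral_lebesgue_tupleS; last 2 first.
- by apply/measurable_EFinP; exact: mP.
- by move=> y; rewrite lee_fin.
rewrite fubini_tonelli1; last 2 first.
- have mPE : measurable_fun setT (fun y : n.+1.-tuple R => (\prod_(i < n.+1) phi (tnth y i))%:E).
    by apply/measurable_EFinP; exact: mP.
  exact: (measurableT_comp mPE (@measurable_tcons R n)).
- by move=> y; rewrite lee_fin.
transitivity (\int[@lebesgue_measure R]_x ((phi x)%:E * (\int[@lebesgue_measure R]_x (phi x)%:E) ^+ n))%E.
  apply: eq_integral => x _; rewrite -ih /fubini_F -ge0_integralZl_EFin//; last 2 first.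
  - by move=> y _; rewrite lee_fin.
  - by apply/measurable_EFinP; exact: mP.
  apply: eq_integral => y _ /=; rewrite -EFinM big_ord_recl; congr (_ * _)%:E.
  by apply: eq_bigr => i _; rewrite (tnth_nth 0) /= (tnth_nth 0).
rewrite ge0_integralZr//; last 3 first.
- exact/measurable_EFinP.
- by move=> x _; rewrite lee_fin.
- exact: expe_ge0.
by rewrite expeS.
Qed.
End lebesgue_tuple_products.

Section euclidean_norm.
Context {R : realType}.

Lemma sqr_enorm n (x : 'rV[R]_n) : enorm x ^+ 2 = \sum_i x ord0 i ^+ 2.
Proof. by rewrite sqr_sqrtr// sumr_ge0// => i _; rewrite sqr_ge0. Qed.

Lemma enorm_ge0 n (x : 'rV[R]_n) : 0 <= enorm x.
Proof. exact: sqrtr_ge0. Qed.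

Lemma le_sqr_enorm n (x : 'rV[R]_n) i : x ord0 i ^+ 2 <= enorm x ^+ 2.
Proof.
rewrite sqr_enorm (bigD1 i)//= lerDl sumr_ge0// => j _; exact: sqr_ge0.
Qed.

Lemma sqr_enorm_vec n (y : n.-tuple R) : enorm (vec y) ^+ 2 = \sum_i tnth y i ^+ 2.
Proof. by rewrite sqr_enorm; apply: eq_bigr => i _; rewrite mxE. Qed.

Lemma enorm_eq0 n (x : 'rV[R]_n) : enorm x = 0 -> forall i, x ord0 i = 0.
Proof.
move=> x0 i; apply/eqP; rewrite -sqrf_eq0 eq_le sqr_ge0 andbT.
by have := le_sqr_enorm x i; rewrite x0 expr0n.
Qed.

Lemma measurable_sqr_dist n (x : 'rV[R]_n) :
  measurable_fun setT (fun y : n.-tuple R => enorm (x - vec y) ^+ 2).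
Proof.
rewrite (_ : (fun _ => _) = fun y => \sum_i (x ord0 i - tnth y i) ^+ 2); last first.
  by apply/funext => y; rewrite sqr_enorm; apply: eq_bigr => i _; rewrite !mxE.
apply: measurable_sum => i; apply: measurable_funX; apply: measurable_funB => //.
exact: measurable_tnth.
Qed.

Lemma measurable_sqr_enorm_vec n :
  measurable_fun setT (fun y : n.-tuple R => enorm (vec y) ^+ 2).
Proof. by apply: measurable_funX; exact: measurable_enorm. Qed.

Lemma sqr_enorm_vec_dist n (x : 'rV[R]_n) (y : n.-tuple R) :
  enorm (vec y) ^+ 2 <= 2 * enorm x ^+ 2 + 2 * enorm (x - vec y) ^+ 2.
Proof.
rewrite !sqr_enorm !mulr_sumr -big_split/=; apply: ler_sum => i _.
rewrite !mxE -subr_ge0.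
rewrite (_ : _ - _ = (2 * x ord0 i - tnth y i) ^+ 2) ?sqr_ge0//; ring.
Qed.
End euclidean_norm.

Section boundary_weight.
Context {R : realType} (n : nat).
Local Notation leb := (@lebesgue_tuple R n).
Implicit Types y : n.-tuple R.

(** The Poisson kernel of the half-space at height 1 above the origin, up to a
    factor. Multiples of it dominate the other Poisson kernels of the half-space
    and the heat kernels. *)
Definition boundary_weight y : R :=
  (1 + enorm (vec y) ^+ 2) `^ (- (n.+1%:R / 2)).

Lemma measurable_boundary_weight : measurable_fun setT boundary_weight.
Proof.
apply: (measurableT_comp (measurable_powR _)).
by apply: measurable_funD => //; exact: measurable_sqr_enorm_vec.
Qed.

Let one_le y : 1 <= 1 + enorm (vec y) ^+ 2.
Proof. by rewrite lerDl sqr_ge0. Qed.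

Let one_gt0 y : 0 < 1 + enorm (vec y) ^+ 2.
Proof. exact: lt_le_trans (one_le y). Qed.

Lemma boundary_weight_le1 y : boundary_weight y <= 1.
Proof.
by apply: (le_trans (powRN_le (b := 1) ltr01 (one_le y) _)); rewrite ?powR1.
Qed.

(** [1 + |y|^2] is at least each [1 + y_i^2], hence at least their geometric mean.
    This bounds the weight by a product of functions of one variable with
    exponent [(n + 1) / n > 1], and avoids polar coordinates. *)
Lemma boundary_weight_prod : (0 < n)%N -> forall y, boundary_weight y <=
  \prod_(i < n) (2 `^ (n.+1%:R / (2 * n%:R)) * (1 + `|tnth y i|) `^ (- (n%:R^-1 + 1))).
Proof.
move=> n0 y; set p := n.+1%:R / (2 * n%:R).
have n0' : 0 < n%:R :> R by rewrite ltr0n.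
have p0 : 0 <= p by rewrite divr_ge0// mulr_ge0// ltW.
have -> : boundary_weight y = \prod_(i < n) (1 + enorm (vec y) ^+ 2) `^ (- p).
  rewrite prodr_const card_ord -powR_mulrn ?powR_ge0// -powRrM; congr (_ `^ _).
  by rewrite /p; field; rewrite gt_eqF.
apply: ler_prod => i _; rewrite powR_ge0/=.
have h : 0 < 1 + `|tnth y i| by rewrite ltr_pwDl.
have -> : n%:R^-1 + 1 = 2 * p by rewrite /p -natr1; field; rewrite gt_eqF.
have -> : 2 `^ p * (1 + `|tnth y i|) `^ (- (2 * p)) = ((1 + `|tnth y i|) ^+ 2 / 2) `^ (- p).
  rewrite !gt0_powRE ?divr_gt0 ?exprn_gt0// ln_div ?posrE ?exprn_gt0// lnXn// -expRD.
  by congr expR; rewrite -mulr_natl; ring.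
apply: powRN_le; [by rewrite divr_gt0// exprn_gt0| |by []].
have := le_sqr_enorm (vec y) i; rewrite mxE -[X in X <= _](real_normK (num_real _)).
have := sqr_ge0 (`|tnth y i| - 1); rewrite sqrrB sqrrD; lra.
Qed.

Lemma boundary_weight_integral_lty : (\int[leb]_y (boundary_weight y)%:E < +oo)%E.
Proof.
have w0 y : (0 <= (boundary_weight y)%:E)%E by rewrite lee_fin powR_ge0.
have [n0|n0] := posnP n.
  apply: (@le_lt_trans _ _ (\int[leb]_y (\prod_(i < n) (cst 1 : R -> R) (tnth y i))%:E)%E).
    apply: ge0_le_integral_all => // y.
    by rewrite lee_fin big1 ?boundary_weight_le1.
  by rewrite (@integral_prod_tuple R n (cst 1))// n0 expe0 ltry.
pose phi (x : R) := 2 `^ (n.+1%:R / (2 * n%:R)) * (1 + `|x|) `^ (- (n%:R^-1 + 1)).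
have mphi0 : measurable_fun setT (fun x : R => (1 + `|x|) `^ (- (n%:R^-1 + 1))).
  by apply: continuous_measurable_fun; exact: continuous_powRN.
apply: (@le_lt_trans _ _ (\int[leb]_y (\prod_(i < n) phi (tnth y i))%:E)%E).
  by apply: ge0_le_integral_all => // y; rewrite lee_fin boundary_weight_prod.
rewrite integral_prod_tuple//; last 2 first.
- exact: measurable_funM.
- by move=> x; rewrite mulr_ge0 ?powR_ge0.
have : (\int[@lebesgue_measure R]_x (phi x)%:E < +oo)%E.
  have -> : (\int[@lebesgue_measure R]_x (phi x)%:E =
      \int[@lebesgue_measure R]_x ((2 `^ (n.+1%:R / (2 * n%:R)))%:E *
      ((1 + `|x|) `^ (- (n%:R^-1 + 1)))%:E))%E by [].
  rewrite ge0_integralZl_EFin ?powR_ge0//; last by apply/measurable_EFinP.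
  apply: lte_mul_pinfty; rewrite ?lee_fin ?powR_ge0//.
  by apply: integral_powRN_lty; rewrite invr_gt0 ltr0n.
have : (0 <= \int[@lebesgue_measure R]_x (phi x)%:E)%E.
  by apply: integral_ge0 => x _; rewrite lee_fin mulr_ge0 ?powR_ge0.
by case: (\int[@lebesgue_measure R]_x (phi x)%:E)%E => // r _ _; rewrite -EFin_expe ltry.
Qed.

Lemma boundary_weight_L2 : L2 leb boundary_weight.
Proof.
apply: L2I; first exact: measurable_boundary_weight.
apply: le_lt_trans boundary_weight_integral_lty.
apply: ge0_le_integral_all => y; first by rewrite lee_fin sqr_ge0.
by rewrite lee_fin expr2 ler_piMl ?powR_ge0// boundary_weight_le1.
Qed.

(** As an inverse, the constant is positive only if the integral is finite and
    nonzero; the weight is bounded below on the unit cube. *)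
Lemma poisson_cst_gt0 : 0 < @poisson_cst R n.
Proof.
have -> : @poisson_cst R n = (\int[leb]_y boundary_weight y)^-1.
  by rewrite /poisson_cst; congr (_^-1);
      apply: eq_Rintegral => y _; rewrite /boundary_weight powRN.
rewrite invr_gt0 /Rintegral fine_gt0// boundary_weight_integral_lty andbT.
pose c : R := (1 + n%:R) `^ (- (n.+1%:R / 2)).
have c0 : 0 < c by apply: powR_gt0; rewrite ltr_pwDl.
pose phi : R -> R := \1_`[0, 1].
have mphi : measurable_fun setT phi by exact: measurable_indic.
have phi0 x : 0 <= phi x by rewrite /phi indicE.
have mP := @measurable_prod_tuple R n phi mphi.
have P0 y : 0 <= \prod_(i < n) phi (tnth y i) by exact: prodr_ge0.
apply: (@lt_le_trans _ _ (\int[leb]_y (c * \prod_(i < n) phi (tnth y i))%:E)%E); last first.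
  apply: ge0_le_integral_all => y; first by rewrite lee_fin mulr_ge0// ltW.
  rewrite lee_fin.
  have [h|/existsNP[i hi]] := pselect (forall i, 0 <= tnth y i <= 1).
    rewrite big1 ?mulr1; last by move=> i _; rewrite /phi indicE mem_set//= in_itv/= h.
    apply: powRN_le => //; rewrite lerD2l sqr_enorm_vec.
    rewrite (le_trans (y := \sum_(i < n) 1))//; last by rewrite sumr_const card_ord.
    apply: ler_sum => i _; have /andP[h0 h1] := h i; exact: exprn_ile1.
  by rewrite (bigD1 i)//= {1}/phi indicE memNset/= ?mul0r ?mulr0 ?powR_ge0//.
have -> : (\int[leb]_y (c * \prod_(i < n) phi (tnth y i))%:E =
    \int[leb]_y (c%:E * (\prod_(i < n) phi (tnth y i))%:E))%E by [].
rewrite ge0_integralZl_EFin ?(ltW c0)//; last first.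
- by apply/measurable_EFinP.
- by move=> y _; rewrite lee_fin.
have I1 : (\int[@lebesgue_measure R]_x (phi x)%:E = 1)%E.
  rewrite integral_indic// setIT.
  transitivity (@lebesgue_measure R [set` `[0, 1]]); first by [].
  by rewrite lebesgue_measure_itv/= lte_fin ltr01 sube0.
rewrite integral_prod_tuple// I1 mule_gt0 ?lte_fin//.
by rewrite -EFin_expe expr1n.
Qed.

(** [1 + |y|^2] is at most a multiple of [delta + |x - y|^2]; [k] is such a
    factor. *)
Lemma shifted_weight_le (x : 'rV[R]_n) (delta : R) : 0 < delta ->
  exists C, 0 < C /\ forall y,
    (delta + enorm (x - vec y) ^+ 2) `^ (- (n.+1%:R / 2)) <= C * boundary_weight y.
Proof.
move=> delta0; pose k := 2 + (1 + 2 * enorm x ^+ 2) / delta.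
have h0 : 0 <= (1 + 2 * enorm x ^+ 2) / delta.
  by rewrite divr_ge0 ?(ltW delta0)// addr_ge0// mulr_ge0// sqr_ge0.
have k0 : 0 < k by rewrite /k; lra.
exists (k `^ (n.+1%:R / 2)); split; first exact: powR_gt0.
move=> y.
have -> : k `^ (n.+1%:R / 2) * boundary_weight y =
    ((1 + enorm (vec y) ^+ 2) / k) `^ (- (n.+1%:R / 2)).
  rewrite /boundary_weight !gt0_powRE ?divr_gt0// ln_div ?posrE// -expRD.
  by congr expR; ring.
apply: powRN_le; rewrite ?divr_gt0//.
rewrite ler_pdivrMr// /k.
have e : delta * ((1 + 2 * enorm x ^+ 2) / delta) = 1 + 2 * enorm x ^+ 2.
  by field; rewrite gt_eqF.
rewrite mulrDl !mulrDr e.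
have := sqr_enorm_vec_dist x y.
have := mulr_ge0 (sqr_ge0 (enorm (x - vec y))) h0; lra.
Qed.

(** The function [l ln t - a t] of [t = 1 + |x - y|^2] is maximal at
    [t = l / a]. *)
Lemma gaussian_weight_le (x : 'rV[R]_n) (a : R) : 0 < a ->
  exists C, 0 < C /\ forall y,
    expR (- (a * enorm (x - vec y) ^+ 2)) <= C * boundary_weight y.
Proof.
move=> a0; have [C [C0 HC]] := shifted_weight_le x ltr01.
pose l : R := n.+1%:R / 2; have l0 : 0 < l by rewrite divr_gt0.
pose K := expR (l * ln (l / a) + a - l).
exists (K * C); split; first by rewrite mulr_gt0// expR_gt0.
move=> y; rewrite -mulrA.
apply: le_trans (ler_wpM2l (expR_ge0 _) (HC y)).
set D := enorm _ ^+ 2; have D0 : 0 <= D by exact: sqr_ge0.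
have D1 : 0 < 1 + D by rewrite ltr_pwDl.
have la : 0 < l / a by rewrite divr_gt0.
rewrite gt0_powRE// -expRD ler_expR -/l.
have : ln (1 + D) - ln (l / a) <= (1 + D) / (l / a) - 1.
  rewrite -ln_div ?posrE//.
  have -> : (1 + D) / (l / a) = 1 + ((1 + D) / (l / a) - 1) by rewrite subrKC.
  rewrite {2}subrKC.
  by apply: le_ln1Dx; have := divr_gt0 D1 la; lra.
move=> /(ler_wpM2l (ltW l0)).
have -> : l * ((1 + D) / (l / a) - 1) = a * (1 + D) - l.
  by field; rewrite !gt_eqF.
lra.
Qed.
End boundary_weight.

(** * Totality of Gaussians *)

Section generation_by_coordinates.
Context {R : realType} (n : nat).
Implicit Types y : n.-tuple R.

Lemma superlevel_measurable (G : set (n.-tuple R -> R)) g :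
  let A0 := [set A | exists2 g, G g & exists c, A = [set y | c < g y]] in
  G g -> measurable_fun (setT : set (g_sigma_algebraType A0))
    (g : g_sigma_algebraType A0 -> R).
Proof.
move=> A0 Gg; apply: (measurability _ (RGenOInfty.measurableE R)).
move=> _ [_ [c ->] <-]; apply: sub_sigma_algebra; exists g => //; exists c.
by rewrite setTI; apply/seteqP; split=> y /=; rewrite in_itv/= andbT.
Qed.

(** The identity is measurable from the sigma-algebra generated by [A0] to the
    product one as soon as the coordinates are. *)
Lemma generated_by_coordinates (A0 : set (set (n.-tuple R))) :
  (forall i, measurable_fun (setT : set (g_sigma_algebraType A0))
    ((fun y => tnth y i) : g_sigma_algebraType A0 -> R)) ->
  measurable `<=` <<s A0 >>.
Proof.
move=> h A mA.
have mid : measurable_fun (setT : set (g_sigma_algebraType A0))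
    ((fun y => y) : g_sigma_algebraType A0 -> n.-tuple R).
  by apply/measurable_fun_tnthP => i; exact: h.
by have := mid measurableT A mA; rewrite setTI preimage_id.
Qed.
End generation_by_coordinates.

Section gaussians.
Context {R : realType} (n : nat).
Variables (mu : {measure set (n.-tuple R) -> \bar R}) (M : set (n.-tuple R -> R)).
Hypothesis cM : closed_class mu setT M.
Implicit Types (y : n.-tuple R) (x : 'rV[rat]_n).

Let rv x : 'rV[R]_n := map_mx ratr x.
(* These exponents are closed under addition, so that the Gaussians are closed
   under products, and they are at least the exponent (n + 1) / 2 of the Poisson
   kernel of the half-space, as domination there requires. *)
Let a b : R := (n.+1 * b.+1)%:R.
Let gauss b x y : R := expR (- (a b * enorm (rv x - vec y) ^+ 2)).

Hypothesis M_gauss : forall b x, M (gauss b x).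

Let a_gt0 b : 0 < a b. Proof. by rewrite ltr0n. Qed.

Definition gaussian_family : set (n.-tuple R -> R) :=
  [set g | exists c b x, 0 <= c <= 1 /\ g = fun y => c * gauss b x y].

(** Completing the square: the center of the product is a barycenter [x''] with
    rational weights, hence rational again. *)
Lemma gaussian_family_mul g h : gaussian_family g -> gaussian_family h ->
  gaussian_family (fun y => g y * h y).
Proof.
move=> [c [b [x [/andP[c0 c1] ->]]]] [c' [b' [x' [/andP[c'0 c'1] ->]]]].
pose b'' := (b + b').+1.
have aD : a b'' = a b + a b' by rewrite /a -natrD -mulnDr addSn addnS.
pose q : rat := (b.+1)%:R / (b''.+1)%:R.
pose q' : rat := (b'.+1)%:R / (b''.+1)%:R.
have ratioE m : ratr (m.+1%:R / (b''.+1)%:R) = a m / a b'' :> R.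
  by rewrite fmorph_div !rmorph_nat /a !natrM invfM mulrACA mulfV ?mul1r.
have qE : ratr q = a b / a b'' by exact: ratioE.
have q'E : ratr q' = a b' / a b'' by exact: ratioE.
clearbody q q'.
pose x'' := q *: x + q' *: x'.
pose k := expR (- (a b * a b' / a b'' * enorm (rv x - rv x') ^+ 2)).
exists (c * c' * k), b'', x''; split.
  rewrite !mulr_ge0 ?expR_ge0//=; apply: mulr_ile1; rewrite ?mulr_ge0 ?expR_ge0//.
    exact: mulr_ile1.
  rewrite -expR0 ler_expR oppr_le0 mulr_ge0 ?sqr_ge0// divr_ge0// ?mulr_ge0//; exact: ltW.
apply/funext => y; rewrite [LHS]mulrACA -(mulrA (c * c') k); congr (c * c' * _).
rewrite /gauss /k -!expRD; congr expR; rewrite -!opprD; congr (- _).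
rewrite !sqr_enorm !mulr_sumr -!big_split/=; apply: eq_bigr => i _.
rewrite !mxE rmorphD !rmorphM/= qE q'E aD.
have : a b + a b' != 0 by rewrite gt_eqF// addr_gt0.
move: (a b) (a b') (ratr _) (ratr _) (tnth y i) => al be t t' z ab0.
by field.
Qed.

(** A coordinate is recovered from the logarithms of two Gaussians, by
    [2 y_i = |y|^2 - |e_i - y|^2 + 1]. *)
Lemma gaussian_total : L2 mu `<=` M.
Proof.
apply: (@multiplicative_total _ _ _ mu setT M cM gaussian_family).
- move=> _ [c [b [x [_ ->]]]]; exact: (closed_class_scale cM).
- move=> _ y [c [b [x [/andP[c0 c1] ->]]]] _.
  rewrite mulr_ge0 ?expR_ge0//= mulr_ile1 ?expR_ge0//.
  by rewrite -expR0 ler_expR oppr_le0 mulr_ge0 ?sqr_ge0// ltW.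
- exact: gaussian_family_mul.
- set A0 := (X in <<s X >>); apply: generated_by_coordinates => i.
  have mdist x : measurable_fun (setT : set (g_sigma_algebraType A0))
      ((fun y => enorm (rv x - vec y) ^+ 2) : g_sigma_algebraType A0 -> R).
    have Gg : gaussian_family (gauss 0 x).
      exists 1, 0%N, x; split; first by rewrite ler01 lexx.
      by apply/funext => y; rewrite mul1r.
    have mg := superlevel_measurable Gg.
    rewrite (_ : (fun _ => _) = fun y => - (a 0)^-1 * ln (gauss 0 x y)).
      by apply: measurable_funM => //; exact: (measurableT_comp (@measurable_ln R) mg).
    apply/funext => y; rewrite /gauss expRK; field.
    by rewrite gt_eqF.
  rewrite (_ : (fun y => tnth y i) = fun y => 2^-1 *
      (enorm (rv 0 - vec y) ^+ 2 - enorm (rv (delta_mx ord0 i) - vec y) ^+ 2 + 1)).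
    apply: measurable_funM => //; apply: measurable_funD => //.
    by apply: measurable_funB; exact: mdist.
  apply/funext => y; rewrite !sqr_enorm -sumrB (bigD1 i)//= big1 ?addr0.
    by rewrite !mxE !eqxx /= rmorph0 rmorph1; field.
  by move=> j ji; rewrite !mxE eqxx/= (negbTE ji) rmorph0 subrr.
- exists (gauss 0 0).
    exists 1, 0%N, 0; split; first by rewrite ler01 lexx.
    by apply/funext => y; rewrite mul1r.
  by move=> y _; exact: expR_gt0.
Qed.
End gaussians.

(** * Totality of heat kernels and of Poisson kernels of the half-space *)

Lemma bernoulli_ineq {R : realType} (x : R) m : 0 <= x ->
  1 + x *+ m <= (1 + x) ^+ m.
Proof.
move=> x0; elim: m => [|m ih]; first by rewrite mulr0n addr0 expr0.
rewrite exprS mulrDl mul1r mulrSr addrA lerD// ler_peMr//.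
by rewrite exprn_ege1// lerDl.
Qed.

Section half_space_totality.
Context {R : realType} (n : nat).
Local Notation leb := (@lebesgue_tuple R n).
Implicit Types (y : n.-tuple R) (x : 'rV[rat]_n).

Definition half_space_point (c : rat) x : 'rV[rat]_n.+1 :=
  \row_i (if unlift ord0 i is Some j then x ord0 j else c).

Lemma half_space_point0 c x :
  (map_mx ratr (half_space_point c x) : 'rV[R]_n.+1) ord0 ord0 = ratr c.
Proof. by rewrite !mxE unlift_none. Qed.

Lemma base_half_space_point c x :
  base_pt (map_mx ratr (half_space_point c x)) = map_mx ratr x :> 'rV[R]_n.
Proof. by apply/rowP => i; rewrite !mxE liftK. Qed.

Variable M : set (n.-tuple R -> R).
Hypothesis cM : closed_class leb setT M.

(** A Gaussian with exponent [a] is the heat kernel at time [1 / (4 a)], up to a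
    factor. *)
Lemma heat_total :
  (forall t : 'rV[rat]_n.+1, domain n CauchyHeat (map_mx ratr t : 'rV[R]_n.+1) ->
    M (repr_kernel n CauchyHeat (map_mx ratr t : 'rV[R]_n.+1))) ->
  L2 leb `<=` M.
Proof.
move=> MK; apply: gaussian_total => // b x.
set a : R := (n.+1 * b.+1)%:R; have a0 : 0 < a by rewrite ltr0n.
pose c : rat := (4 * (n.+1 * b.+1)%:R)^-1.
have cE : ratr c = (4 * a)^-1 :> R by rewrite fmorphV rmorphM !rmorph_nat.
clearbody a.
have c0 : 0 < ratr c :> R by rewrite cE invr_gt0 mulr_gt0.
have := MK (half_space_point c x).
rewrite /domain/= half_space_point0 c0 => /(_ isT).
rewrite /heat_kernel half_space_point0 base_half_space_point cE.
set k := (_ `^ _); have k0 : 0 < k by rewrite powR_gt0// mulr_gt0 ?invr_gt0 ?mulr_gt0 ?pi_gt0.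
move=> /(closed_class_scale cM k^-1); congr M; apply/funext => y.
rewrite mulrA mulVf ?gt_eqF// mul1r; congr expR; congr (- _).
by field; rewrite gt_eqF.
Qed.

Lemma poisson_half_space_power c x : 0 < ratr c :> R ->
  forall y, poisson_half_space (map_mx ratr (half_space_point c x)) y =
    (@poisson_cst R n * ratr c) *
    (ratr c ^+ 2 + enorm (map_mx ratr x - vec y) ^+ 2) `^ (- (n.+1%:R / 2)).
Proof.
move=> c0 y; rewrite /poisson_half_space half_space_point0 base_half_space_point.
by rewrite powRN mulrA.
Qed.

(** At a point of height [c], the Poisson kernel is a multiple of
    [(c^2 + rho)^-((n + 1) / 2)] with [rho = |x - y|^2], so that [closed_class_exp]
    yields Gaussians. The sequence of heights is [k + 1], and the exponents
    [j = (k + 1)^2 a] are chosen integral with [j / s = a]. *)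
Lemma half_space_total :
  (forall t : 'rV[rat]_n.+1, domain n DirichletHalfSpace (map_mx ratr t : 'rV[R]_n.+1) ->
    M (repr_kernel n DirichletHalfSpace (map_mx ratr t : 'rV[R]_n.+1))) ->
  L2 leb `<=` M.
Proof.
move=> MK; apply: gaussian_total => // b x.
set a : R := (n.+1 * b.+1)%:R.
pose rho y : R := enorm (map_mx ratr x - vec y) ^+ 2.
have rho0 y : 0 <= rho y by exact: sqr_ge0.
pose l : R := n.+1%:R / 2; have l0 : 0 < l by rewrite divr_gt0.
pose A : set R := [set s | exists c : rat, 0 < ratr c :> R /\ s = ratr c ^+ 2].
have MA s : A s -> M (fun y => (s + rho y) `^ (- l)).
  move=> [c [c0 ->]]; have := MK (half_space_point c x).
  rewrite /domain/= half_space_point0 c0 => /(_ isT).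
  have k0 : 0 < @poisson_cst R n * ratr c by rewrite mulr_gt0// poisson_cst_gt0.
  move=> /(closed_class_scale cM (@poisson_cst R n * ratr c)^-1); congr M.
  apply/funext => y; rewrite poisson_half_space_power//.
  by rewrite mulrA mulVf ?gt_eqF// mul1r.
apply: (@closed_class_exp _ _ _ _ _ _ cM rho A _ _ _ _ l a
  (fun k => k.+1%:R ^+ 2) (fun k => (k.+1 ^ 2 * (n.+1 * b.+1))%N)
  (fun y => (1 + rho y) `^ (- l))) => //.
- exact: measurable_sqr_dist.
- by move=> s [c [c0 ->]]; rewrite exprn_gt0.
- move=> s [c [c0 ->]].
  have hE i : ratr (c * (1 + i.+1%:R^-1)) = ratr c * (1 + i.+1%:R^-1) :> R.
    by rewrite rmorphM rmorphD rmorph1 fmorphV rmorph_nat.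
  have hpos i : ratr c < ratr c * (1 + i.+1%:R^-1) :> R.
    by rewrite ltr_pMr// ltrDl invr_gt0.
  exists (fun i => (ratr c * (1 + i.+1%:R^-1)) ^+ 2); split.
    move=> i; split.
      exists (c * (1 + i.+1%:R^-1)); rewrite hE; split => //.
      exact: lt_trans (hpos i).
    by rewrite ltrXn2r ?nnegrE// ?ltW// (lt_trans c0).
  have hcv : ratr c * (1 + i.+1%:R^-1) @[i --> \oo] --> (ratr c * (1 + 0) : R).
    apply: cvgM; first exact: cvg_cst.
    by apply: cvgD; [exact: cvg_cst|exact: cvg_harmonic].
  have h2 := cvgM hcv hcv; rewrite addr0 mulr1 -expr2 in h2.
  exact: h2.
- move=> k; exists k.+1%:R; rewrite rmorph_nat; split => //.
- have h := cvgM (@cvg_harmonic R) (@cvg_harmonic R); rewrite mulr0 in h.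
  suff e : (fun k => (k.+1%:R ^+ 2)^-1 : R) = (fun k => k.+1%:R^-1 * k.+1%:R^-1).
    by rewrite e; exact: h.
  by apply/funext => k; rewrite expr2 invfM.
- suff -> : (fun k => (k.+1 ^ 2 * (n.+1 * b.+1))%:R / k.+1%:R ^+ 2 : R) = fun=> a.
    exact: cvg_cst.
  by apply/funext => k; rewrite natrM natrX mulrAC mulfV ?mul1r.
- have [C [C0 HC]] := shifted_weight_le (map_mx ratr x : 'rV[R]_n) ltr01.
  apply: (L2_bounded (C := C) _ (@boundary_weight_L2 R n)).
    apply: (measurableT_comp (measurable_powR _)).
    by apply: measurable_funD => //; exact: measurable_sqr_dist.
  move=> y; rewrite !ger0_norm ?powR_ge0//; exact: HC.
(* Bernoulli's inequality 1 + rho <= (1 + rho / s)^s and a >= (n + 1) / 2 show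
   that the functions stay below (1 + rho)^-((n + 1) / 2). *)
- move=> k y _; set s : R := k.+1%:R ^+ 2.
  have s0 : 0 < s by rewrite exprn_gt0.
  have x0 : 0 <= rho y / s by rewrite divr_ge0// ltW.
  have h1 : 1 + rho y <= (1 + rho y / s) ^+ (k.+1 ^ 2).
    have : 1 + rho y / s *+ (k.+1 ^ 2) <= (1 + rho y / s) ^+ (k.+1 ^ 2).
      exact: bernoulli_ineq.
    by rewrite -mulr_natr natrX divfK ?gt_eqF.
  have h2 : ln (1 + rho y) <= s * ln (1 + rho y / s).
    have z0 : 0 < 1 + rho y / s by rewrite ltr_pwDl.
    have -> : s * ln (1 + rho y / s) = ln ((1 + rho y / s) ^+ (k.+1 ^ 2)).
      by rewrite lnXn// -mulr_natl natrX.
    by rewrite ler_ln ?posrE ?exprn_gt0// ltr_pwDl.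
  have h3 : 0 <= ln (1 + rho y) by rewrite ln_ge0// lerDl.
  have h4 : 0 <= ln (1 + rho y / s) by rewrite ln_ge0// lerDl.
  rewrite !gt0_powRE ?ltr_pwDl// ler_expR !mulNr lerN2 mulrDl.
  apply: ler_wpDl; first by rewrite mulr_ge0// ltW.
  rewrite natrM natrX -/s -/a (mulrC s) -(mulrA a); apply: ler_pM.
  - exact: ltW.
  - exact: h3.
  - by rewrite /l /a ler_pdivrMr// -natrM ler_nat -mulnA leq_pmulr.
  - exact: h2.
Qed.
End half_space_totality.

(** * The measure of the sphere *)

Section sphere.
Context {R : realType} (n : nat).
Local Notation leb := (@lebesgue_tuple R n.+1).
Local Notation sigma := (@sphere_measure R n.+1).
Implicit Types y : n.+1.-tuple R.

Definition unit_sphere : set (n.+1.-tuple R) := [set y | enorm (vec y) = 1].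

Lemma measurable_unit_sphere : measurable unit_sphere.
Proof.
rewrite (_ : unit_sphere = setT `&` (fun y => enorm (vec y)) @^-1` [set 1]).
  exact: measurable_enorm.
by rewrite setTI.
Qed.

(** The indicator of [B] is at most the product of the indicators of [A] at the
    coordinates. *)
Lemma lebesgue_cube (A : set R) (B : set (n.+1.-tuple R)) : measurable A ->
  measurable B -> (forall y, B y -> forall i, A (tnth y i)) ->
  (leb B <= @lebesgue_measure R A ^+ n.+1)%E.
Proof.
move=> mA mB BA.
have mphi : measurable_fun setT (\1_A : R -> R) by exact: measurable_indic.
have -> : @lebesgue_measure R A = (\int[@lebesgue_measure R]_x (\1_A x)%:E)%E.
  by rewrite integral_indic// setIT.
rewrite -integral_prod_tuple//.
rewrite -[X in leb X]setIT -integral_indic//.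
apply: ge0_le_integral_all => y; first by rewrite lee_fin indicE.
rewrite lee_fin indicE; have [By|nBy] := pselect (B y).
  rewrite mem_set// big1// => i _; rewrite indicE mem_set//; exact: BA.
by rewrite memNset// prodr_ge0// => i _; rewrite indicE.
Qed.

Lemma lebesgue_uball_lty : (leb (@uball R n.+1) < +oo)%E.
Proof.
have h : (leb (@uball R n.+1) <= @lebesgue_measure R [set` `[(-1)%R, 1%R]] ^+ n.+1)%E.
  apply: lebesgue_cube => //; first exact: measurable_uball.
  move=> y; rewrite /uball/= => y1 i; rewrite in_itv/= -ler_norml.
  rewrite -(@expr_le1 _ 2)// real_normK ?num_real//.
  have := le_sqr_enorm (vec y) i; rewrite mxE => /le_trans; apply.
  by apply: exprn_ile1; rewrite ?enorm_ge0// ltW.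
have I2 : (@lebesgue_measure R [set` `[(-1)%R, 1%R]] = 2%:E)%E.
  rewrite lebesgue_measure_itv/= lte_fin ifT; last lra.
  by rewrite -EFinB opprK.
by apply: (le_lt_trans h); rewrite I2 -EFin_expe ltry.
Qed.

Lemma lebesgue_origin : leb [set y | enorm (vec y) = 0] = 0%E.
Proof.
apply/eqP; rewrite eq_le measure_ge0 andbT.
have h : (leb [set y | enorm (vec y) = 0%R] <= @lebesgue_measure R [set 0%R] ^+ n.+1)%E.
  apply: lebesgue_cube => //.
    rewrite (_ : [set _ | _] = setT `&` (fun y => enorm (vec y)) @^-1` [set 0]).
      exact: measurable_enorm.
    by rewrite setTI.
  by move=> y /= y0 i; have := enorm_eq0 y0 i; rewrite mxE.
by apply: (le_trans h); rewrite lebesgue_measure_set1 expeS mul0e.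
Qed.

Lemma sphere_measureE A : sigma A =
  ((`|fine (leb (@uball R n.+1))|^-1)%:E * leb (@radial R n.+1 @^-1` A `&` @uball R n.+1))%E.
Proof. by []. Qed.

(** The radial projection maps every point but the origin to the sphere. *)
Lemma sphere_measure_carrier : sigma (~` unit_sphere) = 0%E.
Proof.
suff h0 : leb (@radial R n.+1 @^-1` (~` unit_sphere) `&` @uball R n.+1) = 0%E.
  by rewrite sphere_measureE h0 mule0.
apply/eqP; rewrite eq_le measure_ge0 andbT -lebesgue_origin.
apply: le_measure; rewrite ?inE.
- apply: measurableI; last exact: measurable_uball.
  rewrite -[X in measurable X]setTI; apply: measurable_radial => //.
  by apply: measurableC; exact: measurable_unit_sphere.
- rewrite (_ : [set _ | _] = setT `&` (fun y => enorm (vec y)) @^-1` [set 0]).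
    exact: measurable_enorm.
  by rewrite setTI.
- move=> y [/= ry _]; apply: contrapT => y0; apply: ry; rewrite /unit_sphere/=.
  have yp : 0 < enorm (vec y) by rewrite lt0r enorm_ge0 andbT; apply/eqP.
  apply/eqP; rewrite -(@eqrXn2 _ 2)// ?enorm_ge0// expr1n sqr_enorm_vec.
  rewrite (eq_bigr (fun i => (enorm (vec y))^-2 * tnth y i ^+ 2)); last first.
    by move=> i _; rewrite tnth_mktuple exprMn exprVn mulrC.
  by rewrite -mulr_sumr -sqr_enorm_vec mulVf// sqrf_eq0 gt_eqF.
Qed.

Lemma sphere_measure_lty : (sigma setT < +oo)%E.
Proof.
rewrite sphere_measureE preimage_setT setTI lte_mul_pinfty// ?lee_fin ?invr_ge0//.
exact: lebesgue_uball_lty.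
Qed.

Lemma L2_sphere_cst c : L2 sigma (fun=> c).
Proof.
apply: L2I => //; rewrite integral_cst//.
by rewrite lte_mul_pinfty ?lee_fin ?sqr_ge0// sphere_measure_lty.
Qed.
End sphere.

(** * Totality of the Poisson kernels of the ball *)

Lemma enorm_exprE {R : realType} n (x : 'rV[R]_n) m :
  enorm x ^+ m = (enorm x ^+ 2) `^ (m%:R / 2).
Proof.
rewrite -[enorm x ^+ 2]powR_mulrn ?enorm_ge0// -powRrM mulrC divfK ?pnatr_eq0//.
by rewrite powR_mulrn ?enorm_ge0.
Qed.

Section ball_totality.
Context {R : realType} (n : nat).
Local Notation sigma := (@sphere_measure R n.+1).
Local Notation S := (@unit_sphere R n).
Implicit Types (y : n.+1.-tuple R) (e : 'rV[rat]_n.+1).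

Let rv e : 'rV[R]_n.+1 := map_mx ratr e.
Let dot e y : R := \sum_i ratr (e ord0 i) * tnth y i.
Let sq e : R := enorm (rv e) ^+ 2.
(* An upper bound of e . y on the sphere whose form is easy to check, as
   2 e_i y_i <= e_i^2 + y_i^2. *)
Let bound e : R := n.+1%:R + sq e.
Let tau e (r : R) : R := (r^-1 + r * sq e) / 2.

Let sq_ge0 e : 0 <= sq e. Proof. exact: sqr_ge0. Qed.

Let bound_ge1 e : 1 <= bound e.
Proof. by rewrite /bound -natr1 -addrA addrCA lerDl addr_ge0. Qed.

Lemma dot_le_bound e y : S y -> dot e y <= bound e.
Proof.
move=> y1; rewrite /bound /sq sqr_enorm.
have -> : n.+1%:R = \sum_(i < n.+1) (1 : R) by rewrite sumr_const card_ord.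
rewrite -big_split/=.
apply: ler_sum => i _; rewrite !mxE.
have := le_sqr_enorm (vec y) i; rewrite mxE y1 expr1n.
have := sqr_ge0 (ratr (e ord0 i) - tnth y i : R).
have := sqr_ge0 (ratr (e ord0 i) : R); nra.
Qed.

Lemma measurable_dot e : measurable_fun setT (dot e).
Proof.
apply: measurable_sum => i; apply: measurable_funM => //.
exact: measurable_tnth.
Qed.

(** Hence the Poisson kernel at [r e] is, on the sphere, a multiple of a power of
    [tau - e . y]; and [tau] tends to infinity as [r] tends to 0. *)
Lemma sqr_dist_sphere e (r : rat) y : 0 < ratr r :> R -> S y ->
  enorm (rv (r *: e) - vec y) ^+ 2 = 2 * ratr r * (tau e (ratr r) - dot e y).
Proof.
move=> r0 y1; transitivity (ratr r ^+ 2 * sq e - 2 * ratr r * dot e y + enorm (vec y) ^+ 2).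
  rewrite /sq !sqr_enorm /dot !mulr_sumr.
  rewrite -sumrB -big_split/=; apply: eq_bigr => i _.
  by rewrite !mxE rmorphM/=; ring.
by rewrite (y1 : enorm (vec y) = 1) /tau; field; rewrite gt_eqF.
Qed.

Variable M : set (n.+1.-tuple R -> R).
Hypothesis cM : closed_class sigma S M.
Hypothesis MK : forall t : 'rV[rat]_n.+1,
  domain n DirichletBall (map_mx ratr t : 'rV[R]_n.+1) ->
  M (repr_kernel n DirichletBall (map_mx ratr t : 'rV[R]_n.+1)).

Let l : R := n.+1%:R / 2.
Let l_gt0 : 0 < l. Proof. by rewrite divr_gt0. Qed.

(* The condition on r keeps r e in the ball and makes tau exceed the bound, so
   that s is positive. *)
Let A e : set R := [set s | exists r : rat,
  [/\ 0 < ratr r :> R, ratr r * (2 * bound e + 1) < 1 & s = tau e (ratr r) - bound e]].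

Let small_inv e (r : R) : 0 < r -> r * (2 * bound e + 1) < 1 -> 2 * bound e + 1 < r^-1.
Proof. by move=> r0 h; rewrite -[r^-1]mul1r ltr_pdivlMr// mulrC. Qed.

Let tau_gt e (r : R) : 0 < r -> r * (2 * bound e + 1) < 1 -> bound e < tau e r.
Proof.
move=> r0 /(small_inv r0) h; rewrite /tau.
have := mulr_ge0 (ltW r0) (sq_ge0 e); lra.
Qed.

Lemma ball_power e s : A e s -> M (fun y => (s + (bound e - dot e y)) `^ (- l)).
Proof.
move=> [r [r0 rb ->]]; have b1 := bound_ge1 e; have q0 := sq_ge0 e.
have rlt1 : ratr r * bound e < 1 by lra.
have sqx : enorm (rv (r *: e)) ^+ 2 = ratr r ^+ 2 * sq e.
  rewrite /sq !sqr_enorm mulr_sumr; apply: eq_bigr => i _.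
  by rewrite !mxE rmorphM/= exprMn.
have x1 : enorm (rv (r *: e)) ^+ 2 < 1.
  rewrite sqx; apply: (@le_lt_trans _ _ ((ratr r * bound e) ^+ 2)).
    rewrite [leRHS]exprMn; apply: ler_wpM2l; first exact: sqr_ge0.
    have : sq e <= bound e by rewrite lerDr.
    by move=> h; rewrite (le_trans h)// expr2 ler_peMl// (le_trans ler01).
  by rewrite expr_lt1// mulr_ge0 ?ltW// (lt_le_trans ltr01).
have := @MK (r *: e); rewrite /domain/= -(@expr_lt1 _ 2) ?enorm_ge0// x1 => /(_ isT) MKe.
pose k : R := (1 - enorm (rv (r *: e)) ^+ 2) * (2 * ratr r) `^ (- l).
have k0 : 0 < k by rewrite mulr_gt0 ?subr_gt0// powR_gt0// mulr_gt0.
apply: (closed_class_ae cM (closed_class_scale cM k^-1 MKe)).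
  apply: (measurableT_comp (measurable_powR _)).
  apply: measurable_funD => //; apply: measurable_funB => //; exact: measurable_dot.
move=> y Sy; have dpos : 0 < tau e (ratr r) - dot e y.
  by rewrite subr_gt0 (le_lt_trans (dot_le_bound e Sy))// tau_gt.
rewrite /poisson_ball (enorm_exprE _ n.+1) sqr_dist_sphere// -powRN -/l.
rewrite (_ : _ + (_ - _) = tau e (ratr r) - dot e y); last by ring.
have r2 : 0 <= 2 * ratr r :> R by rewrite mulr_ge0// ltW.
have -> := powRM (- l) r2 (ltW dpos).
by rewrite [X in _ * X]mulrA -/k mulrA mulVf ?mul1r ?gt_eqF.
Qed.

(** Here [closed_class_exp] is applied with [rho = bound - e . y], along the points
    [e / (k + K0)] of the ball and with exponents [j = k]; then [s] is [k / 2] up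
    to a bounded error, whence the factor 2. *)
Lemma ball_exponential e : M (fun y => expR (- (2 * (bound e - dot e y)))).
Proof.
have b1 := bound_ge1 e; have q0 := sq_ge0 e.
pose K0 := (Num.truncn (2 * bound e + 1)).+1.
have K0b : 2 * bound e + 1 < K0%:R by exact: truncnS_gt.
pose z k : R := (k + K0)%:R.
have z0 k : 0 < z k by rewrite ltr0n addnS.
have zb k : 2 * bound e + 1 < z k by rewrite (lt_le_trans K0b)// ler_nat leq_addl.
pose s k := tau e (z k)^-1 - bound e.
have sE k : s k = (z k + (z k)^-1 * sq e) / 2 - bound e by rewrite /s /tau invrK.
have rest k : 0 <= (z k)^-1 * sq e <= sq e.
  rewrite mulr_ge0 ?invr_ge0 ?(ltW (z0 k))//= ler_piMl// invf_le1 ?z0//.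
  by apply: le_trans (ltW (zb k)); lra.
have s_ge k : (k%:R + 1) / 2 <= s k.
  rewrite sE; have /andP[h _] := rest k.
  by move: (_^-1 * _) h => t h; rewrite /z natrD; lra.
have s0 k : 0 < s k by apply: lt_le_trans (s_ge k); rewrite divr_gt0// ltr_wpDl.
have scv : (s k)^-1 @[k --> \oo] --> (0 : R).
  apply: (@squeeze_cvgr _ _ _ _ (fun=> 0) (fun k => 2 * k.+1%:R^-1)).
  - apply: nearW => k; rewrite invr_ge0 (ltW (s0 k))/=.
    by rewrite -[2]invrK -invfM lef_pV2 ?posrE ?mulr_gt0 ?invr_gt0// mulrC -natr1.
  - exact: cvg_cst.
  - have := cvgM (cvg_cst (2 : R)) (@cvg_harmonic R); rewrite mulr0; exact.
pose C : R := K0%:R + sq e.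
have jcv : k%:R / s k @[k --> \oo] --> (2 : R).
  apply: (@squeeze_cvgr _ _ _ _ (fun k => 2 - C * (s k)^-1) (fun=> 2)).
  - apply: nearW => k; rewrite ler_pdivrMr// ler_pdivlMr// mulrBl mulfVK ?gt_eqF//.
    have /andP[h1 h2] := rest k; rewrite sE /C.
    by move: (_^-1 * _) h1 h2 => t h1 h2; rewrite /z natrD; apply/andP; split; lra.
  - have := cvgB (cvg_cst (2 : R)) (cvgM (cvg_cst C) scv).
    by rewrite mulr0 subr0; exact.
  - exact: cvg_cst.
apply: (@closed_class_exp _ _ _ _ _ _ cM (fun y => bound e - dot e y) (A e) _ _ _ _ l 2
  s id (fun=> 1)) => //.
- by apply: measurable_funB => //; exact: measurable_dot.
- by move=> y Sy; rewrite subr_ge0 dot_le_bound.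
- by move=> _ [r [r0 rb ->]]; rewrite subr_gt0 tau_gt.
- move=> _ [r [r0 rb ->]].
  pose u i : R := 1 - i.+2%:R^-1.
  have u01 i : 0 < u i < 1.
    by rewrite subr_gt0 invf_lt1// ltr1n/= gtrBl invr_gt0.
  have uE i : ratr (r * (1 - i.+2%:R^-1)) = ratr r * u i :> R.
    by rewrite rmorphM rmorphB rmorph1 fmorphV rmorph_nat.
  exists (fun i => tau e (ratr r * u i) - bound e); split.
    move=> i; have /andP[ui0 ui1] := u01 i.
    have ru0 : 0 < ratr r * u i by rewrite mulr_gt0.
    have rul : ratr r * u i < ratr r by rewrite gtr_pMr.
    have rub : ratr r * u i * (2 * bound e + 1) < 1.
      by apply: lt_trans rb; rewrite ltr_pM2r//; lra.
    split; first by exists (r * (1 - i.+2%:R^-1)); rewrite uE.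
    rewrite ltrBlDr subrK /tau ltr_pM2r ?invr_gt0//.
    have h1 := small_inv r0 rb; have h2 := small_inv ru0 rub.
    rewrite -subr_gt0 (_ : _ - _ = (ratr r - ratr r * u i) *
        ((ratr r)^-1 * (ratr r * u i)^-1 - sq e)).
      rewrite mulr_gt0 ?subr_gt0//.
      have sb : sq e < 2 * bound e + 1.
        have : sq e <= bound e by rewrite lerDr.
        lra.
      apply: (lt_trans sb); apply: (lt_trans h1).
      by rewrite ltr_pMr ?invr_gt0//; lra.
    by field; rewrite !gt_eqF.
  have ucv : ratr r * u i @[i --> \oo] --> (ratr r * (1 - 0) : R).
    apply: cvgM; first exact: cvg_cst.
    apply: cvgB; first exact: cvg_cst.
    by have := @cvg_harmonic R; rewrite -cvg_shiftS; exact.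
  rewrite subr0 mulr1 in ucv.
  apply: cvgB; last exact: cvg_cst.
  apply: cvgM; last exact: cvg_cst.
  apply: cvgD; first by apply: cvgV => //; rewrite gt_eqF.
  by apply: cvgM => //; exact: cvg_cst.
- by move=> s'; exact: ball_power.
- move=> k; exists (k + K0)%:R^-1; rewrite fmorphV rmorph_nat; split => //.
  + by rewrite invr_gt0; exact: (z0 k).
  + by rewrite mulrC (ltr_pdivrMr _ _ (z0 k)) mul1r; exact: (zb k).
- exact: L2_sphere_cst.
- move=> k y Sy.
  have h1 : 1 <= 1 + (bound e - dot e y) / s k.
    by rewrite lerDl divr_ge0 ?(ltW (s0 k))// subr_ge0 dot_le_bound.
  have h2 : 0 <= l + k%:R by rewrite addr_ge0// ltW.
  by have := powRN_le ltr01 h1 h2; rewrite powR1.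
Qed.

(** The constants [c] normalize the exponentials to values in [0, 1]. *)
Definition exponential_family : set (n.+1.-tuple R -> R) :=
  [set g | exists c e, [/\ 0 <= c, forall y, S y -> c * expR (2 * dot e y) <= 1 &
    g = fun y => c * expR (2 * dot e y)]].

Lemma exponential_familyI e :
  exponential_family (fun y => expR (- (2 * bound e)) * expR (2 * dot e y)).
Proof.
exists (expR (- (2 * bound e))), e; split; [exact: expR_ge0| |by []].
move=> y Sy; rewrite -expRD -[leRHS]expR0 ler_expR.
by have := dot_le_bound e Sy; lra.
Qed.

Lemma ball_total : L2 sigma `<=` M.
Proof.
apply: (@multiplicative_total _ _ _ sigma S M cM exponential_family).
- move=> _ [c [e [_ _ ->]]].
  have := closed_class_scale cM (c * expR (2 * bound e)) (ball_exponential e).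
  congr M; apply/funext => y; rewrite -mulrA -expRD; congr (_ * expR _); ring.
- move=> _ y [c [e [c0 ce ->]]] Sy.
  by rewrite mulr_ge0 ?expR_ge0//= ce.
- move=> _ _ [c [e [c0 ce ->]]] [c' [e' [c'0 ce' ->]]].
  have dotD y : dot (e + e') y = dot e y + dot e' y.
    by rewrite /dot -big_split/=; apply: eq_bigr => i _; rewrite mxE rmorphD mulrDl.
  have eq y : c * c' * expR (2 * dot (e + e') y) =
      (c * expR (2 * dot e y)) * (c' * expR (2 * dot e' y)).
    by rewrite mulrACA -expRD dotD mulrDr.
  exists (c * c'), (e + e'); split.
  + exact: mulr_ge0.
  + by move=> y Sy; rewrite eq mulr_ile1 ?mulr_ge0 ?expR_ge0// ?ce ?ce'.
  + by apply/funext => y; rewrite eq.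
- set A0 := (X in <<s X >>); apply: generated_by_coordinates => i.
  pose e : 'rV[rat]_n.+1 := delta_mx ord0 i.
  have mg := superlevel_measurable (exponential_familyI e).
  rewrite (_ : (fun y => tnth y i) = fun y => 2^-1 *
     ln (expR (- (2 * bound e)) * expR (2 * dot e y)) + bound e).
    apply: measurable_funD => //; apply: measurable_funM => //.
    exact: (measurableT_comp (@measurable_ln R) mg).
  apply/funext => y; rewrite -expRD expRK.
  have -> : dot e y = tnth y i.
    rewrite /dot (bigD1 i)//= big1 ?addr0; first by rewrite mxE !eqxx rmorph1 mul1r.
    by move=> j ji; rewrite mxE (negbTE ji) andbF rmorph0 mul0r.
  by field.
- exists (fun y => expR (- (2 * bound 0)) * expR (2 * dot 0 y)).
    exact: exponential_familyI.
  by move=> y _; rewrite mulr_gt0 ?expR_gt0.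
Qed.
End ball_totality.

(** * Derivatives of Poisson kernels *)

Section newtonian_derivatives.
Context {R : realType} {d : measure_display} {Y : measurableType d} {N : nat}.
Variables (mu : {measure set Y -> \bar R}) (S : set Y).
Hypothesis mS : measurable S.
Hypothesis S0 : mu (~` S) = 0%E.
Variables (lam : Y -> 'rV[R]_N) (q v : 'rV[R]_N) (l : R).
Hypothesis mlam : forall i, measurable_fun setT (fun y => lam y ord0 i).
Implicit Types (s : R) (y : Y).

Let Q s y := enorm (q + s *: v - lam y) ^+ 2.
Let Q0 y := enorm (q - lam y) ^+ 2.
(* The coefficients of Z = Q / Q0. *)
Let b1 y := (2 * \sum_i (q - lam y) ord0 i * v ord0 i) / Q0 y.
Let b2 y := enorm v ^+ 2 / Q0 y.
Let Z y : {poly R} := 1%:P + (b1 y)%:P * 'X + (b2 y)%:P * 'X^2.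

Lemma sqr_enorm_line (x w : 'rV[R]_N) s :
  enorm (x + s *: w) ^+ 2 =
  enorm x ^+ 2 + (2 * \sum_i x ord0 i * w ord0 i) * s + enorm w ^+ 2 * s ^+ 2.
Proof.
rewrite !sqr_enorm mulr_sumr !mulr_suml -!big_split/=; apply: eq_bigr => i _.
by rewrite !mxE; ring.
Qed.

Let ZE s y : (Z y).[s] = 1 + b1 y * s + b2 y * s ^+ 2.
Proof. by rewrite /Z !(hornerD, hornerM, hornerC, hornerX, hornerXn). Qed.

Let QE s y : Q0 y != 0 -> Q s y = Q0 y * (Z y).[s].
Proof.
move=> Qy; rewrite /Q (_ : q + s *: v - lam y = (q - lam y) + s *: v); last by rewrite addrAC.
by rewrite sqr_enorm_line -/(Q0 y) ZE /b1 /b2; field.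
Qed.

Let Q00 y : Q 0 y = Q0 y. Proof. by rewrite /Q scale0r addr0. Qed.

Let mQ0 : measurable_fun setT Q0.
Proof.
rewrite (_ : Q0 = fun y => \sum_i (q ord0 i - lam y ord0 i) ^+ 2).
  apply: measurable_sum => i; apply: measurable_funX; exact: measurable_funB.
by apply/funext => y; rewrite /Q0 sqr_enorm; apply: eq_bigr => i _; rewrite !mxE.
Qed.

Let mQ0V : measurable_fun setT (fun y => (Q0 y)^-1).
Proof. exact: (measurableT_comp (@measurable_invr R) mQ0). Qed.

Lemma inner_product_bound (x w : 'rV[R]_N) :
  `|2 * \sum_i x ord0 i * w ord0 i| <= enorm x ^+ 2 + enorm w ^+ 2.
Proof.
rewrite !sqr_enorm -big_split/= mulr_sumr; apply: (le_trans (ler_norm_sum _ _ _)).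
apply: ler_sum => i _; rewrite ler_norml; apply/andP; split.
  have := sqr_ge0 (x ord0 i + w ord0 i); rewrite sqrrD; lra.
have := sqr_ge0 (x ord0 i - w ord0 i); rewrite sqrrB; lra.
Qed.

Variable delta : R.
Hypothesis delta0 : 0 < delta.
Hypothesis Qdelta : forall y, S y -> delta <= Q0 y.

(* Slow growth with respect to this function is boundedness. *)
Let zero : Y -> R := fun=> 0.

Let b1_bounded : subexp S zero b1.
Proof.
split.
  apply: measurable_funM => //; apply: measurable_funM => //.
  apply: measurable_sum => i; apply: measurable_funM => //.
  rewrite (_ : (fun _ => _) = fun y => q ord0 i - lam y ord0 i).
    exact: measurable_funB.
  by apply/funext => y; rewrite !mxE.
move=> t _; exists (1 + enorm v ^+ 2 / delta) => y Sy.
have Qp : 0 < Q0 y by exact: lt_le_trans (Qdelta Sy).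
rewrite mulr0 expR0 mulr1 /b1 normrM normfV (gtr0_norm Qp) ler_pdivrMr//.
apply: (le_trans (inner_product_bound _ _)); rewrite mulrDl mul1r lerD2l.
by rewrite mulrAC ler_pdivlMr// ler_wpM2l ?sqr_ge0 ?Qdelta.
Qed.

Let b2_bounded : subexp S zero b2.
Proof.
split; first exact: measurable_funM.
move=> t _; exists (enorm v ^+ 2 / delta) => y Sy.
have Qp : 0 < Q0 y by exact: lt_le_trans (Qdelta Sy).
rewrite mulr0 expR0 mulr1 ger0_norm; last by rewrite divr_ge0 ?sqr_ge0// ltW.
by rewrite ler_wpM2l ?sqr_ge0// lef_pV2 ?posrE// Qdelta.
Qed.

(** Both Poisson kernels are, along a line, a polynomial times [Q `^ (- l)] where
    [Q] is a squared distance. The quotient [Z = Q / Q0] is a quadratic polynomial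
    with bounded coefficients and value 1 at 0, and the logarithmic derivative of
    [Q `^ (- l)] is [- l Z' / Z]. *)
Lemma L2_newtonian_derivative (F : R -> Y -> R) (num : {poly R}) G k :
  (forall y y', Q0 y = 0 -> Q0 y' = 0 -> y = y') ->
  (forall s y, 0 < Q s y -> F s y = num.[s] * Q s y `^ (- l)) ->
  L2 mu G -> (forall y, S y -> Q0 y `^ (- l) <= G y) ->
  L2 mu (fun y => ((F^~ y)^`(k))%classic 0).
Proof.
move=> inj FE G2 HG.
have zero0 y : S y -> 0 <= zero y by [].
have hZ : subexp_poly S zero Z.
  apply: subexp_poly_add; first apply: subexp_poly_add.
  - exact: subexp_poly_cst.
  - by apply: subexp_poly_mul => //; [exact: (subexp_polyC zero0 b1_bounded)|
      exact: subexp_poly_cst].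
  - by apply: subexp_poly_mul => //; [exact: (subexp_polyC zero0 b2_bounded)|
      exact: subexp_poly_cst].
have Q0ge y : 0 <= Q0 y by exact: sqr_ge0.
have Z0 y : (Z y).[0] = 1 by rewrite ZE expr0n/= !mulr0 !addr0.
have Zpos y : \forall s \near (0 : R), 0 < (Z y).[s].
  have : (Z y).[s] @[s --> (0 : R)] --> (Z y).[0] by exact: continuous_horner.
  by rewrite Z0 => /cvgr_gt; apply; exact: ltr01.
apply: (@L2_iterated_derivative _ _ _ mu S zero mS S0 zero0 F (fun s y => Q s y `^ (- l))
  (fun y => (- l) *: (Z y)^`()) Z (fun=> num) [set y | 0 < Q0 y] 1 1 G k) => //.
- exact: measurable_superlevel.
- by move=> y Sy; exact: lt_le_trans (Qdelta Sy).
- move=> y y' /negP Hy /negP Hy'; apply: inj; apply/eqP.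
    by rewrite eq_le Q0ge andbT leNgt.
  by rewrite eq_le Q0ge andbT leNgt.
- by apply: subexp_poly_scale => //; exact: subexp_poly_deriv.
- exact: subexp_poly_cst.
- move=> y Qy; have := Zpos y; apply: filterS => s Zs.
  have Qs : Q s y = Q0 y * (Z y).[s] by apply: QE; rewrite gt_eqF.
  rewrite (FE s y); first exact: mulrC.
  by rewrite Qs; exact: mulr_gt0.
- move=> y Qy; have := Zpos y; apply: filterS => s Zs.
  have Qn0 : Q0 y != 0 by rewrite gt_eqF.
  have QZ : 0 < Q0 y * (Z y).[s] by rewrite mulr_gt0.
  rewrite (_ : (fun s => Q s y `^ (- l)) =
    (fun z => z `^ (- l)) \o (Q0 y \*: horner (Z y))); last first.
    by apply/funext => t; rewrite /= QE.
  have := @is_derive1_comp R (fun z => z `^ (- l)) (Q0 y \*: horner (Z y)) s _ _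
    (is_derive1_powR (- l) QZ)
    (is_deriveZ (Q0 y) (is_derive_poly (Z y) s)).
  move=> dd; apply: is_derive_eq dd _.
  rewrite powRNB1// QE// hornerZ /GRing.scale/=.
  move: (Z y)^`().[s] (Z y).[s] (Q0 y) Zs Qn0 {QZ} => z' z c z0 c0.
  by field; rewrite c0 gt_eqF.
- apply: (measurableT_comp (measurable_powR (- l))).
  by rewrite (_ : Q 0 = Q0)//; apply/funext.
- move=> y Sy; rewrite /zero mulr0 expR0 mulr1 ger0_norm ?powR_ge0// Q00.
  exact: HG.
Qed.
End newtonian_derivatives.

(** * Derivatives of heat kernels *)

Lemma horner_log_derivative {R : realType} (tau N : {poly R}) (c v0 s : R) :
  (c *: tau - 4^-1 *: (N^`() * tau - v0 *: N)).[s] =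
  c * tau.[s] - 4^-1 * (N^`().[s] * tau.[s] - v0 * N.[s]).
Proof. by rewrite !(hornerD, hornerN, hornerM, hornerZ). Qed.

Section heat_derivatives.
Context {R : realType} (n : nat).
Local Notation leb := (@lebesgue_tuple R n).
Variables (q v : 'rV[R]_n.+1).
Hypothesis q0 : 0 < q ord0 ord0.
Implicit Types (s : R) (y : n.-tuple R).

Let t := q ord0 ord0.
Let v0 := v ord0 ord0.
Let tau : {poly R} := t%:P + v0%:P * 'X.
Let N0 y := enorm (base_pt q - vec y) ^+ 2.
Let N1 y := 2 * \sum_i (base_pt q - vec y) ord0 i * base_pt v ord0 i.
Let N2 : R := enorm (base_pt v) ^+ 2.
Let Np y : {poly R} := (N0 y)%:P + (N1 y)%:P * 'X + N2%:P * 'X^2.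

Let tauE s : tau.[s] = t + v0 * s.
Proof. by rewrite /tau !(hornerD, hornerM, hornerC, hornerX). Qed.

Let NE s y : (Np y).[s] = enorm (base_pt (q + s *: v) - vec y) ^+ 2.
Proof.
rewrite (_ : base_pt (q + s *: v) - vec y = (base_pt q - vec y) + s *: base_pt v).
  by rewrite sqr_enorm_line /Np !(hornerD, hornerM, hornerC, hornerX, hornerXn).
by apply/rowP => i; rewrite !mxE addrAC.
Qed.

Let heatE s y : heat_kernel (q + s *: v) y =
  (4 * pi * tau.[s]) `^ (- (n%:R / 2)) * expR (- ((Np y).[s] / (4 * tau.[s]))).
Proof. by rewrite /heat_kernel NE tauE !mxE mulrC [v _ _ * s]mulrC mulrC. Qed.

Let N00 y : 0 <= N0 y. Proof. exact: sqr_ge0. Qed.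

Lemma subexp_le (b1 b2 : n.-tuple R -> R) (rho : n.-tuple R -> R) :
  measurable_fun setT b1 -> (forall y, `|b1 y| <= `|b2 y|) ->
  subexp setT rho b2 -> subexp setT rho b1.
Proof.
move=> m1 le12 [_ h2]; split => // e e0; have [C HC] := h2 e e0.
by exists C => y Sy; rewrite (le_trans (le12 y))// HC.
Qed.

Let N0_subexp : subexp setT N0 N0.
Proof.
split; first exact: measurable_sqr_dist.
move=> e e0; exists e^-1 => y _; rewrite ger0_norm// ler_pdivlMl//.
by apply: le_trans (expR_ge1Dx _); rewrite lerDr.
Qed.

Let N1_subexp : subexp setT N0 N1.
Proof.
have N00' y : setT y -> 0 <= N0 y by [].
apply: (@subexp_le _ (fun y => N0 y + N2)).
- apply: measurable_funM => //; apply: measurable_sum => i; apply: measurable_funM => //.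
  rewrite (_ : (fun _ => _) = fun y => base_pt q ord0 i - tnth y i).
    by apply: measurable_funB => //; exact: measurable_tnth.
  by apply/funext => y; rewrite !mxE.
- move=> y; rewrite [leRHS]ger0_norm; first exact: inner_product_bound.
  by rewrite addr_ge0// sqr_ge0.
- by apply: subexp_add => //; exact: subexp_cst.
Qed.

Let is_derive_heat s y : 0 < tau.[s] ->
  is_derive s (1 : R) (fun s => heat_kernel (q + s *: v) y)
    (heat_kernel (q + s *: v) y *
     ((- (n%:R / 2 * v0)) *: tau - 4^-1 *: ((Np y)^`() * tau - v0 *: Np y)).[s]
     / (tau ^+ 2).[s]).
Proof.
move=> ts; have tn0 : tau.[s] != 0 by rewrite gt_eqF.
have pin0 : pi != 0 :> R by rewrite gt_eqF// pi_gt0.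
have pt : 0 < ((4 * pi) *: tau).[s] by rewrite hornerZ !mulr_gt0// pi_gt0.
have t4 : ((4 : R) *: tau).[s] != 0 by rewrite hornerZ mulf_neq0.
pose A := (fun z => z `^ (- (n%:R / 2))) \o horner ((4 * pi) *: tau).
pose B := horner (Np y) * (fun s => (((4 : R) *: tau).[s])^-1).
have e : (fun s => heat_kernel (q + s *: v) y) = A * (expR \o (- B)).
  by apply/funext => z; rewrite heatE /A /B !fctE /= !hornerZ.
have dA : is_derive s (1 : R) A _ := @is_derive1_comp R (fun z => z `^ (- (n%:R / 2)))
  (horner ((4 * pi) *: tau)) s _ _ (is_derive1_powR (- (n%:R / 2)) pt)
  (is_derive_poly ((4 * pi) *: tau) s).
have dB : is_derive s (1 : R) B _ := is_deriveM (is_derive_poly (Np y) s)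
     (is_deriveV t4 (is_derive_poly ((4 : R) *: tau) s)).
have dE : is_derive s (1 : R) (expR \o (- B)) _ :=
  @is_derive1_comp R expR (- B) s _ _ (is_derive_expR _) (is_deriveN dB).
rewrite e; apply: (is_derive_eq (is_deriveM dA dE) _).
rewrite heatE /A /B !fctE /= !hornerZ powRNB1; last by rewrite -hornerZ.
rewrite !derivZ !hornerZ horner_log_derivative horner_exp /GRing.scale/=.
have -> : tau^`().[s] = v0.
  by rewrite /tau derivD derivC derivM derivC derivX mul0r !add0r mulr1 hornerC.
move: (expR _) (_ `^ _) => ex pw; move: (Np y).[s] ((Np y)^`()).[s] => Ns N's.
move: pi tau.[s] pin0 tn0 {pt t4 dA dB dE} => p ts' p0 ts0.
by field; rewrite p0 ts0.
Qed.

(** Along a line, the time [tau] is affine and the squared distance [Np] is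
    quadratic, with coefficients that grow at most like [|x - y|^2]; the
    logarithmic derivative of the kernel has the denominator [tau^2]. *)
Lemma L2_heat_derivative k :
  L2 leb (fun y => ((fun s => heat_kernel (q + s *: v) y)^`(k))%classic 0).
Proof.
have N00' y : setT y -> 0 <= N0 y by [].
have hN : subexp_poly setT N0 Np.
  apply: subexp_poly_add; last exact: subexp_poly_cst.
  apply: subexp_poly_add; first exact: subexp_polyC.
  by apply: subexp_poly_mul => //; [exact: (subexp_polyC N00' N1_subexp)|exact: subexp_poly_cst].
(* Half of the exponent 1 / (4 t) of the kernel is left for the coefficients to
   absorb. *)
pose a : R := (8 * t)^-1; have a0 : 0 < a by rewrite invr_gt0 mulr_gt0.
have [C [C0 HC]] := gaussian_weight_le (base_pt q) a0.
pose c : R := (4 * pi * t) `^ (- (n%:R / 2)).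
have tau0 : tau.[0] = t by rewrite tauE mulr0 addr0.
have taupos : \forall s \near (0 : R), 0 < tau.[s].
  have : tau.[s] @[s --> (0 : R)] --> tau.[0] by exact: continuous_horner.
  by rewrite tau0 => /cvgr_gt; apply.
have HE y : heat_kernel (q + 0 *: v) y = c * expR (- (N0 y / (4 * t))).
  by rewrite scale0r addr0.
apply: (@L2_iterated_derivative _ _ _ leb setT N0 measurableT _ N00'
  (fun s y => heat_kernel (q + s *: v) y) (fun s y => heat_kernel (q + s *: v) y)
  (fun y => (- (n%:R / 2 * v0)) *: tau - 4^-1 *: ((Np y)^`() * tau - v0 *: Np y))
  (fun=> tau ^+ 2) (fun=> 1%:P) setT (t ^+ 2) a (fun y => c * (C * boundary_weight y)) k) => //.
- by rewrite setCT measure0.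
- by move=> y y' [].
- apply: subexp_poly_sub => //; first exact: subexp_poly_cst.
  apply: subexp_poly_scale => //; apply: subexp_poly_sub => //.
    apply: subexp_poly_mul => //; first exact: subexp_poly_deriv.
    exact: subexp_poly_cst.
  exact: subexp_poly_scale.
- exact: subexp_poly_cst.
- exact: subexp_poly_cst.
- by rewrite expf_neq0// gt_eqF.
- by move=> y _; rewrite horner_exp tau0.
- by move=> y _; near=> s; rewrite hornerC mulr1.
- by move=> y _; move: taupos; apply: filterS => s; exact: is_derive_heat.
- rewrite (_ : (fun _ => _) = fun y => c * expR (- (N0 y / (4 * t)))); last exact/funext.
  apply: measurable_funM => //; apply: measurableT_comp => //.
  apply: measurableT_comp => //; apply: measurable_funM => //.
  exact: measurable_sqr_dist.
- by apply: L2_scale; apply: L2_scale; exact: boundary_weight_L2.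
- move=> y _; rewrite HE ger0_norm; last by rewrite mulr_ge0 ?powR_ge0 ?expR_ge0.
  rewrite -mulrA ler_wpM2l ?powR_ge0// -expRD; apply: le_trans (HC y).
  rewrite ler_expR -/(N0 y) /a le_eqVlt; apply/orP; left; apply/eqP.
  by field; rewrite gt_eqF.
Unshelve. all: by end_near. Qed.
End heat_derivatives.

(** * Multiple kernels and the expansion *)

Section poisson_derivatives.
Context {R : realType} (n : nat).
Variables (q v : 'rV[R]_n.+1).

(** From [|y|^2 <= (1 + c^-1) |q - y|^2 + (1 + c) |q|^2] with [|y| = 1], where [c]
    is so small that [(1 + c) |q|^2 < 1]. *)
Lemma sphere_dist_lower : enorm q < 1 -> exists2 delta : R, 0 < delta &
  forall y, unit_sphere y -> delta <= enorm (q - vec y) ^+ 2.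
Proof.
move=> q1; set a := enorm q ^+ 2.
have a0 : 0 <= a by exact: sqr_ge0.
have a1 : a < 1 by rewrite expr_lt1// enorm_ge0.
pose c := (1 - a) / 2; have c0 : 0 < c by rewrite divr_gt0// subr_gt0.
have d0 : 0 < 1 - (1 + c) * a.
  rewrite (_ : _ - _ = (1 - a) * (1 - a / 2)); last by rewrite /c; field.
  by apply: mulr_gt0; lra.
exists ((1 - (1 + c) * a) / (1 + c^-1)).
  by rewrite divr_gt0// addr_gt0// invr_gt0.
move=> y y1; rewrite ler_pdivrMr ?addr_gt0 ?invr_gt0// lerBlDr.
have H : enorm (vec y) ^+ 2 <= enorm (q - vec y) ^+ 2 * (1 + c^-1) + (1 + c) * a.
  rewrite /a !sqr_enorm mulr_suml mulr_sumr -big_split/=; apply: ler_sum => i _.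
  rewrite !mxE -subr_ge0.
  rewrite (_ : _ - _ = (c * q ord0 i + (q ord0 i - tnth y i)) ^+ 2 / c).
    by rewrite divr_ge0 ?sqr_ge0// ltW.
  have cn0 : c != 0 by rewrite gt_eqF.
  by clearbody c; field.
by rewrite (y1 : enorm (vec y) = 1) expr1n in H.
Qed.

Lemma L2_poisson_ball_derivative k : enorm q < 1 ->
  L2 (@sphere_measure R n.+1)
    (fun y => ((fun s => poisson_ball (q + s *: v) y)^`(k))%classic 0).
Proof.
move=> q1; have [delta delta0 Hd] := sphere_dist_lower q1.
pose l : R := n.+1%:R / 2.
pose num : {poly R} := (1 - enorm q ^+ 2)%:P -
  (2 * \sum_i q ord0 i * v ord0 i)%:P * 'X - (enorm v ^+ 2)%:P * 'X^2.
apply: (@L2_newtonian_derivative _ _ _ _ _ _ (@measurable_unit_sphere R n)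
  (@sphere_measure_carrier R n) (@vec R n.+1) q v l _ delta delta0 Hd _ num
  (fun=> delta `^ (- l)) k).
- move=> i; rewrite (_ : (fun _ => _) = (fun y => tnth y i)); first exact: measurable_tnth.
  by apply/funext => y; rewrite mxE.
- have vecE y : enorm (q - vec y) ^+ 2 = 0 -> forall i, tnth y i = q ord0 i.
    move=> /eqP; rewrite sqrf_eq0 => /eqP/enorm_eq0 h i.
    by have := h i; rewrite !mxE => /subr0_eq.
  by move=> y y' /vecE h /vecE h'; apply: eq_from_tnth => i; rewrite h h'.
- move=> s y _; rewrite /poisson_ball (enorm_exprE _ n.+1) -powRN -/l; congr (_ * _).
  rewrite sqr_enorm_line /num !(hornerD, hornerN, hornerM, hornerC, hornerX, hornerXn).
  ring.
- exact: L2_sphere_cst.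
- move=> y Sy; apply: powRN_le => //; first exact: Hd.
  by rewrite divr_ge0.
Qed.

(** The boundary point [y] as a point of the closed half-space; then the Poisson
    kernel is, up to a factor, a power of the distance to it, as in the ball. *)
Definition half_space_lift (y : n.-tuple R) : 'rV[R]_n.+1 :=
  \row_i (if unlift ord0 i is Some j then tnth y j else 0).

Lemma sqr_dist_half_space (x : 'rV[R]_n.+1) y :
  enorm (x - half_space_lift y) ^+ 2 =
  x ord0 ord0 ^+ 2 + enorm (base_pt x - vec y) ^+ 2.
Proof.
rewrite !sqr_enorm big_ord_recl !mxE unlift_none subr0; congr (_ + _).
by apply: eq_bigr => i _; rewrite !mxE liftK.
Qed.

Lemma L2_poisson_half_space_derivative k : 0 < q ord0 ord0 ->
  L2 (@lebesgue_tuple R n)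
    (fun y => ((fun s => poisson_half_space (q + s *: v) y)^`(k))%classic 0).
Proof.
move=> q0; have d0 : 0 < q ord0 ord0 ^+ 2 by rewrite exprn_gt0.
have Hd y : setT y -> q ord0 ord0 ^+ 2 <= enorm (q - half_space_lift y) ^+ 2.
  by move=> _; rewrite sqr_dist_half_space lerDl sqr_ge0.
pose l : R := n.+1%:R / 2.
pose num : {poly R} := (@poisson_cst R n)%:P * ((q ord0 ord0)%:P + (v ord0 ord0)%:P * 'X).
have [C [C0 HC]] := shifted_weight_le (base_pt q) d0.
have nul : @lebesgue_tuple R n (~` setT) = 0%E by rewrite setCT measure0.
apply: (@L2_newtonian_derivative _ _ _ _ _ setT measurableT nul
  half_space_lift q v l _ _ d0 Hd _ num (fun y => C * boundary_weight y) k).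
- move=> i; case: (unliftP ord0 i) => [j ->|->].
    rewrite (_ : (fun _ => _) = (fun y => tnth y j)); first exact: measurable_tnth.
    by apply/funext => y; rewrite mxE liftK.
  rewrite (_ : (fun _ => _) = fun=> 0)//.
  by apply/funext => y; rewrite mxE unlift_none.
- by move=> y y' h _; have := lt_le_trans d0 (Hd y I); rewrite h ltxx.
- move=> s y _; rewrite /poisson_half_space -sqr_dist_half_space -powRN -/l mulrA.
  congr (_ * _).
  by rewrite /num !(hornerM, hornerD, hornerC, hornerX) !mxE [s * _]mulrC.
- exact/L2_scale/boundary_weight_L2.
- by move=> y _; rewrite sqr_dist_half_space; exact: HC.
Qed.
End poisson_derivatives.

Section kernels.
Context {R : realType} (n : nat) (s : problem).

(** A set of full measure on which the formulas of the kernels are usable: the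
    surface measure is defined on all tuples. *)
Definition carrier : set ((bdim n s).-tuple R) :=
  match s with
  | DirichletBall => @unit_sphere R n
  | DirichletHalfSpace | CauchyHeat => setT
  end.

Lemma measurable_carrier : measurable carrier.
Proof. by rewrite /carrier; case: s => //; exact: measurable_unit_sphere. Qed.

Lemma bmeasure_carrier : bmeasure n s (~` carrier) = 0%E.
Proof.
rewrite /carrier; case: s => /=; last 2 first.
- by rewrite setCT measure0.
- by rewrite setCT measure0.
exact: sphere_measure_carrier.
Qed.

Lemma L2_kernel_derivative (q v : 'rV[R]_n.+1) k : domain n s q ->
  L2 (bmeasure n s) (fun y => ((fun t => repr_kernel n s (q + t *: v) y)^`(k))%classic 0).
Proof.
case: s => /= Dq.
- exact: L2_poisson_ball_derivative.
- exact: L2_poisson_half_space_derivative.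
- exact: L2_heat_derivative.
Qed.

Lemma kernel_total M : closed_class (bmeasure n s) carrier M ->
  (forall t : 'rV[rat]_n.+1, domain n s (map_mx ratr t : 'rV[R]_n.+1) ->
    M (repr_kernel n s (map_mx ratr t : 'rV[R]_n.+1))) ->
  L2 (bmeasure n s) `<=` M.
Proof.
move: M; rewrite /carrier; case: s => M /= cM MK.
- exact: ball_total.
- exact: half_space_total.
- exact: heat_total.
Qed.
End kernels.

Theorem theorem4 (R : realType) (n : nat) (s : problem)
    (d : measure_display) (Omega : measurableType d) (P : probability Omega R)
    (f : Omega -> (bdim n s).-tuple R -> R) (q v : nat -> 'rV[R]_n.+1) :
  let mu : {measure set ((bdim n s).-tuple R) -> \bar R} := bmeasure n s in
  let D : set 'rV[R]_n.+1 := domain n s in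
  let K := repr_kernel n s in
  let E := E_ mu K q v in
  let Kt := mkernel K q v in
  let u := lift_fun mu K in
  random_L2 mu P f ->
  max_selection mu D K q v P f ->
  [/\ cvg_random_L2 mu P
        (fun m w y => \sum_(k < m) inner mu (f w) (E k) * E k y) f,
      cvg_random_H2 mu P D K
        (fun m w x => \sum_(k < m) inner mu (f w) (E k) * u (E k) x)
        (fun w => u (f w)) &
      exists a : nat -> nat -> R,
        let c := kernel_coef mu K q v f a in
        [/\ forall k y, E k y = \sum_(j < k.+1) a k j * Kt j y,
            forall m w x, D x ->
              \sum_(k < m) inner mu (f w) (E k) * u (E k) x =
              \sum_(j < m) c m j w * u (Kt j) x &
            cvg_random_H2 mu P D K
              (fun m w x => \sum_(j < m) c m j w * u (Kt j) x)
              (fun w => u (f w))]].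
Proof.
move=> mu D K E Kt u f2 sel.
have K2 p : D p -> L2 mu (K p).
  move=> Dp; have := L2_kernel_derivative 0 0 Dp; congr L2.
  by apply/funext => y; rewrite derive1n0 scaler0 addr0.
have Kt2 k : L2 mu (Kt k).
  by have [Dq _ _ _] := sel k; exact: L2_kernel_derivative.
exact: (random_expansion (@measurable_carrier R n s) (@bmeasure_carrier R n s)
  K2 Kt2 (@kernel_total R n s) f2 sel).
Qed.
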